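(* Let $R$ be a commutative noetherian ring and $A$ a finite projective $R$-algebra. Then the following conditions are equivalent: (a) $A$ is a Gorenstein $R$-algebra; (b) for each $\mathfrak p\in\operatorname{supp}_R A$ the local ring $R_{\mathfrak p}$ is Gorenstein and the ring $A_{k(\mathfrak p)}$ is Iwanaga--Gorenstein; (c) for each maximal element $\mathfrak m$ of $\operatorname{supp}_R A$ (with respect to inclusion) the local ring $R_{\mathfrak m}$ is Gorenstein and the ring $A_{k(\mathfrak m)}$ is Iwanaga--Gorenstein.
   Context: A finite projective $R$-algebra is an associative $R$-algebra (structure map $R\to Z(A)$ into the centre) that is finitely generated and projective as an $R$-module. $\operatorname{supp}_R A=\{\mathfrak p\in\operatorname{Spec}R\mid A_{\mathfrak p}\neq 0\}$. For $\mathfrak p\in\operatorname{Spec}R$, $k(\mathfrak p)$ is the residue field of $R_{\mathfrak p}$ and $A_{k(\mathfrak p)}=A\otimes_R k(\mathfrak p)$. A commutative noetherian local ring is Gorenstein if it has finite injective dimension over itself. An associative ring $\Lambda$ is Iwanaga--Gorenstein if it is noetherian on both sides and has finite injective dimension as a left and as a right module over itself. An associative ring $A$ is a Gorenstein $R$-algebra if it is a finite projective $R$-algebra and $A_{\mathfrak p}$ is Iwanaga--Gorenstein for each $\mathfrak p\in\operatorname{supp}_R A$. *)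

(* Defs.v *)
From HB Require Import structures.
From mathcomp Require Import all_boot all_algebra.
From mathcomp Require Import boolp.

Set Implicit Arguments.
Unset Strict Implicit.
Unset Printing Implicit Defensive.

Import GRing.Theory.
Local Open Scope ring_scope.
Local Open Scope quotient_scope.

(* Associative algebras over a commutative ring [R].  The library's [algType R]
   excludes the zero algebra, which is allowed here. *)
Record centralAlgType (R : comPzRingType) := CentralAlgebra {
  calg_ring : pzRingType;
  calg_map : {rmorphism R -> calg_ring};
  calg_mapC : forall r a, calg_map r * a = a * calg_map r
}.

Definition calg_sort (R : comPzRingType) (A : centralAlgType R) : Type :=
  calg_ring A.
Coercion calg_sort : centralAlgType >-> Sortclass.

Section CentralAlgebraModule.
Variables (R : comPzRingType) (A : centralAlgType R).

HB.instance Definition _ := GRing.PzRing.copy (calg_sort A) (calg_ring A).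

Definition calg_scale (r : R) (a : A) : A := calg_map A r * a.

Fact calg_scaleA r s a : calg_scale r (calg_scale s a) = calg_scale (r * s) a.
Proof. by rewrite /calg_scale rmorphM mulrA. Qed.

Fact calg_scale1 : left_id 1 calg_scale.
Proof. by move=> a; rewrite /calg_scale rmorph1 mul1r. Qed.

Fact calg_scaleDr : right_distributive calg_scale +%R.
Proof. by move=> r a b; rewrite /calg_scale mulrDr. Qed.

Fact calg_scaleDl a : {morph calg_scale^~ a : r s / r + s}.
Proof. by move=> r s; rewrite /calg_scale rmorphD mulrDl. Qed.

HB.instance Definition _ := GRing.Zmodule_isLmodule.Build R (calg_sort A)
  calg_scaleA calg_scale1 calg_scaleDr calg_scaleDl.

Lemma calgZE (r : R) (a : A) : r *: a = (calg_map A r : A) * a.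
Proof. by []. Qed.

Lemma centralAl (r : R) (a b : A) : r *: (a * b) = (r *: a) * b.
Proof. by rewrite !calgZE mulrA. Qed.

Lemma centralAr (r : R) (a b : A) : r *: (a * b) = a * (r *: b).
Proof. by rewrite !calgZE !mulrA; congr (_ * _); exact: calg_mapC. Qed.
End CentralAlgebraModule.

Definition regular_algebra (R : comPzRingType) : centralAlgType R :=
  @CentralAlgebra R R idfun (@mulrC R).

Section Modules.
Variable R : pzRingType.

Definition finitely_generated (M : lmodType R) (S : {pred M}) : Prop :=
  exists (n : nat) (g : 'I_n -> M), (forall i, g i \in S) /\
    forall x, x \in S -> exists c : 'I_n -> R, x = \sum_(i < n) c i *: g i.

Definition projective_module (P : lmodType R) : Prop :=
  forall (M N : lmodType R) (f : {linear M -> N}) (g : {linear P -> N}),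
    (forall y, exists x, f x = y) ->
    exists h : {linear P -> M}, forall x, f (h x) = g x.

Definition injective_module (E : lmodType R) : Prop :=
  forall (M N : lmodType R) (f : {linear M -> N}) (g : {linear M -> E}),
    injective f -> exists h : {linear N -> E}, forall x, h (f x) = g x.

(* There is an exact sequence 0 -> M -> I_0 -> I_1 -> ... of injective modules
   with I_i = 0 for i > n. *)
Definition finite_injdim (M : lmodType R) : Prop :=
  exists (n : nat) (I : nat -> lmodType R) (eta : {linear M -> I 0%N})
         (d : forall i, {linear I i -> I i.+1}),
    [/\ forall i, injective_module (I i),
        injective eta,
        forall x, d 0%N x = 0 <-> exists y, x = eta y,
        forall i x, d i.+1 x = 0 <-> exists y, x = d i y
      & forall i, (n < i)%N -> forall x : I i, x = 0].

Definition left_noetherian : Prop :=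
  forall I : {pred R^o}, GRing.submod_closed I -> finitely_generated I.
End Modules.

(* Right [L]-modules are left modules over the converse ring [L^c]. *)
Definition iwanaga_gorenstein (L : pzRingType) : Prop :=
  [/\ left_noetherian L, left_noetherian L^c,
      finite_injdim L^o & finite_injdim (L^c)^o].

(* The Gorenstein property is only defined for a noetherian local ring [S]; here
   it is only applied to localizations at a prime of a noetherian ring. *)
Definition gorenstein_local (S : comPzRingType) : Prop := finite_injdim S^o.

Definition finite_projective (R : comPzRingType) (A : centralAlgType R) : Prop :=
  finitely_generated (predT : {pred A}) /\ projective_module A.

Record prime_ideal (R : comPzRingType) := PrimeIdeal {
  prime_pred :> {pred R};
  prime_pred0 : 0 \in prime_pred;
  prime_predD : {in prime_pred &, forall x y, x + y \in prime_pred};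
  prime_predM : forall a, {in prime_pred, forall x, a * x \in prime_pred};
  prime_pred1 : 1 \notin prime_pred;
  prime_predP : forall x y,
    x * y \in prime_pred -> (x \in prime_pred) || (y \in prime_pred)
}.

Section Localization.
Variables (R : comPzRingType) (p : prime_ideal R) (A : centralAlgType R).

Definition denominator := {s : R | s \notin p}.

Fact denom_mul_subproof (s t : denominator) : val s * val t \notin p.
Proof.
apply/negP => /prime_predP /orP[].
- exact/negP/(valP s).
- exact/negP/(valP t).
Qed.
Definition denom1 : denominator := exist _ 1 (prime_pred1 p).
Definition denom_mul (s t : denominator) : denominator :=
  exist _ (val s * val t) (denom_mul_subproof s t).

Definition fracrel (x y : A * denominator) : bool :=
  `[< exists u : denominator,
        val u *: (val y.2 *: x.1) = val u *: (val x.2 *: y.1) >].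

Fact fracrel_refl : reflexive fracrel.
Proof. by move=> x; apply/asboolP; exists denom1. Qed.

Fact fracrel_sym : symmetric fracrel.
Proof. by move=> x y; apply/asboolP/asboolP => -[u e]; exists u. Qed.

Fact fracrel_trans : transitive fracrel.
Proof.
move=> [b t] [a s] [c w] /asboolP[u /= e] /asboolP[v /= f].
apply/asboolP; exists (denom_mul (denom_mul u v) t) => /=.
have := congr1 ( *:%R (val v * val w)) e.
have := congr1 ( *:%R (val u * val s)) f.
rewrite !scalerA => f' e'.
have -> : val u * val v * val t * val w = val v * val w * val u * val t.
  by rewrite (AC 4 (2*4*1*3)).
have -> : val u * val v * val t * val s = val u * val s * val v * val t.
  by rewrite (AC 4 (1*4*2*3)).
rewrite e' -f'; congr (_ *: _).
by rewrite (AC 4 (3*4*1*2)).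
Qed.

Canonical fracrel_equiv :=
  EquivRel fracrel fracrel_refl fracrel_sym fracrel_trans.

Definition localization := {eq_quot fracrel}.
HB.instance Definition _ : EqQuotient _ fracrel localization :=
  EqQuotient.on localization.
HB.instance Definition _ := Choice.on localization.

Definition frac (a : A) (s : denominator) : localization :=
  \pi_localization (a, s).

Lemma frac_eqP a s b t :
  frac a s = frac b t <->
  exists u : denominator, val u *: (val t *: a) = val u *: (val s *: b).
Proof.
split=> [/eqmodP/= /asboolP //|e].
by apply/eqmodP => /=; apply/asboolP.
Qed.

Lemma fracW (P : localization -> Prop) :
  (forall a s, P (frac a s)) -> forall x, P x.
Proof. by move=> H; elim/quotW => -[a s]; apply: H. Qed.

Definition fracadd (x y : A * denominator) :=
  (val y.2 *: x.1 + val x.2 *: y.1, denom_mul x.2 y.2).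
Definition fracopp (x : A * denominator) := (- x.1, x.2).
Definition fracmul (x y : A * denominator) := (x.1 * y.1, denom_mul x.2 y.2).

Definition loc_add := lift_op2 localization fracadd.
Definition loc_opp := lift_op1 localization fracopp.
Definition loc_mul := lift_op2 localization fracmul.

Fact loc_addE a s b t : loc_add (frac a s) (frac b t) =
  frac (val t *: a + val s *: b) (denom_mul s t).
Proof.
rewrite /frac; unlock loc_add.
case: piP => -[a' s'] /frac_eqP[u /= eu]; case: piP => -[b' t'] /frac_eqP[v /= ev].
apply/esym/frac_eqP; exists (denom_mul u v) => /=.
rewrite !scalerDr; congr (_ + _).
- transitivity ((val v * val t * val t') *: (val u *: (val s' *: a))).
    by rewrite !scalerA; congr (_ *: _); rewrite !mulrA (AC 5 (2*5*4*1*3)).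
  by rewrite eu !scalerA; congr (_ *: _); rewrite !mulrA (AC 5 (4*1*5*2*3)).
- transitivity ((val u * val s * val s') *: (val v *: (val t' *: b))).
    by rewrite !scalerA; congr (_ *: _); rewrite !mulrA (AC 5 (1*5*3*2*4)).
  by rewrite ev !scalerA; congr (_ *: _); rewrite !mulrA (AC 5 (1*4*2*5*3)).
Qed.

Fact loc_oppE a s : loc_opp (frac a s) = frac (- a) s.
Proof.
rewrite /frac; unlock loc_opp.
case: piP => -[a' s'] /frac_eqP[u /= eu].
by apply/esym/frac_eqP; exists u; rewrite !scalerN eu.
Qed.

Fact loc_mulE a s b t :
  loc_mul (frac a s) (frac b t) = frac (a * b) (denom_mul s t).
Proof.
rewrite /frac; unlock loc_mul.
case: piP => -[a' s'] /frac_eqP[u /= eu]; case: piP => -[b' t'] /frac_eqP[v /= ev].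
apply/esym/frac_eqP; exists (denom_mul u v) => /=.
have scalerM (x y : R) (c d : A) : (x * y) *: (c * d) = (x *: c) * (y *: d).
  by rewrite -scalerA centralAr centralAl.
rewrite !scalerA in eu ev; rewrite !scalerA.
rewrite [X in X *: _ = _]mulrACA [LHS]scalerM eu ev.
by rewrite -scalerM mulrACA.
Qed.

Let frac_eq a b s t : a = b -> val s = val t -> frac a s = frac b t.
Proof. by move=> -> /val_inj ->. Qed.

Fact loc_addA : associative loc_add.
Proof.
elim/fracW => a s; elim/fracW => b t; elim/fracW => c w; rewrite !loc_addE.
apply: frac_eq => /=; last exact: mulrA.
rewrite !scalerDr !scalerA addrA; congr (_ + _ + _); congr (_ *: _); exact: mulrC.
Qed.

Fact loc_addC : commutative loc_add.
Proof.
elim/fracW => a s; elim/fracW => b t; rewrite !loc_addE.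
by apply: frac_eq => /=; [rewrite addrC | rewrite mulrC].
Qed.

Fact loc_add0 : left_id (frac 0 denom1) loc_add.
Proof.
elim/fracW => a s; rewrite !loc_addE.
by apply: frac_eq => /=; rewrite ?mul1r // scaler0 scale1r add0r.
Qed.

Fact loc_addN : left_inverse (frac 0 denom1) loc_opp loc_add.
Proof.
elim/fracW => a s; rewrite loc_oppE loc_addE; apply/frac_eqP; exists denom1 => /=.
by rewrite scalerN addNr !scaler0.
Qed.

HB.instance Definition _ :=
  GRing.isZmodule.Build localization loc_addA loc_addC loc_add0 loc_addN.

Fact loc_mulA : associative loc_mul.
Proof.
elim/fracW => a s; elim/fracW => b t; elim/fracW => c w; rewrite !loc_mulE.
by apply: frac_eq => /=; rewrite mulrA.
Qed.

Fact loc_mul1r : left_id (frac 1 denom1) loc_mul.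
Proof. by elim/fracW => a s; rewrite !loc_mulE; apply: frac_eq => /=; rewrite mul1r. Qed.

Fact loc_mulr1 : right_id (frac 1 denom1) loc_mul.
Proof. by elim/fracW => a s; rewrite !loc_mulE; apply: frac_eq => /=; rewrite mulr1. Qed.

Fact loc_mulDl : left_distributive loc_mul loc_add.
Proof.
elim/fracW => a s; elim/fracW => b t; elim/fracW => c w.
rewrite !(loc_addE, loc_mulE); apply/frac_eqP; exists denom1 => /=; congr (_ *: _).
rewrite mulrDl -!centralAl !scalerDr !scalerA; congr (_ + _); congr (_ *: _).
- by rewrite !mulrA (AC 5 (1*3*2*5*4)).
- by rewrite !mulrA (AC 5 (1*3*2*5*4)).
Qed.

Fact loc_mulDr : right_distributive loc_mul loc_add.
Proof.
elim/fracW => c w; elim/fracW => a s; elim/fracW => b t.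
rewrite !(loc_addE, loc_mulE); apply/frac_eqP; exists denom1 => /=; congr (_ *: _).
rewrite mulrDr -!centralAr !scalerDr !scalerA; congr (_ + _); congr (_ *: _).
- by rewrite !mulrA (AC 5 (1*2*4*3*5)).
- by rewrite !mulrA (AC 5 (1*2*4*3*5)).
Qed.

HB.instance Definition _ := GRing.Zmodule_isPzRing.Build localization
  loc_mulA loc_mul1r loc_mulr1 loc_mulDl loc_mulDr.
End Localization.

Section LocalRing.
Variables (R : comPzRingType) (p : prime_ideal R).

Definition local_ring := localization p (regular_algebra R).
HB.instance Definition _ := GRing.PzRing.on local_ring.

Fact local_ring_mulC : commutative ( *%R : local_ring -> _ -> _).
Proof.
elim/fracW => a s; elim/fracW => b t.
rewrite [LHS]loc_mulE [RHS]loc_mulE; apply/frac_eqP; exists (denom1 p) => /=.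
by congr (_ *: _); rewrite [val t * _]mulrC [a * b]mulrC.
Qed.

Fact local_ring_neq0 : 1 != 0 :> local_ring.
Proof.
apply/eqP => /frac_eqP[u]; rewrite !scaler0 !calgZE /= !mul1r mulr1 => u0.
by have /= := valP u; rewrite [sval u]u0 prime_pred0.
Qed.

HB.instance Definition _ :=
  GRing.PzRing_hasCommutativeMul.Build local_ring local_ring_mulC.
HB.instance Definition _ :=
  GRing.PzSemiRing_isNonZero.Build local_ring local_ring_neq0.

(* The maximal ideal p R_p of R_p. *)
Definition max_ideal : {pred local_ring} := fun x =>
  `[< exists (a : R) (s : denominator p),
        a \in p /\ x = frac (a : regular_algebra R) s >].

Fact max_idealP : idealr_closed max_ideal.
Proof.
split.
- by apply/asboolP; exists 0, (denom1 p); rewrite prime_pred0.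
- apply/negP => /asboolP[a [s [pa /frac_eqP[u]]]].
  rewrite !calgZE /= mul1r mulr1 => e.
  have := valP (denom_mul u s) => /=; rewrite e prime_predM //.
- elim/fracW => c w x y /asboolP[a [s [pa ->]]] /asboolP[b [t [pb ->]]].
  apply/asboolP; rewrite [_ * _]loc_mulE [_ + _]loc_addE.
  eexists; eexists; split; last by reflexivity.
  rewrite !calgZE /=; apply: prime_predD; apply: prime_predM => //.
  exact: prime_predM.
Qed.

HB.instance Definition _ := isIdealr.Build local_ring max_ideal max_idealP.

Definition residue_field := {ideal_quot max_ideal}.
HB.instance Definition _ := GRing.ComNzRing.on residue_field.

Definition to_residue_field (r : R) : residue_field :=
  \pi_residue_field (frac (r : regular_algebra R) (denom1 p) : local_ring).

Fact to_residue_field_zmod : zmod_morphism to_residue_field.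
Proof.
move=> r s; rewrite /to_residue_field -rmorphB; congr (\pi _).
have -> : - frac (s : regular_algebra R) (denom1 p) =
          frac (- s : regular_algebra R) (denom1 p) := loc_oppE _ _.
apply/esym; rewrite [LHS]loc_addE; apply/frac_eqP; exists (denom1 p).
by rewrite !calgZE /= !mul1r.
Qed.

Fact to_residue_field_monoid : monoid_morphism to_residue_field.
Proof.
split=> [|r s]; first by rewrite -[RHS](rmorph1 \pi_residue_field).
rewrite /to_residue_field -rmorphM; congr (\pi _).
apply/esym; rewrite [LHS]loc_mulE; apply/frac_eqP; exists (denom1 p).
by rewrite !calgZE /= !mul1r.
Qed.

HB.instance Definition _ := GRing.isZmodMorphism.Build R residue_field
  to_residue_field to_residue_field_zmod.
HB.instance Definition _ := GRing.isMonoidMorphism.Build R residue_field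
  to_residue_field to_residue_field_monoid.

Definition residue_algebra : centralAlgType R :=
  @CentralAlgebra R residue_field to_residue_field
    (fun r => @mulrC residue_field (to_residue_field r)).

End LocalRing.

Section Tensor.
Variables (R : comPzRingType) (A B : centralAlgType R).

(* A list [:: (a1, b1); ...; (an, bn)] stands for the formal sum of the ai (x) bi;
   the opposite is obtained by negating the first factors. *)
Inductive tensor_eq : seq (A * B) -> seq (A * B) -> Prop :=
| tensor_eq_refl s : tensor_eq s s
| tensor_eq_sym s t : tensor_eq s t -> tensor_eq t s
| tensor_eq_trans t s u : tensor_eq s t -> tensor_eq t u -> tensor_eq s u
| tensor_eq_perm s t : perm_eq s t -> tensor_eq s t
| tensor_eq_cat s t u : tensor_eq s t -> tensor_eq (s ++ u) (t ++ u)
| tensor_eq_0l b : tensor_eq [:: (0, b)] [::]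
| tensor_eq_Dl a a' b : tensor_eq [:: (a + a', b)] [:: (a, b); (a', b)]
| tensor_eq_Dr a b b' : tensor_eq [:: (a, b + b')] [:: (a, b); (a, b')]
| tensor_eq_Z r a b : tensor_eq [:: (r *: a, b)] [:: (a, r *: b)].

Definition tensor_rel (s t : seq (A * B)) : bool := `[< tensor_eq s t >].

Fact tensor_rel_refl : reflexive tensor_rel.
Proof. by move=> s; apply/asboolP; exact: tensor_eq_refl. Qed.

Fact tensor_rel_sym : symmetric tensor_rel.
Proof. by move=> s t; apply/asboolP/asboolP; exact: tensor_eq_sym. Qed.

Fact tensor_rel_trans : transitive tensor_rel.
Proof.
by move=> t s u /asboolP st /asboolP tu; apply/asboolP; exact: tensor_eq_trans tu.
Qed.

Canonical tensor_rel_equiv :=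
  EquivRel tensor_rel tensor_rel_refl tensor_rel_sym tensor_rel_trans.

Definition tensor := {eq_quot tensor_rel}.
HB.instance Definition _ : EqQuotient _ tensor_rel tensor := EqQuotient.on tensor.
HB.instance Definition _ := Choice.on tensor.

Definition tensor_opp_seq (s : seq (A * B)) := [seq (- x.1, x.2) | x <- s].
Definition tensor_mul1 (x y : A * B) := (x.1 * y.1, x.2 * y.2).
Definition tensor_mul_seq (s t : seq (A * B)) :=
  [seq tensor_mul1 x y | x <- s, y <- t].

Definition tensor_add := lift_op2 tensor cat.
Definition tensor_opp := lift_op1 tensor tensor_opp_seq.
Definition tensor_mul := lift_op2 tensor tensor_mul_seq.

Lemma tensor_piP s t : \pi_tensor s = \pi_tensor t <-> tensor_eq s t.
Proof.
split=> [/eqmodP/= /asboolP //|e].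
by apply/eqmodP => /=; apply/asboolP.
Qed.

Fact tensor_eq_catr s t u : tensor_eq s t -> tensor_eq (u ++ s) (u ++ t).
Proof.
move=> st; apply: (@tensor_eq_trans (s ++ u)).
  by apply: tensor_eq_perm; rewrite perm_catC.
apply: (@tensor_eq_trans (t ++ u)); first exact: tensor_eq_cat.
by apply: tensor_eq_perm; rewrite perm_catC.
Qed.

Fact tensor_eq_cat2 s t s' t' :
  tensor_eq s s' -> tensor_eq t t' -> tensor_eq (s ++ t) (s' ++ t').
Proof.
move=> ss' tt'; apply: (@tensor_eq_trans (s' ++ t)); first exact: tensor_eq_cat.
exact: tensor_eq_catr.
Qed.

Fact tensor_eq_map (f : A * B -> A * B) :
    (forall b, tensor_eq [:: f (0, b)] [::]) ->
    (forall a a' b, tensor_eq [:: f (a + a', b)] [:: f (a, b); f (a', b)]) ->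
    (forall a b b', tensor_eq [:: f (a, b + b')] [:: f (a, b); f (a, b')]) ->
    (forall r a b, tensor_eq [:: f (r *: a, b)] [:: f (a, r *: b)]) ->
  forall s t, tensor_eq s t -> tensor_eq (map f s) (map f t).
Proof.
move=> f0 fDl fDr fZ s t; elim=> {s t} //=.
- by move=> s; exact: tensor_eq_refl.
- by move=> s t _; exact: tensor_eq_sym.
- by move=> t s u _ st _; exact: tensor_eq_trans.
- by move=> s t st; apply: tensor_eq_perm; exact: perm_map.
- by move=> s t u _ st; rewrite !map_cat; exact: tensor_eq_cat.
Qed.

Fact tensor_eq_opp s t :
  tensor_eq s t -> tensor_eq (tensor_opp_seq s) (tensor_opp_seq t).
Proof.
apply: tensor_eq_map => /=.
- by move=> b; rewrite oppr0; exact: tensor_eq_0l.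
- by move=> a a' b; rewrite opprD; exact: tensor_eq_Dl.
- by move=> a b b'; exact: tensor_eq_Dr.
- by move=> r a b; rewrite -scalerN; exact: tensor_eq_Z.
Qed.

Fact tensor_eq_mul1l x s t : tensor_eq s t ->
  tensor_eq [seq tensor_mul1 x y | y <- s] [seq tensor_mul1 x y | y <- t].
Proof.
apply: tensor_eq_map; rewrite /tensor_mul1 /=.
- by move=> b; rewrite mulr0; exact: tensor_eq_0l.
- by move=> a a' b; rewrite mulrDr; exact: tensor_eq_Dl.
- by move=> a b b'; rewrite mulrDr; exact: tensor_eq_Dr.
- by move=> r a b; rewrite -!centralAr; exact: tensor_eq_Z.
Qed.

Fact tensor_eq_mul1r y s t : tensor_eq s t ->
  tensor_eq [seq tensor_mul1 x y | x <- s] [seq tensor_mul1 x y | x <- t].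
Proof.
apply: (tensor_eq_map (f := tensor_mul1^~ y)); rewrite /tensor_mul1 /=.
- by move=> b; rewrite mul0r; exact: tensor_eq_0l.
- by move=> a a' b; rewrite mulrDl; exact: tensor_eq_Dl.
- by move=> a b b'; rewrite mulrDl; exact: tensor_eq_Dr.
- by move=> r a b; rewrite -!centralAl; exact: tensor_eq_Z.
Qed.

Fact tensor_eq_mulr s t t' : tensor_eq t t' ->
  tensor_eq (tensor_mul_seq s t) (tensor_mul_seq s t').
Proof.
move=> tt'; elim: s => [|x s IHs]; first exact: tensor_eq_refl.
rewrite /tensor_mul_seq !allpairs_cons.
by apply: tensor_eq_cat2; first exact: tensor_eq_mul1l.
Qed.

Fact tensor_eq_mull s s' t : tensor_eq s s' ->
  tensor_eq (tensor_mul_seq s t) (tensor_mul_seq s' t).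
Proof.
move=> ss'; elim: t => [|y t IHt].
  by rewrite /tensor_mul_seq !allpairs0r; exact: tensor_eq_refl.
have consE u : tensor_eq (tensor_mul_seq u (y :: t))
                 ([seq tensor_mul1 x y | x <- u] ++ tensor_mul_seq u t).
  apply: tensor_eq_perm.
  apply/permPl; exact: (perm_allpairs_consr (fun x y => tensor_mul1 x y) u (fun=> y) (fun=> t)).
apply: tensor_eq_trans (consE s) _.
apply: tensor_eq_trans (tensor_eq_sym (consE s')).
by apply: tensor_eq_cat2 => //; exact: tensor_eq_mul1r.
Qed.

Fact tensor_addE s t :
  tensor_add (\pi_tensor s) (\pi_tensor t) = \pi_tensor (s ++ t).
Proof.
unlock tensor_add; case: piP => s' /tensor_piP ss'; case: piP => t' /tensor_piP tt'.
by apply/tensor_piP; apply: tensor_eq_sym; exact: tensor_eq_cat2.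
Qed.

Fact tensor_oppE s : tensor_opp (\pi_tensor s) = \pi_tensor (tensor_opp_seq s).
Proof.
unlock tensor_opp; case: piP => s' /tensor_piP ss'.
by apply/tensor_piP; apply: tensor_eq_sym; exact: tensor_eq_opp.
Qed.

Fact tensor_mulE s t :
  tensor_mul (\pi_tensor s) (\pi_tensor t) = \pi_tensor (tensor_mul_seq s t).
Proof.
unlock tensor_mul; case: piP => s' /tensor_piP ss'; case: piP => t' /tensor_piP tt'.
apply/tensor_piP; apply: tensor_eq_sym.
by apply: tensor_eq_trans (tensor_eq_mull _ ss') (tensor_eq_mulr _ tt').
Qed.

Fact tensor_addA : associative tensor_add.
Proof.
by elim/quotW => s; elim/quotW => t; elim/quotW => u; rewrite !tensor_addE catA.
Qed.

Fact tensor_addC : commutative tensor_add.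
Proof.
elim/quotW => s; elim/quotW => t; rewrite !tensor_addE; apply/tensor_piP.
by apply: tensor_eq_perm; rewrite perm_catC.
Qed.

Fact tensor_add0 : left_id (\pi_tensor [::]) tensor_add.
Proof. by elim/quotW => s; rewrite tensor_addE. Qed.

Fact tensor_addN : left_inverse (\pi_tensor [::]) tensor_opp tensor_add.
Proof.
elim/quotW => s; rewrite tensor_oppE tensor_addE; apply/tensor_piP.
elim: s => [|[a b] s IHs] /=; first exact: tensor_eq_refl.
apply: (@tensor_eq_trans ([:: (- a, b); (a, b)] ++ (tensor_opp_seq s ++ s))).
  apply: tensor_eq_perm => /=; rewrite perm_cons.
  by rewrite -[(a, b) :: s]cat1s perm_catCA.
rewrite -[X in tensor_eq _ X]cats0; apply: tensor_eq_cat2 => //.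
apply: tensor_eq_trans (tensor_eq_sym (tensor_eq_Dl _ _ _)) _.
by rewrite addNr; exact: tensor_eq_0l.
Qed.

HB.instance Definition _ := GRing.isZmodule.Build tensor
  tensor_addA tensor_addC tensor_add0 tensor_addN.

Fact tensor_mulA : associative tensor_mul.
Proof.
elim/quotW => s; elim/quotW => t; elim/quotW => u; rewrite !tensor_mulE.
congr (\pi_tensor _); rewrite /tensor_mul_seq.
elim: s => [//|x s IHs]; rewrite !allpairs_cons allpairs_cat IHs; congr (_ ++ _).
elim: t {IHs} => [//|y t IHt]; rewrite !allpairs_cons map_cat IHt.
congr (_ ++ _).
by rewrite -map_comp; apply: eq_map => z; rewrite /tensor_mul1 /= !mulrA.
Qed.

Fact tensor_mul1r : left_id (\pi_tensor [:: (1, 1)]) tensor_mul.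
Proof.
elim/quotW => s; rewrite tensor_mulE; congr (\pi_tensor _).
rewrite /tensor_mul_seq allpairs1l -[RHS]map_id; apply: eq_map => -[a b].
by rewrite /tensor_mul1 /= !mul1r.
Qed.

Fact tensor_mulr1 : right_id (\pi_tensor [:: (1, 1)]) tensor_mul.
Proof.
elim/quotW => s; rewrite tensor_mulE; congr (\pi_tensor _).
rewrite /tensor_mul_seq allpairs1r -[RHS]map_id; apply: eq_map => -[a b].
by rewrite /tensor_mul1 /= !mulr1.
Qed.

Fact tensor_mulDl : left_distributive tensor_mul tensor_add.
Proof.
elim/quotW => s; elim/quotW => t; elim/quotW => u.
by rewrite !(tensor_addE, tensor_mulE) /tensor_mul_seq allpairs_cat.
Qed.

Fact tensor_mulDr : right_distributive tensor_mul tensor_add.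
Proof.
elim/quotW => s; elim/quotW => t; elim/quotW => u.
rewrite !(tensor_addE, tensor_mulE); apply/tensor_piP.
apply: tensor_eq_perm; apply/permPl.
exact: (perm_allpairs_catr (fun x y => tensor_mul1 x y) s (fun=> t) (fun=> u)).
Qed.

HB.instance Definition _ := GRing.Zmodule_isPzRing.Build tensor
  tensor_mulA tensor_mul1r tensor_mulr1 tensor_mulDl tensor_mulDr.
End Tensor.

Section Gorenstein.
Variables (R : comPzRingType) (A : centralAlgType R).

Definition supp (p : prime_ideal R) : Prop :=
  exists x : localization p A, x <> 0.

Definition maximal_in_supp (m : prime_ideal R) : Prop :=
  supp m /\
  forall q : prime_ideal R, supp q -> {subset m <= q} -> {subset q <= m}.

(* A_k(p) = A (x)_R k(p) *)
Definition fibre (p : prime_ideal R) : pzRingType := tensor A (residue_algebra p).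

Definition gorenstein_algebra : Prop :=
  finite_projective A /\
  forall p, supp p -> iwanaga_gorenstein (localization p A).
End Gorenstein.

(* Main.v *)
(* Fix a prime [p] of the support and write [S = R_p], [L = A_p], [k = k(p)].  For an
   [L]-module [C] let [omega C = Hom_S(L, C) / C], a relative cosyzygy.

   If [L] has injective dimension [n] over itself, then [Ext^(n+1)_L(X, L) = 0], so
   [Ext^1_L(X, omega^n L) = 0] for all [S]-projective [X]; for [X = omega^(n+1) L] this
   shows that [omega^n L] is injective relative to [S], i.e. a summand of the coinduced
   module [Hom_S(L, omega^n L)].  Conversely, if [S] is Gorenstein then coinduced modules
   of finite projective [S]-modules have finite injective dimension, so relative
   injectivity of [omega^n L] implies that [L] has finite injective dimension.

   The formation of [omega] commutes with the passage to [A_k], and by Nakayama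
   [omega^n L] is relatively injective if and only if its reduction is.  As [k] is
   self-injective, for [S] Gorenstein the injective dimension of [L] is finite if and
   only if that of [A_k] is.  Moreover [S] is a summand of the [S]-module [L], and
   injective [L]-modules are injective over [S], so [S] is Gorenstein if [L] has finite
   injective dimension.  Finally, over a noetherian ring localization preserves
   injectives, which reduces (a) to the maximal elements of the support. *)
Require Import Defs.
From HB Require Import structures.
From mathcomp Require Import all_boot all_algebra.
From mathcomp Require Import boolp classical_sets.
Import Defs.

Set Implicit Arguments.
Unset Strict Implicit.
Unset Printing Implicit Defensive.

Import GRing.Theory.
Local Open Scope ring_scope.
Local Open Scope quotient_scope.

(** * Injective dimension *)

(** Injective dimension does not transfer directly: an injective resolution reduced modulo the
    maximal ideal need not stay exact, and the numerical dimension may drop, as for a regular local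
    ring and its residue field. Relative injectivity is a workable substitute because it asks for
    one [S]-linear solution [g] of a linear equation between finite projective [S]-modules. Such a
    solution can be pushed down to [k], lifted from [k] up to an error in the maximal ideal, and
    then corrected by an invertible endomorphism. This requires every [omega^n L] to remain finite
    projective over [S]; hence cosyzygies are taken inside coinduced modules and not inside
    injective hulls, and dual bases are carried along explicitly. [Ext] is never formed as a
    functor. Its vanishing is expressed by saying that every derivation is inner, which turns
    dimension shifting into a computation with maps. The conditions on right modules come from
    running the same argument on converse rings. For that reason the general lemmas are about an
    abstract ring [L] with a central map from [S], and not about localizations. *)

Section LinearMaps.
Variable R : pzRingType.

Definition lin_of (M N : lmodType R) (f : M -> N)
    (fL : forall a x y, f (a *: x + y) = a *: f x + f y) : {linear M -> N} :=
  HB.pack f (GRing.isLinear.Build R M N *:%R f fL).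

Lemma lin_factor (M N P : lmodType R) (p : {linear M -> N}) (f : {linear M -> P}) :
    (forall y, exists x, p x = y) -> (forall x, p x = 0 -> f x = 0) ->
  exists h : {linear N -> P}, forall x, h (p x) = f x.
Proof.
move=> /choice[s sK] kpf.
have fE x y : p x = p y -> f x = f y.
  by move=> e; apply/subr0_eq; rewrite -linearB kpf // linearB e subrr.
have hE x : f (s (p x)) = f x by apply: fE; rewrite sK.
have hL a x y : f (s (a *: x + y)) = a *: f (s x) + f (s y).
  by rewrite -linearP; apply: fE; rewrite linearP !sK.
by exists (lin_of hL).
Qed.

Section Cokernel.
Variables (M N : lmodType R) (f : {linear M -> N}).

Definition coker_rel (x y : N) : bool := `[< exists m, x - y = f m >].

Fact coker_rel_refl : reflexive coker_rel.
Proof. by move=> x; apply/asboolP; exists 0; rewrite subrr linear0. Qed.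

Fact coker_rel_sym : symmetric coker_rel.
Proof.
by move=> x y; apply/asboolP/asboolP => -[m e];
  exists (- m); rewrite linearN -e opprB.
Qed.

Fact coker_rel_trans : transitive coker_rel.
Proof.
move=> y x z /asboolP[m e] /asboolP[n e']; apply/asboolP; exists (m + n).
by rewrite linearD -e -e' addrA subrK.
Qed.

Canonical coker_rel_equiv :=
  EquivRel coker_rel coker_rel_refl coker_rel_sym coker_rel_trans.

Definition coker := {eq_quot coker_rel}.
HB.instance Definition _ : EqQuotient _ coker_rel coker := EqQuotient.on coker.
HB.instance Definition _ := Choice.on coker.

Definition coker_pi (x : N) : coker := \pi_coker x.

Lemma coker_piP x y : coker_pi x = coker_pi y <-> exists m, x - y = f m.
Proof.
by split=> [/eqmodP/= /asboolP //|e]; apply/eqmodP => /=; apply/asboolP.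
Qed.

Lemma coker_reprK (y : coker) : coker_pi (repr y) = y. Proof. exact: reprK. Qed.

Lemma coker_surj (y : coker) : exists x, coker_pi x = y.
Proof. by exists (repr y); rewrite coker_reprK. Qed.

Definition coker_add (x y : coker) : coker := coker_pi (repr x + repr y).
Definition coker_opp (x : coker) : coker := coker_pi (- repr x).
Definition coker_scale (a : R) (x : coker) : coker := coker_pi (a *: repr x).

Fact coker_addE x y : coker_add (coker_pi x) (coker_pi y) = coker_pi (x + y).
Proof.
have /coker_piP[m e] := coker_reprK (coker_pi x).
have /coker_piP[n e'] := coker_reprK (coker_pi y).
by apply/coker_piP; exists (m + n); rewrite linearD -e -e' opprD addrACA.
Qed.

Fact coker_oppE x : coker_opp (coker_pi x) = coker_pi (- x).
Proof.
have /coker_piP[m e] := coker_reprK (coker_pi x).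
by apply/coker_piP; exists (- m); rewrite (linearN f) -e -opprD.
Qed.

Fact coker_scaleE a x : coker_scale a (coker_pi x) = coker_pi (a *: x).
Proof.
have /coker_piP[m e] := coker_reprK (coker_pi x).
by apply/coker_piP; exists (a *: m); rewrite (linearZ_LR f) -e scalerBr.
Qed.

Let coker_elim (P : coker -> Prop) : (forall x, P (coker_pi x)) -> forall y, P y.
Proof. by move=> H y; have [x <-] := coker_surj y. Qed.

Fact coker_addA : associative coker_add.
Proof.
by do 3![elim/coker_elim => ?]; rewrite !coker_addE addrA.
Qed.

Fact coker_addC : commutative coker_add.
Proof. by do 2![elim/coker_elim => ?]; rewrite !coker_addE addrC. Qed.

Fact coker_add0 : left_id (coker_pi 0) coker_add.
Proof. by elim/coker_elim => ?; rewrite coker_addE add0r. Qed.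

Fact coker_addN : left_inverse (coker_pi 0) coker_opp coker_add.
Proof. by elim/coker_elim => ?; rewrite coker_oppE coker_addE addNr. Qed.

HB.instance Definition _ :=
  GRing.isZmodule.Build coker coker_addA coker_addC coker_add0 coker_addN.

Fact coker_piD x y : coker_pi x + coker_pi y = coker_pi (x + y).
Proof. exact: coker_addE. Qed.

Fact coker_scaleA a b x : coker_scale a (coker_scale b x) = coker_scale (a * b) x.
Proof. by elim/coker_elim: x => ?; rewrite !coker_scaleE scalerA. Qed.

Fact coker_scale1 : left_id 1 coker_scale.
Proof. by elim/coker_elim => ?; rewrite coker_scaleE scale1r. Qed.

Fact coker_scaleDr : right_distributive coker_scale +%R.
Proof.
move=> a; elim/coker_elim => x; elim/coker_elim => y.
by rewrite coker_piD !coker_scaleE coker_piD scalerDr.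
Qed.

Fact coker_scaleDl x : {morph coker_scale^~ x : a b / a + b}.
Proof.
by elim/coker_elim: x => x a b; rewrite !coker_scaleE coker_piD scalerDl.
Qed.

HB.instance Definition _ := GRing.Zmodule_isLmodule.Build R coker
  coker_scaleA coker_scale1 coker_scaleDr coker_scaleDl.

Fact coker_pi_linear a x y : coker_pi (a *: x + y) = a *: coker_pi x + coker_pi y.
Proof. by rewrite [_ *: coker_pi x]coker_scaleE coker_piD. Qed.

HB.instance Definition _ :=
  GRing.isLinear.Build R N coker *:%R coker_pi coker_pi_linear.

Lemma coker_pi_eq0 x : coker_pi x = 0 <-> exists m, x = f m.
Proof. by rewrite (coker_piP x 0) subr0. Qed.
End Cokernel.

Definition short_exact (M N P : lmodType R) (f : {linear M -> N})
    (g : {linear N -> P}) : Prop :=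
  [/\ forall x, f x = 0 -> x = 0, forall z, exists y, g y = z
    & forall y, g y = 0 <-> exists x, y = f x].

Lemma short_exact_inj (M N P : lmodType R) (f : {linear M -> N}) (g : {linear N -> P}) :
  short_exact f g -> injective f.
Proof.
by case=> f0 _ _ x y e; apply/subr0_eq/f0; rewrite linearB e subrr.
Qed.

Lemma short_exact_comp0 (M N P : lmodType R) (f : {linear M -> N})
  (g : {linear N -> P}) x : short_exact f g -> g (f x) = 0.
Proof. by case=> _ _ H; apply/H; exists x. Qed.

Lemma coker_exact (M N : lmodType R) (f : {linear M -> N}) :
  injective f -> short_exact f (@coker_pi M N f).
Proof.
move=> fI; split=> [x|z|y]; last exact: coker_pi_eq0.
- by rewrite -(linear0 f) => /fI.
- exact: coker_surj.
Qed.

Lemma prod_exact (M N : lmodType R) (i : {linear M -> (M * N)%type})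
    (p : {linear (M * N)%type -> N}) :
  (forall x, i x = (x, 0)) -> (forall z, p z = z.2) -> short_exact i p.
Proof.
move=> iE pE; split.
- by move=> x; rewrite iE => -[].
- by move=> y; exists (0, y); rewrite pE.
- move=> [x y]; rewrite pE /=; split=> [->|[z]]; first by exists x; rewrite iE.
  by rewrite iE => -[].
Qed.

Definition summand (M B : lmodType R) : Prop :=
  exists (i : {linear M -> B}) (r : {linear B -> M}), forall x, r (i x) = x.

Lemma summand_inj (M B : lmodType R) :
  summand M B -> injective_module B -> injective_module M.
Proof.
move=> [i [r ri]] injB X Y f g finj.
have [h hf] := injB _ _ f (i \o g : {linear X -> B}) finj.
by exists (r \o h : {linear Y -> M}) => x /=; rewrite hf /= ri.
Qed.

Lemma injective_prod (E F : lmodType R) : injective_module E -> injective_module F ->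
  injective_module (E * F)%type.
Proof.
move=> injE injF X Y f g finj.
have [h1 h1f] := injE _ _ f (fst \o g : {linear X -> E}) finj.
have [h2 h2f] := injF _ _ f (snd \o g : {linear X -> F}) finj.
have hL a x y : (h1 (a *: x + y), h2 (a *: x + y))
   = a *: ((h1 x, h2 x) : (E * F)%type) + (h1 y, h2 y).
  by rewrite !linearP.
exists (lin_of hL) => x /=; rewrite h1f h2f /=.
by case: (g x).
Qed.

(** If [h] retracts [f], then [y - f (h y)] depends only on [g y]; this gives [s], and [f + s] is a
    left inverse of [y |-> (h y, g y)]. A retract suffices for deducing injectivity of [Y]. *)
Lemma short_exact_split (X Y Z : lmodType R) (f : {linear X -> Y})
    (g : {linear Y -> Z}) :
  injective_module X -> short_exact f g -> summand Y (X * Z)%type.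
Proof.
move=> injX fg; have [h hf] := injX _ _ f (idfun : {linear X -> X}) (short_exact_inj fg).
have [_ gs ker] := fg.
pose k := (idfun : {linear Y -> Y}) \- (f \o h).
have [s sE] : exists s : {linear Z -> Y}, forall y, s (g y) = y - f (h y).
  apply: (lin_factor (f := k)) => // y /ker[x ->] /=.
  by rewrite /k /= hf subrr.
have iL a x y : (h (a *: x + y), g (a *: x + y))
   = a *: ((h x, g x) : (X * Z)%type) + (h y, g y).
  by rewrite !linearP.
have rL a (x y : (X * Z)%type) :
    f (a *: x + y).1 + s (a *: x + y).2 = a *: (f x.1 + s x.2) + (f y.1 + s y.2).
  by case: x => x x'; case: y => y y' /=; rewrite !linearP scalerDr addrACA.
by exists (lin_of iL), (lin_of rL) => y /=; rewrite sE addrC subrK.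
Qed.
End LinearMaps.

(** * Bounds on injective dimension and their behaviour in exact sequences *)

Section InjectiveDimension.
Variable R : pzRingType.

(** A bounded injective resolution peeled off one embedding at a time, so that statements about
    dimension go by induction on [n] with the module generalised. *)
Fixpoint injdim_le (n : nat) (M : lmodType R) : Prop :=
  if n is n'.+1 then
    exists (E N : lmodType R) (f : {linear M -> E}) (g : {linear E -> N}),
      [/\ injective_module E, short_exact f g & injdim_le n' N]
  else injective_module M.

Definition zero_module : lmodType R := 'rV[R]_0.

Lemma zero_module_eq0 (x : zero_module) : x = 0.
Proof. by apply/matrixP => i []. Qed.

Lemma injective0 : injective_module zero_module.
Proof.
move=> M N f g _; exists (\0 : {linear N -> zero_module}) => x.
by rewrite [RHS]zero_module_eq0 [LHS]zero_module_eq0.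
Qed.

Lemma injdim_leS n (M : lmodType R) : injdim_le n M -> injdim_le n.+1 M.
Proof.
elim: n M => [|n IHn] M.
  move=> injM; exists M, zero_module, (idfun : {linear M -> M}),
    (\0 : {linear M -> zero_module}); split=> //; last exact: injective0.
  split=> // [z|y]; first by exists 0; rewrite linear0 [z]zero_module_eq0.
  by split=> // _; exists y.
by case=> E [N [f [g [injE fg /IHn idN]]]]; exists E, N, f, g.
Qed.

Lemma injdim_le_mono m n (M : lmodType R) : (m <= n)%N -> injdim_le m M -> injdim_le n M.
Proof.
move=> /subnK <-; elim: (n - m)%N => // k IHk /IHk.
exact: injdim_leS.
Qed.

(** Dropping [I 0] leaves a resolution of [coker eta], which embeds in [I 1] because the kernel of
    [d 0] is the image of [eta]. For [n = 0] the vanishing of [I 1] makes [eta] bijective. *)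
Lemma finite_injdim_le (M : lmodType R) : finite_injdim M -> exists n, injdim_le n M.
Proof.
case=> n [I [eta [d [injI etaI ex0 exS I0]]]]; exists n.
elim: n M I eta d injI etaI ex0 exS I0 => [|n IHn] M I eta d injI etaI ex0 exS I0.
  have eta_surj y : exists x, eta x = y.
    by have /ex0[x ->] : d 0%N y = 0; [exact: I0 | exists x].
  have [r rE] : exists r : {linear I 0%N -> M}, forall x, r (eta x) = idfun x.
    apply: lin_factor => // x; rewrite -(linear0 eta) => /etaI -> //.
  exact: (summand_inj (B := I 0%N)) (ex_intro _ eta (ex_intro _ r rE)) (injI 0%N).
exists (I 0%N), (coker eta), eta, (@coker_pi _ _ _ eta).
split=> //; first exact: coker_exact.
have [h hE] : exists h : {linear coker eta -> I 1%N}, forall x, h (coker_pi eta x) = d 0%N x.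
  apply: lin_factor => [y|x]; first exact: coker_surj.
  by move/coker_pi_eq0/ex0.
apply: (IHn (coker eta) (fun i => I i.+1) h (fun i => d i.+1)) => //.
- move=> x y; have [x' <-] := coker_surj x; have [y' <-] := coker_surj y.
  rewrite !hE => e; apply/coker_piP/ex0.
  by rewrite linearB e subrr.
- move=> x; split=> [/exS[y ->]|[y ->]].
    by exists (coker_pi eta y); rewrite hE.
  by apply/exS; have [y' <-] := coker_surj y; exists y'; rewrite hE.
- by move=> i lt_n_i; apply: I0.
Qed.

Lemma injdim_le_finite n (M : lmodType R) : injdim_le n M -> finite_injdim M.
Proof.
move=> idM.
suff [I [eta [d [injI etaI ex0 exS I0]]]] :
    exists (I : nat -> lmodType R) (eta : {linear M -> I 0%N})
         (d : forall i, {linear I i -> I i.+1}),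
    [/\ forall i, injective_module (I i), injective eta,
        forall x, d 0%N x = 0 <-> exists y, x = eta y,
        forall i x, d i.+1 x = 0 <-> exists y, x = d i y
      & forall i, (n < i)%N -> forall x : I i, x = 0].
  by exists n, I, eta, d.
elim: n M idM => [|n IHn] M /= idM.
  exists (fun i => if i is _.+1 then zero_module else M), (idfun : {linear M -> M}),
    (fun i => \0); split=> //.
  - by case=> // i; exact: injective0.
  - by move=> x; split=> // _; exists x.
  - by move=> i x; split=> // _; exists 0; exact: zero_module_eq0.
  - by case=> // i _; exact: zero_module_eq0.
case: idM => E [N [f [g [injE fg /IHn[I [eta [d [injI etaI ex0 exS I0]]]]]]]].
pose I' i := if i is j.+1 then I j else E.
pose d' i : {linear I' i -> I' i.+1} :=
  match i with 0 => eta \o g : {linear E -> I 0%N} | j.+1 => d j end.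
exists I', f, d'; split=> //.
- by case.
- exact: short_exact_inj fg.
- have [_ _ ker] := fg; move=> x /=; rewrite -ker; split=> [|->]; last exact: linear0.
  by rewrite -(linear0 eta) => /etaI.
- case=> [|i] x; last exact: exS.
  have [_ gs _] := fg; rewrite ex0; split=> [[y ->]|[y ->]]; last by exists (g y).
  by have [z <-] := gs y; exists z.
- by case=> // i; exact: I0.
Qed.

(* For summands this is Schanuel's lemma: if [B] embeds into the injective [E], then
   [E / M] is a summand of [(E / B) * E].  The two closure properties are proved
   together because that product is handled as an extension. *)
Lemma summand_injdim_le_aux n :
  (forall X Y Z : lmodType R, forall (f : {linear X -> Y}) (g : {linear Y -> Z}),
    short_exact f g -> injdim_le n X -> injdim_le n Z -> injdim_le n Y) /\
  (forall M B : lmodType R, summand M B -> injdim_le n B -> injdim_le n M).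
Proof.
elim: n => [|n [IHe IHs]]; split.
- move=> X Y Z f g fg injX injZ.
  exact: summand_inj (short_exact_split injX fg) (injective_prod injX injZ).
- exact: summand_inj.
- move=> X Y Z f g fg [E [X1 [a [a' [injE aa' idX1]]]]] [F [Z1 [c [c' [injF cc' idZ1]]]]].
  (* Horseshoe construction: [b] extends the embedding [a] of [X] to [Y], the pair [(b, c \o g)]
     embeds [Y] in [E * F], and its cokernel is an extension of [Z1] by [X1]. *)
  have [b bf] := injE _ _ f a (short_exact_inj fg).
  have iL k x y : (b (k *: x + y), c (g (k *: x + y)))
     = k *: ((b x, c (g x)) : (E * F)%type) + (b y, c (g y)).
    by rewrite !linearP.
  pose i : {linear Y -> (E * F)%type} := lin_of iL.
  have iI : injective i.
    move=> x y [e1 e2]; apply/subr0_eq.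
    have [_ _ ker] := fg.
    have /ker[z ez] : g (x - y) = 0.
      by apply: (short_exact_inj cc'); rewrite !linearB e2 subrr linear0.
    rewrite ez; have -> : z = 0; last exact: linear0.
    apply: (short_exact_inj aa'); rewrite -bf -ez linearB e1 subrr.
    by rewrite linear0.
  exists (E * F)%type, (coker i), i, (@coker_pi _ _ _ i); split.
  + exact: injective_prod.
  + exact: coker_exact.
  have incL k x y : (k *: x + y, 0) = k *: ((x, 0) : (E * F)%type) + (y, 0).
    by congr (_, _); rewrite /= ?scaler0 ?addr0.
  pose inc := lin_of incL.
  have [_ a's kera] := aa'; have [_ c's kerc] := cc'; have [_ gs ker] := fg.
  have [u uE] : exists u : {linear X1 -> coker i},
      forall x, u (a' x) = (coker_pi i \o inc) x.
    apply: lin_factor => // x /kera[y ->] /=; apply/coker_pi_eq0.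
    by exists (f y); congr (_, _); rewrite ?bf // (short_exact_comp0 _ fg) linear0.
  have [v vE] : exists v : {linear coker i -> Z1},
      forall x, v (coker_pi i x) = (c' \o snd) x.
    apply: lin_factor => [y|x /coker_pi_eq0[y ->] /=]; first exact: coker_surj.
    by rewrite short_exact_comp0.
  apply: (IHe _ _ _ u v _ idX1 idZ1); split.
  + move=> x1; have [x <-] := a's x1; rewrite uE /= => /coker_pi_eq0[y [e1 e2]].
    apply/kera.
    have /ker[z ez] : g y = 0.
      by apply: (short_exact_inj cc'); rewrite -e2 linear0.
    by exists z; rewrite e1 ez bf.
  + move=> z1; have [z <-] := c's z1; exists (coker_pi i (0, z)).
    by rewrite vE.
  + move=> y1; split=> [|[x1 ->]].
      have [[x z] <-] := coker_surj y1; rewrite vE /= => /kerc[w ->].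
      have [y <-] := gs w; exists (a' (x - b y)); rewrite uE /=.
      apply/coker_piP; exists y; congr (_, _) => /=; last by rewrite subr0.
      by rewrite opprB addrC subrK.
    by have [x <-] := a's x1; rewrite uE vE /= linear0.
- move=> M B [i [r ri]] [E [B1 [j [p [injE jp idB1]]]]].
  have [jI' ps kerp] := jp; have jI := short_exact_inj jp.
  (* [q] extends the idempotent [i \o r] of [B] to an endomorphism of [E], in general not
     idempotent. It induces [B1 -> coker m], while [1 - q] induces [coker m -> E]; the decomposition
     [x = q x + (x - q x)] then makes [coker m] a retract of [B1 * E]. *)
  have [q qj] := injE _ _ j (j \o i \o r : {linear B -> E}) jI.
  pose m := j \o i.
  have mI : injective m by move=> x y /jI /(congr1 r); rewrite !ri.
  exists E, (coker m), m, (@coker_pi _ _ _ m); split=> //; first exact: coker_exact.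
  have [a aE] : exists a : {linear coker m -> B1}, forall x, a (coker_pi m x) = p x.
    apply: lin_factor => [y|x /coker_pi_eq0[y ->]]; first exact: coker_surj.
    by rewrite /m /= (short_exact_comp0 _ jp).
  have [b bE] : exists b : {linear B1 -> coker m}, forall x, b (p x) = (coker_pi m \o q) x.
    apply: lin_factor => // x /kerp[y ->] /=.
    by apply/coker_pi_eq0; exists (r y); rewrite qj.
  have [t tE] : exists t : {linear coker m -> E},
      forall x, t (coker_pi m x) = (idfun \- q) x.
    apply: lin_factor => [y|x /coker_pi_eq0[y ->] /=]; first exact: coker_surj.
    by rewrite qj /= ri subrr.
  have uL k x y : (a (k *: x + y), t (k *: x + y))
     = k *: ((a x, t x) : (B1 * E)%type) + (a y, t y).
    by rewrite !linearP.
  have vL k (x y : (B1 * E)%type) :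
      b (k *: x + y).1 + coker_pi m (k *: x + y).2
      = k *: (b x.1 + coker_pi m x.2) + (b y.1 + coker_pi m y.2).
    by rewrite !linearP scalerDr addrACA.
  apply: (IHs _ (B1 * E)%type).
    exists (lin_of uL), (lin_of vL) => z /=; have [x <-] := coker_surj z.
    by rewrite aE tE bE /= linearB addrC subrK.
  pose s1 : {linear B1 -> (B1 * E)%type} :=
    lin_of (f := fun x => (x, 0)) (fun k x y => congr2 pair (erefl (k *: x + y))
      (esym (etrans (addr0 _) (scaler0 E k)))).
  apply: (IHe _ _ _ s1 (snd : {linear (B1 * E)%type -> E})) => //.
    exact: prod_exact.
  exact: (injdim_le_mono (m := 0%N)).
Qed.

Lemma injdim_le_ext n (X Y Z : lmodType R) (f : {linear X -> Y}) (g : {linear Y -> Z}) :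
  short_exact f g -> injdim_le n X -> injdim_le n Z -> injdim_le n Y.
Proof. exact: (summand_injdim_le_aux n).1. Qed.

Lemma injdim_le_summand n (M B : lmodType R) :
  summand M B -> injdim_le n B -> injdim_le n M.
Proof. exact: (summand_injdim_le_aux n).2. Qed.

(** Embedding [B] in an injective [E] makes [E / A] an extension of [E / B] by [C]. Raising the
    bound on [B] by [injdim_leS] supplies such an [E], with [E / B] of dimension at most [n], also
    when [n = 0]. *)
Lemma injdim_le_ker n (A B C : lmodType R) (f : {linear A -> B}) (g : {linear B -> C}) :
  short_exact f g -> injdim_le n B -> injdim_le n C -> injdim_le n.+1 A.
Proof.
move=> fg /injdim_leS[E [B1 [j [p [injE jp idB1]]]]] idC.
have [_ gs ker] := fg; have [_ ps kerp] := jp.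
pose m := j \o f.
have mI : injective m by move=> x y /(short_exact_inj jp) /(short_exact_inj fg).
exists E, (coker m), m, (@coker_pi _ _ _ m); split=> //; first exact: coker_exact.
have [u uE] : exists u : {linear C -> coker m}, forall x, u (g x) = (coker_pi m \o j) x.
  by apply: lin_factor => // x /ker[y ->]; apply/coker_pi_eq0; exists y.
have [v vE] : exists v : {linear coker m -> B1}, forall x, v (coker_pi m x) = p x.
  apply: lin_factor => [y|x /coker_pi_eq0[y ->]]; first exact: coker_surj.
  by rewrite /m /= (short_exact_comp0 _ jp).
apply: (injdim_le_ext (f := u) (g := v)) => //; split.
- move=> z; have [y <-] := gs z; rewrite uE /= => /coker_pi_eq0[x].
  by move=> /(short_exact_inj jp) ->; rewrite short_exact_comp0.
- by move=> z; have [y <-] := ps z; exists (coker_pi m y); rewrite vE.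
- move=> y; split=> [|[z ->]].
    have [x <-] := coker_surj y; rewrite vE => /kerp[b ->].
    by exists (g b); rewrite uE.
  by have [b <-] := gs z; rewrite uE /= vE short_exact_comp0.
Qed.
End InjectiveDimension.

(** * Relative cosyzygies and coinduced modules *)

Section RelativeModules.
Variables (S : comPzRingType) (L : pzRingType) (i : {rmorphism S -> L}).

(** [S]-linearity as a predicate on plain functions avoids two module structures on one carrier;
    [restr] provides the second structure only where genuine [S]-modules are required. *)
Definition slin (M N : lmodType L) (f : M -> N) : Prop :=
  forall s x y, f (i s *: x + y) = i s *: f x + f y.

Section SlinTheory.
Variables (M N : lmodType L) (f : M -> N).
Hypothesis fL : slin f.

Lemma slinD x y : f (x + y) = f x + f y.
Proof. by have := fL 1 x y; rewrite rmorph1 !scale1r. Qed.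

Lemma slin0 : f 0 = 0.
Proof. by apply: (addrI (f 0)); rewrite -slinD !addr0. Qed.

Lemma slinZ s x : f (i s *: x) = i s *: f x.
Proof. by have := fL s x 0; rewrite slin0 !addr0. Qed.

Lemma slinN x : f (- x) = - f x.
Proof. by apply/eqP; rewrite -addr_eq0 -slinD addNr slin0. Qed.

Lemma slinB x y : f (x - y) = f x - f y.
Proof. by rewrite slinD slinN. Qed.

Lemma slin_sum (I : finType) (F : I -> M) : f (\sum_j F j) = \sum_j f (F j).
Proof.
apply: (big_ind2 (fun x y => f x = y)) => //; first exact: slin0.
by move=> x1 x2 y1 y2 <- <-; exact: slinD.
Qed.
End SlinTheory.

(** Finite projectivity over [S] in coordinates: the functionals [f j] are what will be reduced
    modulo the maximal ideal. *)
Definition dual_basis (M : lmodType L) n (e : 'I_n -> M) (f : 'I_n -> M -> S) : Prop :=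
  (forall j s x y, f j (i s *: x + y) = s * f j x + f j y) /\
  (forall x, x = \sum_j i (f j x) *: e j).

Definition sproj (M : lmodType L) : Prop :=
  exists n (e : 'I_n -> M) (f : 'I_n -> M -> S), dual_basis e f.

Section DualBasisTheory.
Variables (M : lmodType L) (n : nat) (e : 'I_n -> M) (f : 'I_n -> M -> S).
Hypothesis ef : dual_basis e f.

Lemma dual_basisD j x y : f j (x + y) = f j x + f j y.
Proof. by have := ef.1 j 1 x y; rewrite rmorph1 scale1r mul1r. Qed.

Lemma dual_basis0 j : f j 0 = 0.
Proof. by apply: (addrI (f j 0)); rewrite -dual_basisD !addr0. Qed.

Lemma dual_basisZ j s x : f j (i s *: x) = s * f j x.
Proof. by have := ef.1 j s x 0; rewrite dual_basis0 !addr0. Qed.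

Lemma dual_basisN j x : f j (- x) = - f j x.
Proof. by apply/eqP; rewrite -addr_eq0 -dual_basisD addNr dual_basis0. Qed.

Lemma dual_basis_sum j (I : finType) (F : I -> M) :
  f j (\sum_k F k) = \sum_k f j (F k).
Proof.
apply: (big_ind2 (fun x y => f j x = y)) => //; first exact: dual_basis0.
by move=> x1 x2 y1 y2 <- <-; exact: dual_basisD.
Qed.

(** The target is a mere additive group with an action [act], because in the reduction it is an
    [L']-module on which [S] acts through [sigma]. The lift is prescribed on the generators
    [e j]. *)
Lemma dual_basis_lift (N : lmodType L) (P : zmodType) (q : N -> P) (act : S -> P -> P)
    (g : M -> P) :
    {morph q : x y / x + y} -> (forall s y, q (i s *: y) = act s (q y)) ->
    (forall z, exists y, q y = z) ->
    {morph g : x y / x + y} -> (forall s x, g (i s *: x) = act s (g x)) ->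
  exists h : M -> N, slin h /\ forall x, q (h x) = g x.
Proof.
move=> qD qZ qs gD gZ; have /choice[r rK] := qs.
pose h x := \sum_j i (f j x) *: r (g (e j)).
have add0 (T U : zmodType) (k : T -> U) : {morph k : x y / x + y} -> k 0 = 0.
  by move=> kD; apply: (addrI (k 0)); rewrite -kD !addr0.
exists h; split=> [s x y|x].
  rewrite /h scaler_sumr -big_split; apply: eq_bigr => j _ /=.
  by rewrite ef.1 rmorphD rmorphM scalerDl scalerA.
rewrite [in RHS](ef.2 x) /h.
rewrite (big_morph q qD (add0 _ _ _ qD)) (big_morph g gD (add0 _ _ _ gD)).
by apply: eq_bigr => j _; rewrite qZ gZ rK.
Qed.
End DualBasisTheory.

Lemma sproj_lift (X N P : lmodType L) (q : {linear N -> P}) (g : X -> P) :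
    sproj X -> (forall z, exists y, q y = z) -> slin g ->
  exists h : X -> N, slin h /\ forall x, q (h x) = g x.
Proof.
case=> n [e [f ef]] qs gL.
apply: (dual_basis_lift ef (act := fun s z => i s *: z)) => //.
- by move=> x y; rewrite linearD.
- by move=> s y; rewrite linearZ_LR.
- by move=> x y; rewrite (slinD gL).
- by move=> s x; rewrite (slinZ gL).
Qed.

(* [omega C] is [Hom_S(L, C) / C], realised as the complement of [C] consisting of
   the maps that vanish at [1]. *)
Record omega (C : lmodType L) := Omega {
  omega_fun :> L -> C;
  omega_slin : slin (omega_fun : L^o -> C);
  omega_1 : omega_fun 1 = 0
}.

Section OmegaModule.
Variable C : lmodType L.
Implicit Types phi psi : omega C.

Lemma omega_ext phi psi : (forall l, phi l = psi l) -> phi = psi.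
Proof.
case: phi => f fL f1; case: psi => g gL g1 /= /funext e; subst g.
by congr Omega; exact: Prop_irrelevance.
Qed.

Lemma omegaD phi l m : phi (l + m) = phi l + phi m.
Proof. exact: (slinD (omega_slin phi)). Qed.

Lemma omegaZ phi s l : phi (i s * l) = i s *: phi l.
Proof. exact: (slinZ (omega_slin phi)). Qed.

Lemma omegai phi s : phi (i s) = 0.
Proof. by rewrite -[i s]mulr1 omegaZ omega_1 scaler0. Qed.

HB.instance Definition _ := gen_eqMixin (omega C).
HB.instance Definition _ := gen_choiceMixin (omega C).

Definition omega_zero : omega C.
Proof.
exists (fun=> 0) => // s x y.
by rewrite scaler0 addr0.
Defined.

Definition omega_opp phi : omega C.
Proof.
exists (fun l => - phi l) => [s x y|]; last by rewrite omega_1 oppr0.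
by rewrite (omega_slin phi) opprD scalerN.
Defined.

Definition omega_add phi psi : omega C.
Proof.
exists (fun l => phi l + psi l) => [s x y|]; last by rewrite !omega_1 addr0.
by rewrite (omega_slin phi) (omega_slin psi) scalerDr addrACA.
Defined.

(** The coinduced action [l |-> phi (l * m)] has value [phi m] at [1]. Subtracting the image
    [l |-> l *: phi m] of that element of [C] returns to the representative vanishing at [1]. *)
Definition omega_scale (m : L) phi : omega C.
Proof.
exists (fun l => phi (l * m) - l *: phi m) => [s x y|]; last first.
  by rewrite mul1r scale1r subrr.
rewrite mulrDl -[_ *: x * m]mulrA omegaD omegaZ scalerDl -scalerA scalerBr.
by rewrite opprD addrACA.
Defined.

Fact omega_addA : associative omega_add.
Proof. by move=> x y z; apply: omega_ext => l /=; rewrite addrA. Qed.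

Fact omega_addC : commutative omega_add.
Proof. by move=> x y; apply: omega_ext => l /=; rewrite addrC. Qed.

Fact omega_add0 : left_id omega_zero omega_add.
Proof. by move=> x; apply: omega_ext => l /=; rewrite add0r. Qed.

Fact omega_addN : left_inverse omega_zero omega_opp omega_add.
Proof. by move=> x; apply: omega_ext => l /=; rewrite addNr. Qed.

HB.instance Definition _ :=
  GRing.isZmodule.Build (omega C) omega_addA omega_addC omega_add0 omega_addN.

Fact omega_scaleA a b phi :
  omega_scale a (omega_scale b phi) = omega_scale (a * b) phi.
Proof.
apply: omega_ext => l /=; rewrite scalerBr scalerA mulrA opprB.
by rewrite addrA subrK.
Qed.

Fact omega_scale1 : left_id 1 omega_scale.
Proof.
by move=> x; apply: omega_ext => l /=; rewrite mulr1 omega_1 scaler0 subr0.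
Qed.

Fact omega_scaleDr : right_distributive omega_scale +%R.
Proof.
by move=> a x y; apply: omega_ext => l /=; rewrite scalerDr opprD addrACA.
Qed.

Fact omega_scaleDl phi : {morph omega_scale^~ phi : a b / a + b}.
Proof.
by move=> a b; apply: omega_ext => l /=; rewrite mulrDr !omegaD scalerDr opprD addrACA.
Qed.

HB.instance Definition _ := GRing.Zmodule_isLmodule.Build L (omega C)
  omega_scaleA omega_scale1 omega_scaleDr omega_scaleDl.

Lemma omega_addE phi psi l : (phi + psi) l = phi l + psi l. Proof. by []. Qed.
Lemma omega_oppE phi l : (- phi) l = - phi l. Proof. by []. Qed.
Lemma omega0E l : (0 : omega C) l = 0. Proof. by []. Qed.
Lemma omega_scaleE m phi l : (m *: phi) l = phi (l * m) - l *: phi m.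
Proof. by []. Qed.
End OmegaModule.

(* The derivation [(m, phi) |-> phi m] is universal among those with values in [C], so
   this says that every [S]-split extension of [L]-modules with kernel [C] splits. *)
Definition relinj (C : lmodType L) : Prop :=
  exists g : omega C -> C, slin g /\
    forall (phi : omega C) m, phi m = m *: g phi - g (m *: phi).

Hypothesis iC : forall s a, i s * a = a * i s.

(** The correction term of the action disappears because [phi] is [S]-linear and kills [1], hence
    kills the image of [i]. *)
Lemma omega_iE (C : lmodType L) s (phi : omega C) l : (i s *: phi) l = i s *: phi l.
Proof. by rewrite omega_scaleE omegai scaler0 subr0 -iC omegaZ. Qed.

Section Coboundary.
Variables (X M : lmodType L) (g : X -> M).
Hypothesis gL : slin g.

(** The defect of [L]-linearity of [g]. Up to sign this is the map from [Hom_L(X, coind M)], which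
    is [Hom_S(X, M)], to [Hom_L(X, omega M)]; its values are the inner derivations. *)
Definition cobound (x : X) : omega M.
Proof.
exists (fun m => m *: g x - g (m *: x)) => [s a b|]; last by rewrite !scale1r subrr.
by rewrite !scalerDl -!scalerA gL scalerBr opprD addrACA.
Defined.

Lemma cobound_linear a x y : cobound (a *: x + y) = a *: cobound x + cobound y.
Proof.
apply: omega_ext => m; rewrite omega_addE omega_scaleE /=.
rewrite scalerDr (slinD gL) scalerDr (slinD gL) scalerA opprD addrACA.
congr (_ + _); rewrite scalerBr scalerA opprB.
by rewrite [RHS]addrC addrA subrK.
Qed.
End Coboundary.

(* [Ext^1_L(X, M) = 0] for all [X] that are finite projective over [S]: derivations
   [L * X -> M] are the [L]-linear maps [X -> omega M], and inner ones come from [g]. *)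
Definition ext1_vanish (M : lmodType L) : Prop :=
  forall X : lmodType L, sproj X -> forall u : {linear X -> omega M},
  exists g : X -> M, slin g /\ forall x m, u x m = m *: g x - g (m *: x).

Lemma relinj_ext1 M : relinj M -> ext1_vanish M.
Proof.
move=> [g [gL gE]] X _ u; exists (g \o u); split=> [s x y|x m] /=.
  by rewrite linearP gL.
by rewrite linearZ_LR -gE.
Qed.

Lemma ext1_relinj M : sproj (omega M) -> ext1_vanish M -> relinj M.
Proof. by move=> pM /(_ _ pM (idfun : {linear omega M -> omega M})). Qed.

(** The splitting [g] of [M] is applied argumentwise to [Phi], whose values lie in [omega M]. The
    sign compensates the minus in the action on [omega]. *)
Lemma relinj_omega M : relinj M -> relinj (omega M).
Proof.
move=> [g [gL gE]].
have hP (Phi : omega (omega M)) : exists phi : omega M, forall l, phi l = - g (Phi l).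
  have kL : slin ((fun l => - g (Phi l)) : L^o -> M).
    by move=> s x y; rewrite (omega_slin Phi) gL opprD scalerN.
  have k1 : - g (Phi 1) = 0 by rewrite omega_1 (slin0 gL) oppr0.
  by exists (Omega kL k1).
have [h hE] := choice hP; exists h; split.
  move=> s x y; apply: omega_ext => l; rewrite omega_addE omega_iE !hE.
  by rewrite omega_addE omega_iE gL opprD scalerN.
move=> Phi m; apply: omega_ext => l.
rewrite omega_addE omega_oppE omega_scaleE !hE omega_scaleE (slinB gL) scalerN.
by rewrite gE !opprK [- _ + _]addrC addrA subrK.
Qed.

Section OmegaMap.
Variables (M N : lmodType L) (f : {linear M -> N}).

Definition omega_map_fun (phi : omega M) : omega N.
Proof.
exists (fun l => f (phi l)) => [s x y|]; last by rewrite omega_1 linear0.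
by rewrite (omega_slin phi) linearP.
Defined.

Fact omega_map_linear a x y :
  omega_map_fun (a *: x + y) = a *: omega_map_fun x + omega_map_fun y.
Proof. by apply: omega_ext => l /=; rewrite linearD linearB linearZ_LR. Qed.

Definition omega_map : {linear omega M -> omega N} := lin_of omega_map_linear.

Lemma omega_mapE phi l : omega_map phi l = f (phi l). Proof. by []. Qed.
End OmegaMap.

(** This is the projection of [Hom_S(L, C)] onto its quotient by [C], in terms of representatives
    vanishing at [1]. *)
Lemma omega_sub_inner (C : lmodType L) (h : L -> C) :
  slin (h : L^o -> C) -> exists phi : omega C, forall l, phi l = h l - l *: h 1.
Proof.
move=> hL.
have kL : slin ((fun l : L => h l - l *: h 1) : L^o -> C).
  move=> s x y; rewrite hL scalerDl -scalerA scalerBr opprD.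
  by rewrite addrACA.
have k1 : h 1 - 1 *: h 1 = 0 by rewrite scale1r subrr.
by exists (Omega kL k1).
Qed.

Lemma omega_exact (M N P : lmodType L) (f : {linear M -> N}) (g : {linear N -> P}) :
  sproj L^o -> short_exact f g -> short_exact (omega_map f) (omega_map g).
Proof.
move=> pL fg; have [f0 gs ker] := fg; split.
- move=> phi e; apply: omega_ext => l; apply: f0.
  by rewrite -omega_mapE e.
(* The [S]-linear lift [h] need not vanish at [1]. Normalising it does not disturb its image,
   because [psi 1 = 0]. *)
- move=> psi; have [h [hL hE]] := sproj_lift pL gs (omega_slin psi).
  have [phi phiE] := omega_sub_inner hL; exists phi; apply: omega_ext => l.
  rewrite omega_mapE phiE linearB linearZ_LR !hE.
  by rewrite omega_1 scaler0 subr0.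
- move=> phi; split=> [e|[x ->]]; last first.
    by apply: omega_ext => l; rewrite !omega_mapE (short_exact_comp0 _ fg).
  have /choice[k kE] l : exists x, phi l = f x.
    by apply/ker; rewrite -omega_mapE e.
  have fI := short_exact_inj fg.
  have kL : slin (k : L^o -> M).
    by move=> s x y; apply: fI; rewrite -kE linearP -!kE (omega_slin phi).
  have k1 : k 1 = 0 by apply: fI; rewrite -kE omega_1 linear0.
  by exists (Omega kL k1); apply: omega_ext => l; rewrite omega_mapE -kE.
Qed.

(* [Ext^1_L(X, omega M) = Ext^2_L(X, M) = Ext^1_L(X, N)] for [X] projective over [S]. *)
Lemma ext1_vanish_shift (M I N : lmodType L) (f : {linear M -> I}) (q : {linear I -> N}) :
    sproj L^o -> short_exact f q -> relinj I -> ext1_vanish N ->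
  ext1_vanish (omega M).
Proof.
move=> pL fq injI vN X pX u.
have ofq := omega_exact pL fq; have [_ qs _] := fq; have [_ _ oker] := ofq.
have [w [wL wE]] := relinj_ext1 (relinj_omega injI) pX
  (omega_map (omega_map f) \o u : {linear X -> omega (omega I)}).
(* [w] is only [S]-linear, but its defect comes from [omega M] and dies in [omega N]. *)
have w'L a x y : omega_map q (w (a *: x + y)) = a *: omega_map q (w x) + omega_map q (w y).
  rewrite (slinD wL) linearD; congr (_ + _); rewrite -linearZ_LR; apply/esym/subr0_eq.
  rewrite -linearB -wE /=.
  exact: short_exact_comp0 ofq.
have [v' [v'L v'E]] := vN X pX (lin_of w'L).
have [v [vL vE]] := sproj_lift pX qs v'L.
(* A coboundary is [L]-linear in [x], so subtracting it leaves the defect of [w] unchanged; the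
   difference now dies in [omega N] and therefore comes from [omega M]. *)
have /choice[y yE] x : exists y, w x - cobound vL x = omega_map f y.
  apply/oker/omega_ext => m; rewrite omega0E omega_mapE linearB /=.
  have /= := v'E x m; rewrite -!vE => ->.
  by rewrite linearB linearZ_LR subrr.
have ofI := short_exact_inj ofq.
exists y; split.
  move=> s a b; apply: ofI; rewrite -yE linearP -!yE wL cobound_linear.
  by rewrite scalerBr opprD addrACA.
move=> x m; apply: ofI; rewrite linearB linearZ_LR -!yE.
have -> : cobound vL (m *: x) = m *: cobound vL x.
  have := cobound_linear vL m x 0; rewrite addr0 => ->.
  suff -> : cobound vL 0 = 0 by rewrite addr0.
  by apply: omega_ext => l /=; rewrite !scaler0 (slin0 vL) scaler0 subrr.
rewrite scalerBr opprB addrA subrK.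
by have := wE x m => /=.
Qed.

Fixpoint omegan (n : nat) (M : lmodType L) : lmodType L :=
  if n is n'.+1 then omega (omegan n' M) else M.

Lemma omegan_exact n (M N P : lmodType L) (f : {linear M -> N}) (g : {linear N -> P}) :
    sproj L^o -> short_exact f g ->
  exists (f' : {linear omegan n M -> omegan n N})
         (g' : {linear omegan n N -> omegan n P}), short_exact f' g'.
Proof.
move=> pL fg; elim: n => [|n [f' [g' fg']]]; first by exists f, g.
by exists (omega_map f'), (omega_map g'); exact: omega_exact.
Qed.

(** The generators are the elementary maps [l |-> i (f a l) *: c b], normalised at [1]. The last
    clause, that each functional is a coordinate of a value of [phi], later transfers the kernel
    condition of [reduction] from [C] to [omega C]. *)
Lemma omega_dual_basis (C : lmodType L) n (e : 'I_n -> L^o) f m (c : 'I_m -> C) k :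
    dual_basis e f -> dual_basis c k ->
  exists N (E : 'I_N -> omega C) F, dual_basis E F /\
    forall j, exists a b, forall phi, F j phi = k b (phi (e a)).
Proof.
move=> ef ck.
have /choice[E EE] (t : 'I_n * 'I_m) :
    exists phi : omega C, forall l, phi l = i (f t.1 l) *: c t.2 - l *: (i (f t.1 1) *: c t.2).
  apply: (omega_sub_inner (h := fun l => i (f t.1 l) *: c t.2)) => s x y.
  by rewrite ef.1 rmorphD rmorphM scalerDl -scalerA.
pose F (t : 'I_n * 'I_m) (phi : omega C) := k t.2 (phi (e t.1)).
exists #|{: 'I_n * 'I_m}|, (E \o enum_val), (fun j => F (enum_val j)).
split; last by move=> j; exists (enum_val j).1, (enum_val j).2.
split.
  by move=> j s x y; rewrite /F omega_addE omega_iE ck.1.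
move=> phi; rewrite -(reindex (fun j : 'I_#|{: 'I_n * 'I_m}| => enum_val j)
   (F := fun t => i (F t phi) *: E t) (P := predT)) /=; last first.
  by apply: onW_bij; exact: enum_val_bij.
have phiE l : phi l = \sum_t i (F t phi) *: (i (f t.1 l) *: c t.2).
  rewrite {1}(ef.2 l) -(pair_bigA _ (fun a b => i (F (a, b) phi) *: (i (f a l) *: c b))) /=.
  rewrite (slin_sum (omega_slin phi)); apply: eq_bigr => a _.
  rewrite omegaZ (ck.2 (phi (e a))) scaler_sumr; apply: eq_bigr => b _.
  by rewrite !scalerA -!rmorphM mulrC.
have sumE (T : finType) (G : T -> omega C) l : (\sum_t G t) l = \sum_t G t l.
  by apply: (big_ind2 (fun (x : omega C) y => x l = y)) => // x1 x2 y1 y2 <- <-.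
apply: omega_ext => l; rewrite sumE.
under eq_bigr => t _ do rewrite omega_iE EE scalerBr.
(* The main terms add up to [phi l] and the normalising terms to [l *: phi 1], which is zero. *)
rewrite big_split /= -phiE sumrN -[LHS]subr0; congr (_ - _); apply/esym.
transitivity (l *: phi 1); last by rewrite omega_1 scaler0.
rewrite phiE scaler_sumr; apply: eq_bigr => t _.
by rewrite scalerA iC -scalerA.
Qed.

Lemma omega_sproj C : sproj L^o -> sproj C -> sproj (omega C).
Proof.
move=> [n [e [f ef]]] [m [c [k ck]]].
by have [N [E [F [EF _]]]] := omega_dual_basis ef ck; exists N, E, F.
Qed.

Lemma omegan_sproj n C : sproj L^o -> sproj C -> sproj (omegan n C).
Proof. by move=> pL pC; elim: n => // n IHn; exact: omega_sproj. Qed.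

(* The unused first argument lets unification find the [S]-module structure. *)
Definition restr (_ : {rmorphism S -> L}) (M : lmodType L) : Type := M.

Section Restriction.
Variable M : lmodType L.
HB.instance Definition _ := GRing.Zmodule.on (restr i M).

Definition restr_scale (s : S) (x : restr i M) : restr i M := i s *: (x : M).

Fact restr_scaleA a b x : restr_scale a (restr_scale b x) = restr_scale (a * b) x.
Proof. by rewrite /restr_scale scalerA rmorphM. Qed.

Fact restr_scale1 : left_id 1 restr_scale.
Proof. by move=> x; rewrite /restr_scale rmorph1 scale1r. Qed.

Fact restr_scaleDr : right_distributive restr_scale +%R.
Proof. by move=> a x y; rewrite /restr_scale scalerDr. Qed.

Fact restr_scaleDl x : {morph restr_scale^~ x : a b / a + b}.
Proof. by move=> a b; rewrite /restr_scale rmorphD scalerDl. Qed.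

HB.instance Definition _ := GRing.Zmodule_isLmodule.Build S (restr i M)
  restr_scaleA restr_scale1 restr_scaleDr restr_scaleDl.

Lemma restrZ s (x : restr i M) : s *: x = i s *: (x : M). Proof. by []. Qed.
End Restriction.

Definition restr_map (M N : lmodType L) (f : {linear M -> N}) :
  {linear restr i M -> restr i N} :=
  lin_of (M := restr i M) (N := restr i N) (f := f) (fun a x y => linearP f (i a) x y).

Lemma restr_exact (M N P : lmodType L) (f : {linear M -> N}) (g : {linear N -> P}) :
  short_exact f g -> short_exact (restr_map f) (restr_map g).
Proof. by []. Qed.

(** * Coinduced modules [Hom_S(L, J)] *)

Record coind (J : lmodType S) := Coind {
  coind_fun :> L -> J;
  coind_slin : forall s a b, coind_fun (i s * a + b) = s *: coind_fun a + coind_fun b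
}.

Section Coinduced.
Variable J : lmodType S.
Implicit Types phi psi : coind J.

Lemma coind_ext phi psi : (forall l, phi l = psi l) -> phi = psi.
Proof.
case: phi => f fL; case: psi => g gL /= /funext e; subst g.
by congr Coind; exact: Prop_irrelevance.
Qed.

HB.instance Definition _ := gen_eqMixin (coind J).
HB.instance Definition _ := gen_choiceMixin (coind J).

Definition coind_zero : coind J.
Proof. by exists (fun=> 0) => s x y; rewrite scaler0 addr0. Defined.

Definition coind_opp phi : coind J.
Proof.
by exists (fun l => - phi l) => s x y; rewrite coind_slin opprD scalerN.
Defined.

Definition coind_add phi psi : coind J.
Proof.
by exists (fun l => phi l + psi l) => s x y; rewrite !coind_slin scalerDr addrACA.
Defined.

Definition coind_scale (m : L) phi : coind J.
Proof.
by exists (fun l => phi (l * m)) => s x y; rewrite mulrDl -mulrA coind_slin.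
Defined.

Fact coind_addA : associative coind_add.
Proof. by move=> x y z; apply: coind_ext => l /=; rewrite addrA. Qed.

Fact coind_addC : commutative coind_add.
Proof. by move=> x y; apply: coind_ext => l /=; rewrite addrC. Qed.

Fact coind_add0 : left_id coind_zero coind_add.
Proof. by move=> x; apply: coind_ext => l /=; rewrite add0r. Qed.

Fact coind_addN : left_inverse coind_zero coind_opp coind_add.
Proof. by move=> x; apply: coind_ext => l /=; rewrite addNr. Qed.

HB.instance Definition _ :=
  GRing.isZmodule.Build (coind J) coind_addA coind_addC coind_add0 coind_addN.

Lemma coindD phi l m : phi (l + m) = phi l + phi m.
Proof. by have := coind_slin phi 1 l m; rewrite rmorph1 mul1r scale1r. Qed.

Lemma coindZ phi s l : phi (i s * l) = s *: phi l.
Proof.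
have phi0 : phi 0 = 0 by apply: (addrI (phi 0)); rewrite -coindD !addr0.
by have := coind_slin phi s l 0; rewrite phi0 !addr0.
Qed.

Fact coind_scaleA a b phi : coind_scale a (coind_scale b phi) = coind_scale (a * b) phi.
Proof. by apply: coind_ext => l /=; rewrite mulrA. Qed.

Fact coind_scale1 : left_id 1 coind_scale.
Proof. by move=> x; apply: coind_ext => l /=; rewrite mulr1. Qed.

Fact coind_scaleDr : right_distributive coind_scale +%R.
Proof. by move=> a x y; apply: coind_ext => l. Qed.

Fact coind_scaleDl phi : {morph coind_scale^~ phi : a b / a + b}.
Proof. by move=> a b; apply: coind_ext => l /=; rewrite mulrDr coindD. Qed.

HB.instance Definition _ := GRing.Zmodule_isLmodule.Build L (coind J)
  coind_scaleA coind_scale1 coind_scaleDr coind_scaleDl.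

Lemma coind_addE phi psi l : (phi + psi) l = phi l + psi l. Proof. by []. Qed.
Lemma coind_scaleE m phi l : (m *: phi) l = phi (l * m). Proof. by []. Qed.

(** Adjunction: evaluation at [1] turns [L]-linear maps into [coind J] into [S]-linear maps into
    [J], and [y |-> (l |-> h (l *: y))] goes back. *)
Lemma coind_injective : injective_module J -> injective_module (coind J).
Proof.
move=> injJ M N f g fI.
have g1L s (x y : restr i M) : g (s *: x + y) 1 = s *: g x 1 + g y 1.
  by rewrite linearP coind_addE coind_scaleE mul1r -[i s]mulr1 coindZ.
have [h hE] := injJ (restr i M) (restr i N) (restr_map f) (lin_of g1L) fI.
have kP (y : N) : exists phi : coind J, forall l, phi l = h (l *: y).
  have kL s a b : h ((i s * a + b) *: y) = s *: h (a *: y) + h (b *: y).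
    by rewrite scalerDl -scalerA -[i s *: _]/(s *: (a *: y : restr i N)) linearP.
  by exists (Coind kL).
have [k kE] := choice kP.
have kL a x y : k (a *: x + y) = a *: k x + k y.
  apply: coind_ext => l; rewrite coind_addE coind_scaleE !kE scalerDr scalerA.
  by rewrite (linearD h).
exists (lin_of kL) => x; apply: coind_ext => l /=; rewrite kE.
have -> : l *: f x = restr_map f (l *: x) by rewrite /= linearZ_LR.
by rewrite hE /= linearZ_LR coind_scaleE mul1r.
Qed.
End Coinduced.

Section CoinducedMap.
Variables (J K : lmodType S) (f : {linear J -> K}).

Definition coind_map_fun (phi : coind J) : coind K.
Proof. by exists (fun l => f (phi l)) => s x y; rewrite coind_slin linearP. Defined.

Fact coind_map_linear a x y :
  coind_map_fun (a *: x + y) = a *: coind_map_fun x + coind_map_fun y.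
Proof. by apply: coind_ext => l /=; rewrite linearD. Qed.

Definition coind_map : {linear coind J -> coind K} := lin_of coind_map_linear.
End CoinducedMap.

Lemma coind_exact (M N P : lmodType S) (f : {linear M -> N}) (g : {linear N -> P}) :
  sproj L^o -> short_exact f g -> short_exact (coind_map f) (coind_map g).
Proof.
move=> [n [e [b eb]]] fg; have [f0 gs ker] := fg; split.
- move=> phi E; apply: coind_ext => l; apply: f0.
  by have := congr1 (fun k : coind N => k l) E.
- move=> psi.
  have /choice[c cE] j : exists y, g y = psi (e j) by exact: gs.
  have hL s x y : \sum_j b j (i s * x + y) *: c j
      = s *: (\sum_j b j x *: c j) + \sum_j b j y *: c j.
    rewrite scaler_sumr -big_split; apply: eq_bigr => j _ /=.
    by rewrite -[i s * x]/(i s *: (x : L^o)) eb.1 scalerDl scalerA.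
  have psi0 : psi 0 = 0.
    by apply: (addrI (psi 0)); rewrite -coindD !addr0.
  have psi_sum (F : 'I_n -> L) : psi (\sum_j F j) = \sum_j psi (F j).
    by apply: (big_ind2 (fun x y => psi x = y)) => // x1 x2 y1 y2 <- <-; rewrite coindD.
  exists (Coind hL); apply: coind_ext => l /=.
  rewrite linear_sum [in RHS](eb.2 l) psi_sum; apply: eq_bigr => j _.
  by rewrite linearZ_LR cE coindZ.
- move=> phi; split=> [E|[x ->]]; last first.
    by apply: coind_ext => l /=; rewrite (short_exact_comp0 _ fg).
  have /choice[k kE] l : exists x, phi l = f x.
    by apply/ker; have := congr1 (fun k : coind P => k l) E.
  have kL s x y : k (i s * x + y) = s *: k x + k y.
    by apply: (short_exact_inj fg); rewrite -kE linearP -!kE coind_slin.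
  by exists (Coind kL); apply: coind_ext => l /=; rewrite -kE.
Qed.

Lemma coind_injdim_le n (J : lmodType S) :
  sproj L^o -> injdim_le n J -> injdim_le n (coind J).
Proof.
move=> pL; elim: n J => [|n IHn] J /=; first exact: coind_injective.
case=> E [N [f [g [injE fg idN]]]].
exists (coind E), (coind N), (coind_map f), (coind_map g); split.
- exact: coind_injective.
- exact: coind_exact.
- exact: IHn.
Qed.

Section Unit.
Variable C : lmodType L.

Definition coind_unit_fun (c : C) : coind (restr i C).
Proof. by exists (fun l => l *: c) => s a b; rewrite scalerDl -scalerA. Defined.

Fact coind_unit_linear a x y :
  coind_unit_fun (a *: x + y) = a *: coind_unit_fun x + coind_unit_fun y.
Proof. by apply: coind_ext => l /=; rewrite scalerDr scalerA. Qed.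

Definition coind_unit : {linear C -> coind (restr i C)} := lin_of coind_unit_linear.

Definition coind_omega_fun (phi : coind (restr i C)) : omega C.
Proof.
exists (fun l => (phi l : C) - l *: (phi 1 : C)) => [s x y|]; last by rewrite scale1r subrr.
by rewrite (coind_slin phi) restrZ scalerDl -scalerA scalerBr opprD addrACA.
Defined.

Fact coind_omega_linear a x y :
  coind_omega_fun (a *: x + y) = a *: coind_omega_fun x + coind_omega_fun y.
Proof.
apply: omega_ext => l; rewrite omega_addE omega_scaleE /= mul1r.
rewrite scalerDr opprD addrACA; congr (_ + _).
by rewrite scalerBr scalerA opprB addrA subrK.
Qed.

Definition coind_omega : {linear coind (restr i C) -> omega C} := lin_of coind_omega_linear.

(** This sequence justifies reading [omega C] as [Hom_S(L, C) / C], and it is the one along which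
    dimensions are shifted. *)
Lemma coind_unit_exact : short_exact coind_unit coind_omega.
Proof.
split.
- move=> c /(congr1 (fun k : coind (restr i C) => k 1)) /=.
  by rewrite scale1r.
- move=> phi.
  exists (Coind (J := restr i C) (omega_slin phi)); apply: omega_ext => l /=.
  by rewrite omega_1 scaler0 subr0.
- move=> phi; split=> [E|[c ->]].
    exists (phi 1); apply: coind_ext => l /=.
    by apply/subr0_eq; have := congr1 (fun k : omega C => k l) E.
  by apply: omega_ext => l /=; rewrite scale1r subrr.
Qed.

Lemma injective_relinj : injective_module C -> relinj C.
Proof.
move=> injC; have [r rE] := injC _ _ coind_unit (idfun : {linear C -> C})
  (short_exact_inj coind_unit_exact).
(* [inc] is an [S]-linear section of [coind_omega], and [m *: inc phi - inc (m *: phi)] is the unit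
   applied to [phi m]. The retraction [r] of the unit therefore turns [inc] into the required
   splitting. *)
pose inc (phi : omega C) := Coind (J := restr i C) (omega_slin phi).
have incL s phi psi : inc (i s *: phi + psi) = i s *: inc phi + inc psi.
  by apply: coind_ext => l /=; rewrite omegai scaler0 subr0.
exists (fun phi => r (inc phi)); split=> [s x y|phi m]; first by rewrite incL linearP.
rewrite -linearZ_LR -linearB -[LHS]rE; congr (r _); apply: coind_ext => l /=.
by rewrite opprB addrC subrK.
Qed.

Lemma relinj_summand : relinj C -> summand C (coind (restr i C)).
Proof.
move=> [g [gL gE]]; exists coind_unit.
(* Evaluation at [1] retracts the unit but is only [S]-linear: its defect at [a] is
   [coind_omega phi a], exactly what the [g] term cancels. *)
pose r (phi : coind (restr i C)) : C := (phi 1 : C) + g (coind_omega phi).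
have rL a x y : r (a *: x + y) = a *: r x + r y.
  rewrite /r linearP (slinD gL) coind_addE coind_scaleE mul1r addrACA; congr (_ + _).
  have /= /(canRL (subrK _)) -> := gE (coind_omega x) a.
  by rewrite addrAC subrK scalerDr addrC.
exists (lin_of rL) => c /=; rewrite /r (short_exact_comp0 _ coind_unit_exact).
by rewrite (slin0 gL) addr0 /= scale1r.
Qed.
End Unit.

Lemma relinj_omegan n C : relinj C -> relinj (omegan n C).
Proof. by move=> rC; elim: n => // n; exact: relinj_omega. Qed.

Lemma injdim_omegan_relinj n C :
  sproj L^o -> sproj C -> injdim_le n C -> relinj (omegan n C).
Proof.
move=> pL pC idC; apply: ext1_relinj; first by apply: (omegan_sproj n.+1).
(* The cosyzygies [N] of an injective resolution need not be finite over [S], so the induction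
   carries the vanishing of [Ext^1]; finiteness enters once, through [ext1_relinj]. *)
elim: n C {pC} idC => [|n IHn] C /=; first by move/injective_relinj/relinj_ext1.
case=> E [N [f [g [injE fg /IHn vN]]]].
have [f' [g' fg']] := omegan_exact n pL fg.
exact: ext1_vanish_shift pL fg' (relinj_omegan n (injective_relinj injE)) vN.
Qed.

Lemma rV_injdim_le n N : injdim_le n (S^o : lmodType S) ->
  injdim_le n ('rV[S]_N : lmodType S).
Proof.
move=> idS; elim: N => [|N IHN].
  exact: (injdim_le_mono (m := 0%N) (leq0n n) (@injective0 S)).
have fL (s x y : S^o) : row_mx (s *: x + y)%:M (0 : 'rV[S]_N)
   = s *: row_mx (x%:M : 'M_1) 0 + row_mx (y%:M : 'M_1) 0.
  by rewrite scale_row_mx add_row_mx scaler0 addr0 raddfD /= -scale_scalar_mx.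
have gL s (x y : 'rV[S]_(1 + N)) : rsubmx (s *: x + y) = s *: rsubmx x + rsubmx y.
  by apply/matrixP => a b; rewrite !mxE.
apply: (injdim_le_ext (f := lin_of fL) (g := lin_of gL)) idS IHN; split.
- move=> x /= /(congr1 lsubmx); rewrite row_mxKl => /matrixP /(_ 0 0).
  by rewrite !mxE eqxx mulr1n.
- by move=> z; exists (row_mx 0 z); rewrite /= row_mxKr.
- move=> y; split=> [|[x ->]] /=; last by rewrite row_mxKr.
  move=> e; exists (lsubmx y 0 0); rewrite -[LHS]hsubmxK e.
  by rewrite -mx11_scalar.
Qed.

Lemma restr_injdim_le n C : sproj C -> injdim_le n (S^o : lmodType S) ->
  injdim_le n (restr i C).
Proof.
move=> [N [e [f ef]]] /(@rV_injdim_le n N); apply: injdim_le_summand.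
have fL s (x y : restr i C) : \row_j f j (s *: x + y) = s *: (\row_j f j x) + \row_j f j y.
  by apply/rowP => j; rewrite !mxE ef.1.
have gL s (x y : 'rV[S]_N) : (\sum_j i ((s *: x + y) 0 j) *: e j : restr i C)
   = s *: (\sum_j i (x 0 j) *: e j : restr i C) + (\sum_j i (y 0 j) *: e j : restr i C).
  rewrite scaler_sumr -big_split; apply: eq_bigr => j _ /=.
  by rewrite !mxE rmorphD rmorphM scalerDl -scalerA.
exists (lin_of fL), (lin_of gL) => x /=; rewrite [RHS](ef.2 x).
by apply: eq_bigr => j _; rewrite mxE.
Qed.

(* [omega^n C] is a summand of a coinduced module, hence of finite injective dimension;
   descend along [0 -> C -> coind C -> omega C -> 0]. *)
Lemma relinj_omegan_injdim n d C : sproj L^o -> sproj C ->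
    injdim_le d (S^o : lmodType S) -> relinj (omegan n C) ->
  exists k, injdim_le k C.
Proof.
move=> pL pC idS rC.
have idco m : injdim_le d (coind (restr i (omegan m C))).
  by apply: coind_injdim_le => //; apply: restr_injdim_le => //; exact: omegan_sproj.
suff : forall m, (m <= n)%N -> exists k, injdim_le k (omegan (n - m) C).
  by move=> /(_ n (leqnn n)); rewrite subnn.
elim=> [_|m IHm lt_m_n].
  by rewrite subn0; exists d; exact: injdim_le_summand (relinj_summand rC) (idco n).
have [k] := IHm (ltnW lt_m_n).
have -> : (n - m = (n - m.+1).+1)%N by rewrite subnSK.
move=> idk; exists (maxn d k).+1.
apply: (injdim_le_ker (coind_unit_exact _)).
- exact: injdim_le_mono (leq_maxl d k) (idco _).
- exact: injdim_le_mono (leq_maxr d k) idk.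
Qed.
End RelativeModules.

(** * Reduction modulo the maximal ideal *)

Section Reduction.
Variables (S : comNzRingType) (L : pzRingType) (i : {rmorphism S -> L}).
Variables (k : comNzRingType) (L' : pzRingType) (i' : {rmorphism k -> L'}).
Variables (sigma : {rmorphism S -> k}) (psi : {rmorphism L -> L'}).
Hypothesis iC : forall s a, i s * a = a * i s.
Hypothesis iC' : forall s a, i' s * a = a * i' s.
Hypothesis sigma_surj : forall y, exists x, sigma x = y.
Hypothesis psi_surj : forall y, exists x, psi x = y.
Hypothesis psi_i : forall s, psi (i s) = i' (sigma s).
(** The kernel of [sigma] lies in the Jacobson radical of [S]. *)
Hypothesis sigma_unit : forall s, sigma s = 1 -> exists t, t * s = 1.

(* Nakayama: [T + 1 - E], for [T] the matrix of [tau] and [E] that of the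
   projection onto [X], is the identity modulo the kernel of [sigma]. *)
Lemma red_id_bij (X : lmodType L) n (e : 'I_n -> X) f (tau : X -> X) :
    dual_basis i e f -> slin i tau ->
    (forall j x, sigma (f j (tau x - x)) = 0) ->
  (forall x, tau x = 0 -> x = 0) /\ (forall y, exists x, tau x = y).
Proof.
move=> ef tauL tau1.
pose cf x : 'cV[S]_n := \col_j f j x.
pose vec (v : 'cV[S]_n) := \sum_j i (v j 0) *: e j.
pose T := \matrix_(j, l) f j (tau (e l)).
pose E := \matrix_(j, l) f j (e l).
pose T' := T + 1%:M - E.
have vecK x : vec (cf x) = x.
  by rewrite [RHS](ef.2 x); apply: eq_bigr => j _; rewrite mxE.
have cf_vec v : cf (vec v) = E *m v.
  apply/matrixP => j l; rewrite !mxE (dual_basis_sum ef).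
  by apply: eq_bigr => a _; rewrite (dual_basisZ ef) mxE mulrC (ord1 l).
have cf_tau v : cf (tau (vec v)) = T *m v.
  apply/matrixP => j l; rewrite !mxE (slin_sum tauL) (dual_basis_sum ef).
  by apply: eq_bigr => a _; rewrite (slinZ tauL) (dual_basisZ ef) mxE mulrC (ord1 l).
have T'E x : T' *m cf x = cf (tau x).
  rewrite mulmxBl mulmxDl mul1mx -cf_tau -cf_vec !vecK.
  by rewrite addrK.
have [t tE] : exists t, t * \det T' = 1.
  apply: sigma_unit; rewrite -det_map_mx -[RHS](det1 _ n); congr (\det _).
  apply/matrixP => j l; rewrite !mxE addrAC -(dual_basisN ef) -(dual_basisD ef).
  by rewrite rmorphD tau1 add0r rmorph_nat.
have adjK : t *: (\adj T' *m T') = 1%:M.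
  by rewrite mul_adj_mx scale_scalar_mx tE.
split=> [x taux|y].
  rewrite -[x]vecK -[cf x]mul1mx -adjK -scalemxAl -mulmxA T'E taux.
  have -> : cf 0 = 0 by apply/matrixP => j l; rewrite !mxE (dual_basis0 ef).
  rewrite mulmx0 scaler0 /vec big1 // => j _.
  by rewrite mxE rmorph0 scale0r.
pose v := t *: (\adj T' *m cf y).
have T'v : T' *m v = cf y.
  by rewrite /v -scalemxAr mulmxA mul_mx_adj mul_scalar_mx scalerA tE scale1r.
have E_cf x : E *m cf x = cf x by rewrite -cf_vec vecK.
(* Multiplication by the idempotent [E] removes the summand [1 - E] of [T'] and fixes every
   coordinate vector, so the solution for [T'] also solves the equation for [T]. *)
have Tv : T *m v = cf y.
  have := congr1 (mulmx E) T'v; rewrite E_cf => <-.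
  rewrite mulmxBl mulmxDl mul1mx mulmxBr mulmxDr -cf_tau E_cf.
  by rewrite -[E *m v]cf_vec E_cf addrK.
by exists (vec v); rewrite -[LHS]vecK cf_tau Tv vecK.
Qed.

(** Presents [C'] as [C (x)_S k] without forming a tensor product: an element dies only if all its
    coordinates lie in the kernel of [sigma]. The converse follows from semilinearity, since the
    kernel of [sigma] acts as zero on [C']. *)
Definition reduction (C : lmodType L) (C' : lmodType L') (r : C -> C') : Prop :=
  [/\ {morph r : x y / x + y}, forall l c, r (l *: c) = psi l *: r c,
      forall y, exists x, r x = y
    & exists n (e : 'I_n -> C) f, dual_basis i e f /\
        forall c, r c = 0 -> forall j, sigma (f j c) = 0].

Section ReductionTheory.
Variables (C : lmodType L) (C' : lmodType L') (r : C -> C').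
Hypothesis rC : reduction r.

Let rD x y : r (x + y) = r x + r y. Proof. by case: rC. Qed.
Let rZ l x : r (l *: x) = psi l *: r x. Proof. by case: rC. Qed.

Lemma red0 : r 0 = 0. Proof. by apply: (addrI (r 0)); rewrite -rD !addr0. Qed.

Lemma redN x : r (- x) = - r x.
Proof. by apply/eqP; rewrite -addr_eq0 -rD addNr red0. Qed.

Lemma redB x y : r (x - y) = r x - r y. Proof. by rewrite rD redN. Qed.

(** The difference [c - c'] is a combination of the [e j] with coefficients in the kernel of
    [sigma], and [q \o h] kills such combinations. This is how maps descend along [r]. *)
Lemma red_slin_eq0 (N : lmodType L) (N' : zmodType) (q : N -> N') (h : C -> N) :
    {morph q : x y / x + y} -> slin i h ->
    (forall s x, sigma s = 0 -> q (i s *: x) = 0) ->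
  forall c c', r c = r c' -> q (h c) = q (h c').
Proof.
move=> qD hL qZ c c' rcc'.
have q0 : q 0 = 0 by apply: (addrI (q 0)); rewrite -qD !addr0.
suff q1 : q (h (c - c')) = 0.
  by rewrite -[c](subrK c') (slinD hL) qD q1 add0r.
have [_ _ _ [n [e [f [ef ker]]]]] := rC.
rewrite (ef.2 (c - c')) (slin_sum hL) (big_morph q qD q0) big1 // => j _.
by rewrite (slinZ hL) qZ // ker // redB rcc' subrr.
Qed.

Lemma red_sproj : sproj i' C'.
Proof.
have [_ _ rs [n [e [f [ef ker]]]]] := rC; have [s sK] := choice rs.
have fE j c c' : r c = r c' -> sigma (f j c) = sigma (f j c').
  move=> e0; apply/subr0_eq; rewrite -rmorphB -(dual_basisN ef) -(dual_basisD ef).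
  by rewrite ker // redB e0 subrr.
exists n, (r \o e), (fun j y => sigma (f j (s y))); split.
  move=> j a x y; have [b <-] := sigma_surj a.
  rewrite -rmorphM -rmorphD -ef.1; apply: fE.
  by rewrite sK rD rZ psi_i !sK.
move=> y; rewrite -{1}[y]sK {1}(ef.2 (s y)) (big_morph r rD red0).
by apply: eq_bigr => j _; rewrite rZ psi_i.
Qed.
End ReductionTheory.

Hypothesis redL : reduction (psi : L^o -> L'^o).

(** [R phi] is well defined because [S]-linear maps respect the kernels of reductions. For
    surjectivity, [phi' \o psi] is lifted to an [S]-linear map [L -> C] through the dual basis of
    [L] and then normalised at [1]. *)
Lemma reduction_omega (C : lmodType L) (C' : lmodType L') (r : C -> C') :
  reduction r -> exists R : omega i C -> omega i' C', reduction R /\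
    forall phi l, R phi (psi l) = r (phi l).
Proof.
move=> rC; have [rD rZ rs [m [c [g [cg ker]]]]] := rC.
have [_ _ _ [n [e [f [ef kerL]]]]] := redL.
have rZ0 s x : sigma s = 0 -> r (i s *: x) = 0.
  by move=> s0; rewrite rZ psi_i s0 rmorph0 scale0r.
have [s sK] := choice psi_surj.
have phiE (phi : omega i C) l l' : psi l = psi l' -> r (phi l) = r (phi l').
  exact: (red_slin_eq0 redL rD (omega_slin phi)).
have /choice[R RE] (phi : omega i C) :
    exists phi' : omega i' C', forall l, phi' l = r (phi (s l)).
  have kL : slin i' ((fun l => r (phi (s l))) : L'^o -> C').
    move=> b x y; have [a <-] := sigma_surj b.
    rewrite -psi_i -rZ -rD -(omega_slin phi); apply: phiE.
    rewrite sK; apply/esym.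
    have : psi (i a * s x + s y) = i' (sigma a) * x + y.
      by rewrite rmorphD rmorphM psi_i !sK.
    by rewrite psi_i.
  have k1 : r (phi (s 1)) = 0.
    by rewrite (phiE _ _ 1) ?omega_1 ?(red0 rC) // sK rmorph1.
  by exists (Omega kL k1).
have REp phi l : R phi (psi l) = r (phi l) by rewrite RE; apply: phiE; rewrite sK.
exists R; split=> //; split.
- by move=> x y; apply: omega_ext => l; rewrite omega_addE !RE -rD.
- move=> a x; apply: omega_ext => l; have [b <-] := psi_surj l.
  by rewrite omega_scaleE -rmorphM !REp omega_scaleE (redB rC) rZ.
- move=> phi'.
  have [h [hL hE]] : exists h : L^o -> C, slin i h /\ forall l, r (h l) = phi' (psi l).
    apply: (dual_basis_lift ef (act := fun s z => i' (sigma s) *: z)) => //.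
    + by move=> a x; rewrite rZ psi_i.
    + by move=> x y; rewrite rmorphD omegaD.
    + by move=> a x; rewrite [psi _]rmorphM psi_i omegaZ.
  have [phi pE] := omega_sub_inner hL; exists phi; apply: omega_ext => l.
  have [b <-] := psi_surj l.
  by rewrite REp pE (redB rC) rZ !hE rmorph1 omega_1 scaler0 subr0.
- have [N [E [F [EF FE]]]] := omega_dual_basis iC ef cg.
  exists N, E, F; split=> // phi R0 j; have [a [b ->]] := FE j.
  by apply: ker; rewrite -REp R0.
Qed.

(* Upwards, a splitting modulo the kernel of [sigma] lifts to a linear map out of
   [omega C] because coinduced modules receive all [S]-linear maps; the composite
   endomorphism [tau] of [omega C] reduces to the identity, hence is invertible. *)
Lemma reduction_relinj (C : lmodType L) (C' : lmodType L') (r : C -> C') :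
  reduction r -> (relinj i C <-> relinj i' C').
Proof.
move=> rC; have [rD rZ rs _] := rC.
have rZ0 s x : sigma s = 0 -> r (i s *: x) = 0.
  by move=> s0; rewrite rZ psi_i s0 rmorph0 scale0r.
have [R [RC RE]] := reduction_omega rC.
have [RD RZ Rs [n [e [f [ef ker]]]]] := RC; split=> [[g [gL gE]]|[g' [g'L g'E]]].
  have [s sK] := choice Rs.
  have grE phi : r (g (s (R phi))) = r (g phi).
    by apply: (red_slin_eq0 RC rD gL rZ0); rewrite sK.
  exists (fun phi' => r (g (s phi'))); split.
    move=> a x y; have [b <-] := sigma_surj a.
    have [x' <-] := Rs x; have [y' <-] := Rs y.
    by rewrite -psi_i -RZ -RD !grE gL rD rZ.
  move=> phi' m; have [phi <-] := Rs phi'; have [l <-] := psi_surj m.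
  by rewrite -RZ !grE RE -rZ -(redB rC) -gE.
have [g [gL gE]] : exists g : omega i C -> C, slin i g /\ forall phi, r (g phi) = g' (R phi).
  apply: (dual_basis_lift ef (act := fun s z => i' (sigma s) *: z)) => //.
  - by move=> a x; rewrite rZ psi_i.
  - by move=> x y; rewrite RD (slinD g'L).
  - by move=> a x; rewrite RZ psi_i (slinZ g'L).
pose tau := lin_of (cobound_linear gL).
have [tau0 taus] : (forall x, tau x = 0 -> x = 0) /\ (forall y, exists x, tau x = y).
  apply: (red_id_bij ef) => [s x y|j x]; first exact: linearP.
  apply: ker; rewrite (redB RC); suff -> : R (tau x) = R x by rewrite subrr.
  apply: omega_ext => m.
  have [l <-] := psi_surj m.
  by rewrite !RE /= (redB rC) rZ !gE RZ -g'E RE.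
have [h hE] : exists h : {linear omega i C -> omega i C}, forall x, h (tau x) = idfun x.
  by apply: lin_factor.
have tauh y : tau (h y) = y by have [x <-] := taus y; rewrite hE.
exists (g \o h); split=> [s x y|phi m] /=; first by rewrite linearP gL.
by rewrite -{1}(tauh phi) linearZ_LR.
Qed.

Lemma reduction_omegan n : exists R : omegan i n L^o -> omegan i' n L'^o, reduction R.
Proof.
elim: n => [|n [r rC]]; first by exists psi.
by have [R [RC _]] := reduction_omega rC; exists R.
Qed.

Hypothesis inj_k : injective_module (k^o : lmodType k).

Lemma finite_injdim_reduction : finite_injdim L^o -> finite_injdim L'^o.
Proof.
have [n [e [f [ef _]]]] : exists n (e : 'I_n -> L^o) f, dual_basis i e f /\
    forall c, psi c = 0 -> forall j, sigma (f j c) = 0 by case: redL.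
have pL : sproj i L^o by exists n, e, f.
have pL' := red_sproj redL.
case/finite_injdim_le => m /(injdim_omegan_relinj iC pL pL) rL.
have [R RC] := reduction_omegan m.
have [d idL'] := relinj_omegan_injdim (d := 0) iC' pL' pL' inj_k ((reduction_relinj RC).1 rL).
exact: injdim_le_finite idL'.
Qed.

Lemma finite_injdim_lift : finite_injdim (S^o : lmodType S) -> finite_injdim L'^o ->
  finite_injdim L^o.
Proof.
have [n [e [f [ef _]]]] : exists n (e : 'I_n -> L^o) f, dual_basis i e f /\
    forall c, psi c = 0 -> forall j, sigma (f j c) = 0 by case: redL.
have pL : sproj i L^o by exists n, e, f.
have pL' := red_sproj redL.
case/finite_injdim_le => d idS.
case/finite_injdim_le => m /(injdim_omegan_relinj iC' pL' pL') rL'.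
have [R RC] := reduction_omegan m.
have [q idL] := relinj_omegan_injdim iC pL pL idS ((reduction_relinj RC).2 rL').
exact: injdim_le_finite idL.
Qed.
End Reduction.

(** * Baer's criterion and restriction of scalars *)

Definition is_submod (R : pzRingType) (M : lmodType R) (W : M -> Prop) : Prop :=
  W 0 /\ forall a x y, W x -> W y -> W (a *: x + y).

Section SubmoduleTheory.
Variables (R : pzRingType) (M : lmodType R) (W : M -> Prop).
Hypothesis WM : is_submod W.

Lemma is_submodZ a x : W x -> W (a *: x).
Proof. by move=> Wx; rewrite -[_ *: _]addr0; apply: WM.2 => //; exact: WM.1. Qed.

Lemma is_submodD x y : W x -> W y -> W (x + y).
Proof. by move=> Wx Wy; rewrite -[x]scale1r; exact: WM.2. Qed.

Lemma is_submodB x y : W x -> W y -> W (x - y).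
Proof. by move=> Wx Wy; rewrite addrC -scaleN1r; exact: WM.2. Qed.

Lemma is_submod_sum (I : finType) (F : I -> M) : (forall j, W (F j)) -> W (\sum_j F j).
Proof. by move=> WF; apply: big_ind => //; [exact: WM.1 | exact: is_submodD]. Qed.

Definition submod_sort := {x : M | `[< W x >]}.
HB.instance Definition _ := SubType.on submod_sort.
HB.instance Definition _ := Choice.on submod_sort.

Let mk x (Wx : W x) : submod_sort := exist _ x (asboolT Wx).
Let valW (x : submod_sort) : W (val x) := asboolW (valP x).

Definition submod_zero : submod_sort := mk WM.1.
Definition submod_add (x y : submod_sort) : submod_sort := mk (is_submodD (valW x) (valW y)).
Definition submod_opp (x : submod_sort) : submod_sort := mk (is_submodB WM.1 (valW x)).
Definition submod_scale a (x : submod_sort) : submod_sort := mk (is_submodZ a (valW x)).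

Fact submod_addA : associative submod_add.
Proof. by move=> x y z; apply: val_inj; rewrite /= addrA. Qed.
Fact submod_addC : commutative submod_add.
Proof. by move=> x y; apply: val_inj; rewrite /= addrC. Qed.
Fact submod_add0 : left_id submod_zero submod_add.
Proof. by move=> x; apply: val_inj; rewrite /= add0r. Qed.
Fact submod_addN : left_inverse submod_zero submod_opp submod_add.
Proof. by move=> x; apply: val_inj; rewrite /= sub0r addNr. Qed.
Definition submod_zmod : Type := submod_sort.
HB.instance Definition _ := Choice.on submod_zmod.
HB.instance Definition _ :=
  GRing.isZmodule.Build submod_zmod submod_addA submod_addC submod_add0 submod_addN.

Fact submod_scaleA a b x : submod_scale a (submod_scale b x) = submod_scale (a * b) x.
Proof. by apply: val_inj; rewrite /= scalerA. Qed.
Fact submod_scale1 : left_id 1 submod_scale.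
Proof. by move=> x; apply: val_inj; rewrite /= scale1r. Qed.
Fact submod_scaleDr : right_distributive submod_scale submod_add.
Proof. by move=> a x y; apply: val_inj; rewrite /= scalerDr. Qed.
Fact submod_scaleDl x :
  forall a b, submod_scale (a + b) x = submod_add (submod_scale a x) (submod_scale b x).
Proof. by move=> a b; apply: val_inj; rewrite /= scalerDl. Qed.
HB.instance Definition _ := GRing.Zmodule_isLmodule.Build R submod_zmod
  submod_scaleA submod_scale1 submod_scaleDr submod_scaleDl.

Lemma injective_extend (E : lmodType R) (f : M -> E) : injective_module E ->
    (forall a x y, W x -> W y -> f (a *: x + y) = a *: f x + f y) ->
  exists h : {linear M -> E}, forall x, W x -> h x = f x.
Proof.
move=> injE fL.
have vL a (x y : submod_zmod) : val (a *: x + y) = a *: val x + val y by [].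
have gL a (x y : submod_zmod) : f (val (a *: x + y)) = a *: f (val x) + f (val y).
  exact: fL (valW x) (valW y).
have [h hE] := injE _ _ (lin_of vL) (lin_of gL) (@val_inj _ _ _).
by exists h => x Wx; exact: (hE (mk Wx)).
Qed.
End SubmoduleTheory.

Section Baer.
Variables (R : pzRingType) (E : lmodType R).

Definition baer_test : Prop :=
  forall (I : R^o -> Prop) (f : R -> E), is_submod I ->
    (forall (a x y : R), I x -> I y -> f (a * x + y) = a *: f x + f y) ->
  exists z, forall x : R, I x -> f x = x *: z.

Section Extension.
Variables (M N : lmodType R) (f : {linear M -> N}) (g : {linear M -> E}).
Hypotheses (testE : baer_test) (fI : injective f).

(** Partial extensions of [g] are handled as graphs, so that Zorn's lemma applies to inclusion of
    sets. For a linear relation, the condition at [0] amounts to being single-valued. *)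
Let good (G : set (N * E)) : Prop :=
  [/\ forall m, G (f m, g m),
      forall a x y x' y', G (x, y) -> G (x', y') -> G (a *: x + x', a *: y + y')
    & forall y, G (0, y) -> y = 0].

Lemma baer_maximal : exists G, good G /\ forall G', (G `<=` G')%classic -> good G' -> G' = G.
Proof.
have [G [PG maxG]] : exists A, (A = set0 \/ good A) /\
    forall B, (A `<` B)%classic -> ~ (B = set0 \/ good B).
  (* the disjunct [A = set0] accounts for the empty chain *)
  apply: (@Zorn_bigcup _ (fun A => A = set0 \/ good A)) => F FP Ftot.
  have [allF|/existsNP[X0 /not_implyP[FX0 X0n]]] := pselect (forall X, F X -> X = set0).
    by left; apply/seteqP; split=> // x [X /allF ->].
  right; have gX X x : F X -> X x -> good X.
    by move=> /FP[->|].
  have [//|gX0] : X0 = set0 \/ good X0 by exact: FP.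
  have [m0 _ _] := gX0.
  split=> [m|a x y x' y' [X FX Xx] [Y FY Yx]|y [X FX Xy]].
  - by exists X0.
  - have [XY|YX] := Ftot _ _ FX FY.
      exists Y => //; have [_ gY _] := gX _ _ FY Yx.
      by apply: gY => //; exact: XY.
    exists X => //; have [_ gXX _] := gX _ _ FX Xx.
    by apply: gXX => //; exact: YX.
  - by have [_ _ h] := gX _ _ FX Xy; exact: h.
have gG : good G.
  case: PG => // G0; exfalso.
  pose B : set (N * E) := fun u => exists m, u = (f m, g m).
  apply: (maxG B).
    by rewrite G0; split=> // /(_ (f 0, g 0)); apply; exists 0.
  right; split=> [m|a x y x' y' [m [-> ->]] [n [-> ->]]|y [m [e ->]]].
  - by exists m.
  - by exists (a *: m + n); rewrite !linearP.
  - by have -> : m = 0 by [apply: fI; rewrite linear0 e]; rewrite linear0.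
exists G; split=> // G' GG' gG'.
apply/seteqP; split=> //; apply: contrapT => nG'.
by apply: (maxG G'); [split | right].
Qed.

Lemma baer_extend : exists h : {linear N -> E}, forall x, h (f x) = g x.
Proof.
have [G [gG maxG]] := baer_maximal; have [Gfg GL G0] := gG.
have G00 : G (0, 0) by have := Gfg 0; rewrite !linear0.
have GZ a x y : G (x, y) -> G (a *: x, a *: y).
  by move=> Gx; have := GL a _ _ _ _ Gx G00; rewrite !addr0.
have Gfun x y y' : G (x, y) -> G (x, y') -> y = y'.
  move=> Gy Gy'; apply/subr0_eq/G0; have := GL (-1) _ _ _ _ Gy' Gy.
  by rewrite !scaleN1r addNr addrC.
have Gtot x0 : exists y, G (x0, y).
  pose I (a : R^o) := exists y, G ((a : R) *: x0, y).
  have /choice[k kE] (a : R) : exists y, I a -> G (a *: x0, y).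
    by have [[y Gy]|nI] := pselect (I a); [exists y | exists 0].
  have Isub : is_submod I.
    split; first by exists 0; rewrite scale0r.
    move=> a x y [u Gu] [v Gv]; exists (a *: u + v).
    by rewrite scalerDl -scalerA; exact: GL.
  have [z zE] : exists z, forall x : R, I x -> k x = x *: z.
    apply: (testE Isub) => a x y Ix Iy.
    apply: (Gfun ((a * x + y) *: x0)); first exact/kE/Isub.2.
    by rewrite scalerDl -scalerA; apply: GL; exact: kE.
  (* [G'] adjoins the value [z] at [x0]. It stays single-valued because [z] agrees with [G] on every
     multiple of [x0] already in the domain; maximality then puts [x0] itself in the domain. *)
  pose G' : set (N * E) := fun u => exists x y a, G (x, y) /\ u = (x + a *: x0, y + a *: z).
  have <- : G' = G.
    apply: maxG => [[x y] Gxy|]; first by exists x, y, 0; rewrite !scale0r !addr0.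
    split=> [m|a x y x' y'|y].
    - by exists (f m), (g m), 0; rewrite !scale0r !addr0.
    - move=> [u [v [b [Guv [-> ->]]]]] [u' [v' [b' [Guv' [-> ->]]]]].
      exists (a *: u + u'), (a *: v + v'), (a * b + b'); split; first exact: GL.
      by rewrite !scalerDr !scalerDl !scalerA; congr (_, _); rewrite addrACA.
    - move=> [u [v [b [Guv [/esym/eqP e ->]]]]].
      have Gb : G (b *: x0, - v).
        move: e; rewrite addrC addr_eq0 => /eqP ->.
        by rewrite -!scaleN1r; exact: GZ.
      by rewrite -zE ?(Gfun _ _ _ (kE b _) Gb) ?subrr //; exists (- v).
  exists z; exists 0, 0, 1; split=> //.
  by rewrite !scale1r !add0r.
have [h hG] := choice Gtot.
have hL a x y : h (a *: x + y) = a *: h x + h y.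
  by apply: (Gfun (a *: x + y)) => //; exact: GL.
by exists (lin_of hL) => x; exact: Gfun (hG _) (Gfg x).
Qed.
End Extension.

Lemma baer : baer_test -> injective_module E.
Proof. by move=> testE M N f g fI; exact: baer_extend. Qed.
End Baer.

Lemma field_injective (k : comPzRingType) :
  (forall x : k, x <> 0 -> exists y, y * x = 1) -> injective_module (k^o : lmodType k).
Proof.
move=> kF; apply: baer => I f Isub fL.
have f0 : f 0 = 0.
  have I0 := Isub.1; have := fL 1 0 0 I0 I0; rewrite mul1r scale1r addr0.
  by move=> /esym/(canRL (addrK _)); rewrite subrr.
have [[x [Ix x0]]|nI] := pselect (exists x, I x /\ x <> 0); last first.
  exists 0 => x Ix; rewrite scaler0.
  by have [->//|x0] := pselect (x = 0); case: nI; exists x.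
have [y yx] := kF x x0; exists (y * f x) => z Iz.
have -> : f z = f (z * y * x + 0) by rewrite -mulrA yx mulr1 addr0.
rewrite fL ?f0 ?addr0; last exact: Isub.1.
  by rewrite -[LHS]/(z * y * f x) -mulrA.
exact: Ix.
Qed.

Section Restriction.
Variables (S : comNzRingType) (L : pzRingType) (i : {rmorphism S -> L}).
Hypothesis iC : forall s a, i s * a = a * i s.
Hypothesis pL : sproj i L^o.

(** Restriction is right adjoint to [L (x)_S -], which is exact as [L] is projective over [S].
    Baer's test needs this only for ideals, where it can be carried out in coordinates. *)
Lemma restr_injective (J : lmodType L) : injective_module J -> injective_module (restr i J).
Proof.
move=> injJ; apply: baer => I f Isub fL.
have [n [e [b eb]]] := pL.
have f0 : f 0 = 0.
  have I0 := Isub.1; have := fL 1 0 0 I0 I0; rewrite mul1r scale1r addr0.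
  by move=> /esym/(canRL (addrK _)); rewrite subrr.
(* [W] is the left ideal [L * I] and [F] the extension of [f] to it. *)
pose W (l : L^o) := forall j, I (b j l).
pose F (l : L^o) : J := \sum_j (e j : L) *: (f (b j l) : J).
have bM j a x : b j (a * x) = \sum_p b p x * b j (a * e p).
  rewrite {1}(eb.2 x) mulr_sumr (dual_basis_sum eb); apply: eq_bigr => p _.
  by rewrite -(dual_basisZ eb); congr (b j _); rewrite -[RHS]/(i _ * _) !mulrA iC.
have fsum m (c d : 'I_m -> S) : (forall p, I (d p)) ->
    f (\sum_p c p * d p) = \sum_p c p *: f (d p) /\ I (\sum_p c p * d p).
  move=> Id; elim/big_ind2: _ => //; first by split=> //; exact: Isub.1.
    move=> x1 x2 y1 y2 [e1 I1] [e2 I2]; split; last exact: (is_submodD Isub).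
    by have := fL 1 _ _ I1 I2; rewrite mul1r !scale1r => ->; rewrite e1 e2.
  move=> p _; split; last exact: (is_submodZ Isub).
  by have := fL (c p) _ _ (Id p) Isub.1; rewrite f0 !addr0.
have Wsub : is_submod W.
  split; first by move=> j; rewrite (dual_basis0 eb); exact: Isub.1.
  move=> a x y Wx Wy j; rewrite (dual_basisD eb); apply: (is_submodD Isub) => //.
  rewrite -[_ *: _]/(a * _) bM; under eq_bigr => p _ do rewrite mulrC.
  exact: (fsum _ _ _ Wx).2.
have [h hE] : exists h : {linear L^o -> J}, forall x, W x -> h x = F x.
  apply: (injective_extend Wsub) => // a x y Wx Wy.
  have fD j : f (b j (a * x + y)) = f (b j (a * x)) + f (b j y).
    rewrite (dual_basisD eb).
    have Iax : I (b j (a * x)) by exact: (is_submodZ Wsub a Wx j).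
    by have := fL 1 _ _ Iax (Wy j); rewrite mul1r scale1r.
  rewrite /F -[a *: x + y]/(a * x + y).
  under eq_bigr => j _ do rewrite fD scalerDr.
  rewrite big_split /=; congr (_ + _).
  have fM j : f (b j (a * x)) = \sum_p b j (a * e p) *: f (b p x).
    by rewrite bM; under eq_bigr => p _ do rewrite mulrC; exact: (fsum _ _ _ Wx).1.
  under eq_bigr => j _ do rewrite fM scaler_sumr.
  rewrite exchange_big scaler_sumr; apply: eq_bigr => p _ /=.
  rewrite scalerA [in RHS](eb.2 (a * e p)) scaler_suml; apply: eq_bigr => j _.
  by rewrite restrZ !scalerA -[X in _ = X *: _]/(i _ * e j) iC.
exists (h 1) => x Ix.
have Wx : W (i x) by move=> j; rewrite -[i x]mulr1 (dual_basisZ eb) mulrC; exact: (is_submodZ Isub).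
have -> : x *: (h 1 : restr i J) = h (i x).
  by rewrite restrZ -linearZ_LR -[_ *: _]/(_ * _) mulr1.
rewrite hE // /F.
have fbE j : f (b j (i x)) = b j 1 *: f x.
  rewrite -[i x]mulr1 (dual_basisZ eb) mulrC.
  by have := fL (b j 1) _ _ Ix Isub.1; rewrite f0 !addr0.
under eq_bigr => j _ do rewrite fbE restrZ scalerA -iC.
rewrite -scaler_suml; transitivity ((1 : L) *: (f x : J)); first by rewrite scale1r.
by rewrite [X in X *: _](eb.2 1).
Qed.

Lemma restr_injdim n (J : lmodType L) : injdim_le n J -> injdim_le n (restr i J).
Proof.
elim: n J => [|n IHn] J /=; first exact: restr_injective.
case=> E [N [f [g [injE fg idN]]]].
exists (restr i E), (restr i N), (restr_map i f), (restr_map i g); split.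
- exact: restr_injective.
- exact: restr_exact.
- exact: IHn.
Qed.

Variables (k : comNzRingType) (sigma : {rmorphism S -> k}).
Hypothesis sigma_unit : forall s, sigma s <> 0 -> exists t, t * s = 1.

Lemma finite_injdim_base (x0 : L) : x0 <> 0 ->
  finite_injdim L^o -> finite_injdim (S^o : lmodType S).
Proof.
move=> x0_neq0 /finite_injdim_le[m /restr_injdim idL].
apply: (@injdim_le_finite _ m); apply: injdim_le_summand idL.
have [n [e [b eb]]] := pL.
(* Were every [b j (e p)] in the kernel of [sigma], the zero map would be the identity modulo that
   kernel, hence injective by [red_id_bij], against [x0 <> 0]. So one of them is a unit, and [e p]
   spans a copy of [S] retracted by a multiple of [b j]. *)
have [[j [p u]]|nu] := pselect (exists j p, sigma (b j (e p)) <> 0); last first.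
  case: x0_neq0.
  have : forall x : L^o, (fun=> 0 : L^o) x = 0 -> x = 0.
    apply: (red_id_bij (sigma := sigma) _ eb _ _).1.
    - by move=> s s1; apply: sigma_unit; rewrite s1; exact/eqP/oner_neq0.
    - by move=> s x y; rewrite scaler0 addr0.
    - move=> j x; rewrite sub0r (dual_basisN eb) rmorphN {1}(eb.2 x).
      rewrite (dual_basis_sum eb) rmorph_sum big1 ?oppr0 // => p _.
      rewrite (dual_basisZ eb) rmorphM; have [->|u] := pselect (sigma (b j (e p)) = 0).
        by rewrite mulr0.
      by case: nu; exists j, p.
  by move=> /(_ x0 erefl).
have [t tE] := sigma_unit u.
have fL (s x y : S^o) : (i (s *: x + y) * e p : restr i L^o)
    = s *: (i x * e p : restr i L^o) + (i y * e p : restr i L^o).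
  by rewrite rmorphD rmorphM mulrDl -mulrA.
have gL s (x y : restr i L^o) : t * b j (s *: x + y) = s *: (t * b j x : S^o) + t * b j y.
  by rewrite [b j _]eb.1 mulrDr; congr (_ + _); rewrite mulrCA.
exists (lin_of fL), (lin_of (N := S^o) (f := fun x : restr i L^o => t * b j x) gL) => s /=.
by rewrite -[_ * e p]/(i s *: e p) (dual_basisZ eb) mulrCA tE mulr1.
Qed.
End Restriction.

(** * Localization of modules over noetherian rings *)

(** Induction on the number of generators: the coefficients of [g ord0] in elements of [W] form a
    left ideal. Lifts [w] of its generators, together with generators of the part of [W] spanned by
    the other [g j], generate [W]. *)
Lemma noetherian_submod (R : pzRingType) (M : lmodType R) n (g : 'I_n -> M)
    (W : M -> Prop) :
    left_noetherian R -> is_submod W ->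
    (forall x, W x -> exists c : 'I_n -> R, x = \sum_j c j *: g j) ->
  exists m (h : 'I_m -> M), (forall j, W (h j)) /\
    forall x, W x -> exists c : 'I_m -> R, x = \sum_j c j *: h j.
Proof.
move=> noethR; elim: n g W => [|n IHn] g W Wsub Wg.
  exists 0%N, (fun=> 0); split=> [[]//|x /Wg[c ->]].
  by exists c; rewrite !big_ord0.
pose g' j := g (lift ord0 j).
pose I (a : R^o) := exists w c, W w /\ w = (a : R) *: g ord0 + \sum_j c j *: g' j.
have lin (a : R) (c d : 'I_n -> R) :
    \sum_j (a * c j + d j) *: g' j = a *: (\sum_j c j *: g' j) + \sum_j d j *: g' j.
  rewrite scaler_sumr -big_split; apply: eq_bigr => j _ /=.
  by rewrite scalerDl scalerA.
have Icl : GRing.submod_closed (fun a : R^o => `[< I a >] : bool).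
  split=> [|a x y /asboolP[w [c [Ww wE]]] /asboolP[v [d [Wv vE]]]]; apply/asboolP.
    exists 0, (fun=> 0); split; first exact: Wsub.1.
    by rewrite scale0r add0r big1 // => j _; rewrite scale0r.
  exists (a *: w + v), (fun j => a * c j + d j); split; first exact: Wsub.2.
  by rewrite lin wE vE scalerDl -scalerA scalerDr addrACA.
have [q [a [Ia genI]]] := noethR _ Icl.
have /choice[w wP] j : exists w, exists c, W w /\ w = (a j : R) *: g ord0 + \sum_j c j *: g' j.
  exact: asboolW (Ia j).
have [c0 wE] := choice wP.
have [|x [_ //]|m [h [Wh genh]]] := IHn g' (fun x => W x /\ exists c, x = \sum_j c j *: g' j).
  split=> [|b x y [Wx [c xE]] [Wy [d yE]]].
    split; first exact: Wsub.1.
    by exists (fun=> 0); rewrite big1 // => j _; rewrite scale0r.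
  split; first exact: Wsub.2.
  by exists (fun j => b * c j + d j); rewrite lin -xE -yE.
exists (q + m)%N, (fun j => match split j with inl a => w a | inr b => h b end).
split=> [j|x Wx].
  by case: split => t; [have [] := wE t | have [] := Wh t].
have [c xE] := Wg x Wx; rewrite big_ord_recl in xE.
have [|d dE] := genI (c ord0).
  by apply/asboolP; exists x, (fun j => c (lift ord0 j)); split.
have [|d' d'E] := genh (x - \sum_j d j *: w j).
  split.
    apply: (is_submodB Wsub) => //; apply: (is_submod_sum Wsub) => j.
    by apply: (is_submodZ Wsub); have [] := wE j.
  exists (fun t => -1 * (\sum_j d j * c0 j t) + c (lift ord0 t)).
  have wsum : \sum_j d j *: w j =
      c ord0 *: g ord0 + \sum_t (\sum_j d j * c0 j t) *: g' t.
    under eq_bigr => j _ do rewrite (wE j).2 scalerDr scalerA.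
    rewrite big_split /= dE scaler_suml; congr (_ + _).
    under [RHS]eq_bigr => t _ do rewrite scaler_suml.
    rewrite exchange_big; apply: eq_bigr => j _ /=.
    by rewrite scaler_sumr; apply: eq_bigr => t _; rewrite scalerA.
  by rewrite lin scaleN1r wsum xE opprD addrACA subrr add0r addrC.
exists (fun j => match split j with inl a => d a | inr b => d' b end).
rewrite big_split_ord /=.
under eq_bigr => j _ do rewrite (unsplitK (inl _ j)).
under [X in _ + X]eq_bigr => j _ do rewrite (unsplitK (inr _ j)).
by rewrite -d'E addrC subrK.
Qed.

Section ModuleLocalization.
Variables (S : comPzRingType) (L L' : pzRingType).
Variables (i : {rmorphism S -> L}) (phi : {rmorphism L -> L'}) (T : S -> Prop).
Hypothesis iC : forall s a, i s * a = a * i s.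
Hypothesis T1 : T 1.
Hypothesis TM : forall s t, T s -> T t -> T (s * t).
(** With [frac_ex] and [phi_eq0] this characterises [L'] as the localization of [L] at the central
    set [i T]. The axiomatic form covers converse rings as well. *)
Hypothesis TU : forall t, T t -> exists v, v * phi (i t) = 1.
Hypothesis frac_ex : forall y, exists t a, T t /\ phi (i t) * y = phi a.
Hypothesis phi_eq0 : forall a, phi a = 0 -> exists t, T t /\ i t * a = 0.

Local Notation "s *^ x" := (i s *: x) (at level 40).

Lemma central_scalerA (M : lmodType L) s t (x : M) : s *^ (t *^ x) = (s * t) *^ x.
Proof. by rewrite scalerA rmorphM. Qed.

Lemma central_scalerC (M : lmodType L) s a (x : M) : a *: (s *^ x) = s *^ (a *: x).
Proof. by rewrite !scalerA iC. Qed.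

Definition mdenom := {t : S | `[< T t >]}.
Definition mden t (Tt : T t) : mdenom := exist _ t (asboolT Tt).
Definition mdenP (s : mdenom) : T (val s) := asboolW (valP s).
Definition mden1 : mdenom := mden T1.
Definition mdenM (s t : mdenom) : mdenom := mden (TM (mdenP s) (mdenP t)).

Lemma phiC s a : phi (i s) * phi a = phi a * phi (i s).
Proof. by rewrite -!rmorphM iC. Qed.

Lemma phi_cancel t y z : T t -> phi (i t) * y = phi (i t) * z -> y = z.
Proof. by move=> /TU[v vt] /(congr1 ( *%R v)); rewrite !mulrA vt !mul1r. Qed.

Lemma phi_central s y : phi (i s) * y = y * phi (i s).
Proof.
have [t [a [Tt ta]]] := frac_ex y; apply: (phi_cancel Tt).
by rewrite mulrA phiC -mulrA ta mulrA ta phiC.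
Qed.

Section LocModule.
Variable M : lmodType L.

Definition locmod_rel (x y : M * mdenom) : bool :=
  `[< exists u : mdenom, val u *^ (val y.2 *^ x.1) = val u *^ (val x.2 *^ y.1) >].

Fact locmod_rel_refl : reflexive locmod_rel.
Proof. by move=> x; apply/asboolP; exists mden1. Qed.

Fact locmod_rel_sym : symmetric locmod_rel.
Proof. by move=> x y; apply/asboolP/asboolP => -[u e]; exists u. Qed.

Fact locmod_rel_trans : transitive locmod_rel.
Proof.
move=> [b t] [a s] [c w] /asboolP[u /= e] /asboolP[v /= f].
apply/asboolP; exists (mdenM (mdenM u v) t) => /=.
have := congr1 (fun x => (val v * val w) *^ x) e.
have := congr1 (fun x => (val u * val s) *^ x) f.
rewrite /= !central_scalerA => f' e'.
have -> : val u * val v * val t * val w = val v * val w * val u * val t.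
  by rewrite (AC 4 (2*4*1*3)).
have -> : val u * val v * val t * val s = val u * val s * val v * val t.
  by rewrite (AC 4 (1*4*2*3)).
by rewrite e' -f'; congr (i _ *: _); rewrite (AC 4 (3*4*1*2)).
Qed.

Canonical locmod_rel_equiv :=
  EquivRel locmod_rel locmod_rel_refl locmod_rel_sym locmod_rel_trans.

Definition locmod := {eq_quot locmod_rel}.
HB.instance Definition _ : EqQuotient _ locmod_rel locmod := EqQuotient.on locmod.
HB.instance Definition _ := Choice.on locmod.

Definition mfrac (x : M) (s : mdenom) : locmod := \pi_locmod (x, s).

Lemma mfrac_eqP x s y t : mfrac x s = mfrac y t <->
  exists u : mdenom, val u *^ (val t *^ x) = val u *^ (val s *^ y).
Proof.
by split=> [/eqmodP/= /asboolP //|e]; apply/eqmodP => /=; apply/asboolP.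
Qed.

Lemma mfrac_surj (X : locmod) : exists x s, mfrac x s = X.
Proof. by exists (repr X).1, (repr X).2; rewrite /mfrac -surjective_pairing reprK. Qed.

Lemma mfracW (P : locmod -> Prop) : (forall x s, P (mfrac x s)) -> forall X, P X.
Proof. by move=> H X; have [x [s <-]] := mfrac_surj X. Qed.

Lemma mfrac_repr x s : exists u : mdenom,
  val u *^ (val s *^ (repr (mfrac x s)).1) = val u *^ (val (repr (mfrac x s)).2 *^ x).
Proof. by apply/mfrac_eqP; rewrite /mfrac -surjective_pairing reprK. Qed.

Definition locmod_add (X Y : locmod) : locmod :=
  mfrac (val (repr Y).2 *^ (repr X).1 + val (repr X).2 *^ (repr Y).1)
    (mdenM (repr X).2 (repr Y).2).
Definition locmod_opp (X : locmod) : locmod := mfrac (- (repr X).1) (repr X).2.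

Fact locmod_addE x s y t :
  locmod_add (mfrac x s) (mfrac y t) = mfrac (val t *^ x + val s *^ y) (mdenM s t).
Proof.
have [u] := mfrac_repr x s; have [v] := mfrac_repr y t.
rewrite /locmod_add; case: (repr _) => y' t'; case: (repr _) => x' s' /= ev eu.
apply/mfrac_eqP; exists (mdenM u v) => /=.
rewrite !scalerDr; congr (_ + _).
  transitivity ((val v * val t * val t') *^ (val u *^ (val s *^ x'))).
    by rewrite !central_scalerA; congr (i _ *: _); rewrite !mulrA (AC 5 (2*4*5*1*3)).
  by rewrite eu !central_scalerA; congr (i _ *: _); rewrite !mulrA (AC 5 (4*1*5*3*2)).
transitivity ((val u * val s * val s') *^ (val v *^ (val t *^ y'))).
  by rewrite !central_scalerA; congr (i _ *: _); rewrite !mulrA (AC 5 (1*3*5*2*4)).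
by rewrite ev !central_scalerA; congr (i _ *: _); rewrite !mulrA (AC 5 (1*4*3*5*2)).
Qed.

Fact locmod_oppE x s : locmod_opp (mfrac x s) = mfrac (- x) s.
Proof.
have [u] := mfrac_repr x s; rewrite /locmod_opp; case: (repr _) => x' s' /= eu.
by apply/mfrac_eqP; exists u; rewrite !scalerN eu.
Qed.

Lemma mfrac_eq x y s t : x = y -> val s = val t -> mfrac x s = mfrac y t.
Proof. by move=> -> /val_inj ->. Qed.

Fact locmod_addA : associative locmod_add.
Proof.
elim/mfracW => x s; elim/mfracW => y t; elim/mfracW => z w; rewrite !locmod_addE.
apply: mfrac_eq => /=; last exact: mulrA.
rewrite !scalerDr !central_scalerA addrA; congr (_ + _ + _); congr (i _ *: _);
  exact: mulrC.
Qed.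

Fact locmod_addC : commutative locmod_add.
Proof.
elim/mfracW => x s; elim/mfracW => y t; rewrite !locmod_addE.
by apply: mfrac_eq => /=; [rewrite addrC | rewrite mulrC].
Qed.

Fact locmod_add0 : left_id (mfrac 0 mden1) locmod_add.
Proof.
elim/mfracW => x s; rewrite locmod_addE.
by apply: mfrac_eq => /=; rewrite ?mul1r // scaler0 rmorph1 scale1r add0r.
Qed.

Fact locmod_addN : left_inverse (mfrac 0 mden1) locmod_opp locmod_add.
Proof.
elim/mfracW => x s; rewrite locmod_oppE locmod_addE; apply/mfrac_eqP; exists mden1 => /=.
by rewrite scalerN addNr !scaler0.
Qed.

HB.instance Definition _ :=
  GRing.isZmodule.Build locmod locmod_addA locmod_addC locmod_add0 locmod_addN.

Lemma mfracD x s y t :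
  mfrac x s + mfrac y t = mfrac (val t *^ x + val s *^ y) (mdenM s t).
Proof. exact: locmod_addE. Qed.

Lemma mfracDl x y s : mfrac x s + mfrac y s = mfrac (x + y) s.
Proof.
rewrite mfracD; apply/mfrac_eqP; exists mden1 => /=.
by congr (_ *: _); rewrite -scalerDr central_scalerA.
Qed.

Lemma mfrac_scale u x s : mfrac (val u *^ x) (mdenM u s) = mfrac x s.
Proof.
by apply/mfrac_eqP; exists mden1; congr (_ *: _); rewrite central_scalerA /= mulrC.
Qed.

Lemma mfrac_eq0 x s : mfrac x s = 0 <-> exists u : mdenom, val u *^ x = 0.
Proof.
rewrite -[0]/(mfrac 0 mden1) mfrac_eqP.
by split=> -[u e]; exists u; move: e; rewrite /= rmorph1 scale1r !scaler0.
Qed.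

Lemma num_den_ex (y : L') : exists q : L * mdenom, phi (i (val q.2)) * y = phi q.1.
Proof. by have [t [a [Tt e]]] := frac_ex y; exists (a, mden Tt). Qed.
Definition num (y : L') : L := (sval (cid (num_den_ex y))).1.
Definition den (y : L') : mdenom := (sval (cid (num_den_ex y))).2.
Lemma num_denE y : phi (i (val (den y))) * y = phi (num y).
Proof. exact: svalP (cid (num_den_ex y)). Qed.

Definition locmod_scale (y : L') (X : locmod) : locmod :=
  mfrac (num y *: (repr X).1) (mdenM (den y) (repr X).2).

(** Independence of the chosen fraction: two numerators of [y], brought to a common denominator,
    have the same image under [phi], so some [w] of [T] annihilates their difference. *)
Lemma locmod_scaleE y (t : mdenom) a x s : phi (i (val t)) * y = phi a ->
  locmod_scale y (mfrac x s) = mfrac (a *: x) (mdenM t s).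
Proof.
move=> ta; have [u] := mfrac_repr x s.
rewrite /locmod_scale; case: (repr _) => x' s' /= eu.
have [w [Tw we]] : exists w, T w /\ i w * (i (val t) * num y - i (val (den y)) * a) = 0.
  apply: phi_eq0; rewrite rmorphB !rmorphM -ta -num_denE !mulrA phiC subrr //.
have {}we : i w * (i (val t) * num y) = i w * (i (val (den y)) * a).
  by apply/subr0_eq; rewrite -mulrBr.
apply/mfrac_eqP; exists (mdenM (mden Tw) u) => /=.
transitivity ((i w * (i (val t) * num y)) *: (val u *^ (val s *^ x'))).
  rewrite mulrA -rmorphM -scalerA !(central_scalerC _ (num y)) !central_scalerA.
  by congr (i _ *: _); rewrite !mulrA (AC 4 (1*3*2*4)).
rewrite we eu mulrA -rmorphM -scalerA !(central_scalerC _ a) !central_scalerA.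
by congr (i _ *: _); rewrite !mulrA (AC 4 (1*3*2*4)).
Qed.

Fact locmod_scaleA y z X : locmod_scale y (locmod_scale z X) = locmod_scale (y * z) X.
Proof.
elim/mfracW: X => x s.
rewrite (locmod_scaleE _ _ (num_denE z)) (locmod_scaleE _ _ (num_denE y)).
have e : phi (i (val (mdenM (den y) (den z)))) * (y * z) = phi (num y * num z).
  rewrite /= !rmorphM -!num_denE -!mulrA; congr (_ * _).
  by rewrite mulrA phi_central mulrA.
rewrite (locmod_scaleE _ _ e) scalerA.
by apply: mfrac_eq => //=; rewrite mulrA.
Qed.

Fact locmod_scale1 : left_id 1 locmod_scale.
Proof.
elim/mfracW => x s; rewrite (locmod_scaleE (t := mden1) (a := 1)) /=; last first.
  by rewrite rmorph1 mulr1.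
by rewrite scale1r; apply: mfrac_eq; rewrite //= mul1r.
Qed.

Fact locmod_scaleDr : right_distributive locmod_scale +%R.
Proof.
move=> y; elim/mfracW => a s; elim/mfracW => b t.
rewrite mfracD !(locmod_scaleE _ _ (num_denE y)) mfracD; apply/mfrac_eqP; exists mden1 => /=.
congr (_ *: _); rewrite !scalerDr !(central_scalerC _ (num y)) !central_scalerA; congr (_ + _);
  congr (i _ *: _).
  by rewrite !mulrA (AC 5 (1*2*4*3*5)).
by rewrite !mulrA (AC 5 (1*2*4*3*5)).
Qed.

Fact locmod_scaleDl X : {morph locmod_scale^~ X : y z / y + z}.
Proof.
move=> y z /=; elim/mfracW: X => x s.
pose d := mdenM (den y) (den z).
have ey : phi (i (val d)) * y = phi (i (val (den z)) * num y).
  by rewrite /= mulrC !rmorphM -num_denE mulrA.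
have ez : phi (i (val d)) * z = phi (i (val (den y)) * num z).
  by rewrite /= !rmorphM -num_denE mulrA.
have eyz : phi (i (val d)) * (y + z)
    = phi (i (val (den z)) * num y + i (val (den y)) * num z).
  by rewrite mulrDr ey ez rmorphD.
rewrite (locmod_scaleE _ _ ey) (locmod_scaleE _ _ ez) (locmod_scaleE _ _ eyz).
by rewrite mfracDl -scalerDl.
Qed.

HB.instance Definition _ := GRing.Zmodule_isLmodule.Build L' locmod
  locmod_scaleA locmod_scale1 locmod_scaleDr locmod_scaleDl.

Lemma mfracZ y (t : mdenom) a x s : phi (i (val t)) * y = phi a ->
  y *: mfrac x s = mfrac (a *: x) (mdenM t s).
Proof. exact: locmod_scaleE. Qed.

Lemma mfracZ_phi a x s : phi a *: mfrac x s = mfrac (a *: x) s.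
Proof.
rewrite (@mfracZ _ mden1 a) /=; last by rewrite !rmorph1 mul1r.
by apply: mfrac_eq; rewrite //= mul1r.
Qed.

Lemma mfrac_cancel (t : mdenom) (X Y : locmod) :
  phi (i (val t)) *: X = phi (i (val t)) *: Y -> X = Y.
Proof.
have [v vt] := TU (mdenP t); move/(congr1 ( *:%R v)).
by rewrite !scalerA vt !scale1r.
Qed.

End LocModule.

Section LocMap.
Variables (M N : lmodType L) (f : {linear M -> N}).

Definition locmap_fun (X : locmod M) : locmod N := mfrac (f (repr X).1) (repr X).2.

Lemma locmap_funE x s : locmap_fun (mfrac x s) = mfrac (f x) s.
Proof.
have [u] := mfrac_repr x s; rewrite /locmap_fun; case: (repr _) => x' s' /= eu.
by apply/mfrac_eqP; exists u; rewrite -!linearZ_LR eu.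
Qed.

Fact locmap_linear y X Z : locmap_fun (y *: X + Z) = y *: locmap_fun X + locmap_fun Z.
Proof.
elim/mfracW: X => x s; elim/mfracW: Z => z w.
rewrite (mfracZ _ _ (num_denE y)) mfracD !locmap_funE (mfracZ _ _ (num_denE y)) mfracD.
by rewrite linearD !linearZ_LR.
Qed.

Definition locmap : {linear locmod M -> locmod N} := lin_of locmap_linear.

Lemma locmapE x s : locmap (mfrac x s) = mfrac (f x) s.
Proof. exact: locmap_funE. Qed.
End LocMap.

Lemma locmap_exact (M N P : lmodType L) (f : {linear M -> N}) (g : {linear N -> P}) :
  short_exact f g -> short_exact (locmap f) (locmap g).
Proof.
move=> fg; have [_ gs ker] := fg; split.
- elim/mfracW => x s; rewrite locmapE => /mfrac_eq0[u e].
  apply/mfrac_eq0; exists u; apply: (short_exact_inj fg).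
  by rewrite linearZ_LR e linear0.
- elim/mfracW => z s; have [y <-] := gs z; exists (mfrac y s).
  by rewrite locmapE.
- elim/mfracW => y s; rewrite locmapE; split=> [/mfrac_eq0[u]|[X]].
    rewrite -linearZ_LR => /ker[x ux]; exists (mfrac x (mdenM u s)).
    by rewrite locmapE -ux mfrac_scale.
  elim/mfracW: X => x t; rewrite locmapE => /mfrac_eqP[u e].
  apply/mfrac_eq0; exists (mdenM u t).
  rewrite -linearZ_LR /= -central_scalerA e !linearZ_LR.
  by rewrite (short_exact_comp0 _ fg) !scaler0.
Qed.

Lemma mden_common n (s : 'I_n -> mdenom) :
  exists t : mdenom, forall j, exists a, val t = a * val (s j).
Proof.
elim: n s => [|n IHn] s; first by exists mden1 => -[].
have [t tP] := IHn (fun j => s (lift ord0 j)).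
exists (mdenM t (s ord0)) => j; have [p ->|->] := unliftP ord0 j; last first.
  by exists (val t).
have [a aE] := tP p; exists (val (s ord0) * a).
by rewrite /= aE [RHS]mulrAC [RHS]mulrC mulrA [LHS]mulrAC.
Qed.

(* Baer's criterion: a left ideal of [L'] is generated by the images of finitely many
   elements of [L], whose finitely many relations admit a common denominator. *)
Lemma loc_injective (M : lmodType L) : left_noetherian L ->
  injective_module M -> injective_module (locmod M).
Proof.
move=> noethL injM; apply: baer => I f Isub fL.
have f0 : f 0 = 0.
  have I0 := Isub.1; have := fL 1 0 0 I0 I0; rewrite mul1r scale1r addr0.
  by move=> /esym/(canRL (addrK _)); rewrite subrr.
have fZ a x : I x -> f (a * x) = a *: f x.
  by move=> Ix; have := fL a _ _ Ix Isub.1; rewrite f0 !addr0.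
have fsum m (c d : 'I_m -> L') : (forall p, I (d p)) ->
    f (\sum_p c p * d p) = \sum_p c p *: f (d p).
  move=> Id.
  suff [] : f (\sum_p c p * d p) = \sum_p c p *: f (d p) /\ I (\sum_p c p * d p) by [].
  elim/big_ind2: _ => //; first by split=> //; exact: Isub.1.
    move=> x1 x2 y1 y2 [e1 I1] [e2 I2]; split; last exact: (is_submodD Isub).
    by have := fL 1 _ _ I1 I2; rewrite mul1r !scale1r => ->; rewrite e1 e2.
  by move=> p _; split; [exact: fZ | exact: (is_submodZ Isub)].
pose J (a : L^o) := I (phi a).
have Jsub : is_submod J.
  split; first by rewrite /J rmorph0; exact: Isub.1.
  move=> a x y Jx Jy; rewrite /J; have -> : phi (a *: x + y) = phi a * phi x + phi y.
    exact: etrans (rmorphD phi _ _) (congr1 (+%R^~ (phi y)) (rmorphM phi a x)).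
  exact: Isub.2.
have [n [b [Jb genb]]] : exists n (b : 'I_n -> L^o), (forall j, J (b j)) /\
    forall x, J x -> exists c : 'I_n -> L, x = \sum_j c j *: b j.
  apply: (noetherian_submod (g := fun _ : 'I_1 => 1 : L^o) noethL Jsub) => x _.
  by exists (fun=> x); rewrite big_ord1 -[RHS]/(x * 1) mulr1.
have [K [kap [Kkap genK]]] : exists m (h : 'I_m -> 'rV[L]_n),
    (forall j, \sum_p h j 0 p *: b p = 0) /\
    forall x : 'rV[L]_n, \sum_p x 0 p *: b p = 0 ->
      exists c : 'I_m -> L, x = \sum_j c j *: h j.
  apply: (noetherian_submod (g := fun j => delta_mx 0 j : 'rV[L]_n)
    (W := fun x => \sum_p x 0 p *: b p = 0)) => //.
  - split; first by rewrite big1 // => p _; rewrite mxE scale0r.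
    move=> a x y Wx Wy; under eq_bigr => p _ do rewrite !mxE scalerDl -scalerA.
    by rewrite big_split /= -scaler_sumr Wx Wy scaler0 addr0.
  - by move=> x _; exists (fun j => x 0 j); exact: row_sum_delta.
have /choice[xs xsE] j : exists q : M * mdenom, f (phi (b j)) = mfrac q.1 q.2.
  by have [x [s <-]] := mfrac_surj (f (phi (b j))); exists (x, s).
have [s sP] := mden_common (fun j => (xs j).2).
have /choice[x xE] j : exists x, f (phi (b j)) = mfrac x s.
  have [a aE] := sP j; exists (a *^ (xs j).1); rewrite xsE.
  apply/mfrac_eqP; exists mden1; congr (_ *: _).
  by rewrite aE central_scalerA mulrC.
have /choice[u uE] j : exists u : mdenom, val u *^ (\sum_p kap j 0 p *: x p) = 0.
  have : mfrac (\sum_p kap j 0 p *: x p) s = 0.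
    have -> : mfrac (\sum_p kap j 0 p *: x p) s = \sum_p phi (kap j 0 p) *: f (phi (b p)).
      under [RHS]eq_bigr => p _ do rewrite xE mfracZ_phi.
      elim/big_ind2: _ => // [|x1 X1 x2 X2 <- <-]; last by rewrite mfracDl.
      by apply/mfrac_eq0; exists mden1; rewrite scaler0.
    rewrite -fsum //; have := Kkap j; move/(congr1 phi); rewrite rmorph0 raddf_sum => e.
    rewrite -[RHS]f0; congr f; rewrite -[RHS]e; apply: eq_bigr => p _.
    by rewrite -rmorphM.
  by case/mfrac_eq0 => v ve; exists v.
(* The numerators [x j] satisfy the relations [kap] only up to the factors [u]. Scaling all of them
   by the common multiple [v] makes the relations hold in [M] itself; [v] returns in the denominator
   of [z]. *)
have [v vP] := mden_common u.
have kL a (c d : 'rV[L]_K) :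
    \sum_j (a *: c + d) 0 j *: kap j = a *: (\sum_j c 0 j *: kap j) + \sum_j d 0 j *: kap j.
  rewrite scaler_sumr -big_split; apply: eq_bigr => j _ /=.
  by rewrite !mxE scalerDl scalerA.
pose kmap := lin_of kL.
have bL a (c d : 'rV[L]_n) : (\sum_j (a *: c + d) 0 j *: b j : L^o)
    = a *: (\sum_j c 0 j *: b j) + \sum_j d 0 j *: b j.
  rewrite scaler_sumr -big_split; apply: eq_bigr => j _ /=.
  by rewrite !mxE scalerDl scalerA.
have xL a (c d : 'rV[L]_n) : \sum_j (a *: c + d) 0 j *: (val v *^ x j)
    = a *: (\sum_j c 0 j *: (val v *^ x j)) + \sum_j d 0 j *: (val v *^ x j).
  rewrite scaler_sumr -big_split; apply: eq_bigr => j _ /=.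
  by rewrite !mxE scalerDl -!scalerA.
pose B := lin_of bL; pose X := lin_of xL.
have BK d : B (kmap d) = 0.
  rewrite -[kmap d]/(\sum_j d 0 j *: kap j) linear_sum big1 // => j _.
  by rewrite linearZ_LR [B _]Kkap scaler0.
have XK d : X (kmap d) = 0.
  rewrite -[kmap d]/(\sum_j d 0 j *: kap j) linear_sum big1 // => j _.
  rewrite linearZ_LR -[X _]/(\sum_p kap j 0 p *: (val v *^ x p)).
  under eq_bigr => p _ do rewrite central_scalerC.
  have [a ->] := vP j.
  by rewrite -scaler_sumr -central_scalerA uE !scaler0.
(* [coker kmap], generators modulo relations, is a copy of the ideal [J]. It replaces [J] because a
   map out of it is given by values on generators that respect the relations. *)
have [bb bbE] : exists h : {linear coker kmap -> L^o}, forall c, h (coker_pi kmap c) = B c.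
  apply: lin_factor => [y|c /coker_pi_eq0[d ->]]; first exact: coker_surj.
  exact: BK.
have [xx xxE] : exists h : {linear coker kmap -> M}, forall c, h (coker_pi kmap c) = X c.
  apply: lin_factor => [y|c /coker_pi_eq0[d ->]]; first exact: coker_surj.
  exact: XK.
have bbI : injective bb.
  move=> c d cd; apply/subr0_eq; have {cd} : bb (c - d) = 0 by rewrite linearB cd subrr.
  have [y <-] := coker_surj (c - d); rewrite bbE => /genK[r yE].
  apply/coker_pi_eq0; exists (\row_j r j); rewrite yE.
  by apply: eq_bigr => j _; rewrite mxE.
have [h hE] := injM _ _ bb xx bbI.
have deltaE (N : lmodType L) (g : 'I_n -> N) j :
    \sum_p (delta_mx 0 j : 'rV[L]_n) 0 p *: g p = g j.
  rewrite (bigD1 j) //= mxE !eqxx scale1r big1 ?addr0 // => p pj.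
  by rewrite mxE (negPf pj) andbF scale0r.
have hb j : (b j : L) *: h 1 = val v *^ x j.
  rewrite -linearZ_LR -[_ *: _]/(b j * 1) mulr1.
  by rewrite -(deltaE _ b) -[X in h X]bbE hE xxE -[LHS]/(\sum_p _) deltaE.
pose z := mfrac (h 1) (mdenM v s).
have bz j : f (phi (b j)) = phi (b j) *: z by rewrite mfracZ_phi hb mfrac_scale xE.
exists z => y Iy.
have [t [a [Tt ta]]] := frac_ex y.
apply: (@mfrac_cancel _ (mden Tt)); rewrite -fZ //= scalerA ta.
have [|c aE] := genb a; first by rewrite /J -ta; exact: (is_submodZ Isub).
have -> : phi a = \sum_j phi (c j) * phi (b j).
  by rewrite aE raddf_sum; apply: eq_bigr => j _; rewrite -rmorphM.
rewrite fsum // scaler_suml; apply: eq_bigr => j _.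
by rewrite bz scalerA.
Qed.

Lemma loc_injdim n (M : lmodType L) : left_noetherian L ->
  injdim_le n M -> injdim_le n (locmod M).
Proof.
move=> noethL; elim: n M => [|n IHn] M /=; first exact: loc_injective.
case=> E [N [f [g [injE fg idN]]]].
exists (locmod E), (locmod N), (locmap f), (locmap g); split.
- exact: loc_injective.
- exact: locmap_exact.
- exact: IHn.
Qed.

Lemma finite_injdim_localization : left_noetherian L ->
  finite_injdim L^o -> finite_injdim L'^o.
Proof.
move=> noethL /finite_injdim_le[n /(loc_injdim noethL) idL].
apply: (@injdim_le_finite _ n); apply: injdim_le_summand idL.
(* [locmod L^o] is a copy of [L']: [G] sends the fraction [a / s] to the element that [s] multiplies
   to [phi a], and it undoes [y |-> y *: (1 / 1)]. *)
have /choice[G GE] (X : locmod L^o) : exists y : L'^o, forall a s, X = mfrac a s ->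
    phi (i (val s)) * y = phi a.
  elim/mfracW: X => a s; have [v vs] := TU (mdenP s); exists (v * phi a) => b t.
  case/mfrac_eqP => u e; apply: (phi_cancel (mdenP u)).
  have e' : phi (i (val u)) * (phi (i (val t)) * phi a)
      = phi (i (val u)) * (phi (i (val s)) * phi b).
    by rewrite -!rmorphM; exact: (congr1 (phi : L^o -> L') e).
  have vC w c : phi (i w) * (v * c) = v * (phi (i w) * c).
    by rewrite mulrA phi_central mulrA.
  by rewrite !vC e' -vC [v * _]mulrA vs mul1r.
have FL a (x y : L'^o) : (a *: x + y : L') *: (mfrac (1 : L^o) mden1) =
    a *: ((x : L') *: mfrac (1 : L^o) mden1) + (y : L') *: mfrac (1 : L^o) mden1.
  by rewrite scalerDl scalerA.
have GL a X Y : G (a *: X + Y) = a *: G X + G Y.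
  elim/mfracW: X => x s; elim/mfracW: Y => y t.
  have Gx := GE _ _ _ (erefl (mfrac x s)); have Gy := GE _ _ _ (erefl (mfrac y t)).
  pose d := mdenM (mdenM (den a) s) t.
  apply: (phi_cancel (mdenP d)).
  rewrite (GE _ (val t *^ (num a *: x) + val (mdenM (den a) s) *^ y) d); last first.
    by rewrite (mfracZ _ _ (num_denE a)) mfracD.
  rewrite mulrDr [phi (_ + _)]rmorphD; congr (_ + _).
    rewrite -![_ *: x]/(_ * x) -[_ *: (_ * x)]/(_ * (_ * x)) -[a *: _]/(a * _).
    rewrite /= mulrC !rmorphM -!mulrA; congr (_ * _).
    rewrite -num_denE -Gx -mulrA; congr (_ * _).
    by rewrite !mulrA phi_central.
  rewrite -[_ *: y]/(_ * y) !rmorphM -!mulrA -Gy.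
  by congr (_ * (_ * _)).
exists (lin_of FL), (lin_of GL) => y /=.
rewrite (mfracZ _ _ (num_denE y)).
set q := mdenM _ _; apply: (phi_cancel (mdenP q)); rewrite (GE _ _ q erefl).
by rewrite -[_ *: _]/(_ * 1) mulr1 /= mulr1 num_denE.
Qed.
End ModuleLocalization.

(** * Localizations and fibres of finite projective algebras *)

Section RingMorphismOf.
Variables (R S : pzRingType) (f : R -> S).
Hypotheses (fD : {morph f : x y / x + y}) (fM : {morph f : x y / x * y}) (f1 : f 1 = 1).

Fact rmorphism_of_zmod : zmod_morphism f.
Proof.
have f0 : f 0 = 0 by apply: (addrI (f 0)); rewrite -fD !addr0.
move=> x y; rewrite fD; congr (_ + _); apply/eqP.
by rewrite -addr_eq0 -fD addNr f0.
Qed.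

Definition rmorphism_of : {rmorphism R -> S} :=
  HB.pack f (GRing.isZmodMorphism.Build R S f rmorphism_of_zmod)
    (GRing.isMonoidMorphism.Build R S f (f1, fM)).
End RingMorphismOf.

Definition op_rmorphism (L L' : pzRingType) (f : {rmorphism L -> L'}) :
    {rmorphism L^c -> L'^c} :=
  @rmorphism_of L^c L'^c f (rmorphD f) (fun x y => rmorphM f y x) (rmorph1 f).

Definition op_central (S : comPzRingType) (L : pzRingType) (i : {rmorphism S -> L}) :
    {rmorphism S -> L^c} :=
  @rmorphism_of S L^c i (rmorphD i)
    (fun x y => etrans (congr1 i (mulrC x y)) (rmorphM i y x)) (rmorph1 i).

(* [L] is the localization of an algebra finite over [R], or such a ring's converse. *)
Lemma left_noetherian_frac (R : comPzRingType) (M : lmodType R) n (g : 'I_n -> M)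
    (L : pzRingType) (kap : R -> L) (j : M -> L) :
    left_noetherian R -> (forall x, exists c : 'I_n -> R, x = \sum_t c t *: g t) ->
    {morph j : x y / x + y} -> (forall r x, j (r *: x) = kap r * j x) ->
    (forall y, exists u v a, u * v = 1 /\ v * y = j a) ->
  left_noetherian L.
Proof.
move=> noethR gM jD jZ frac_ex I [I0 IP].
have j0 : j 0 = 0 by apply: (addrI (j 0)); rewrite -jD !addr0.
have IZ a x : x \in I -> a * x \in I.
  by move=> Ix; have := IP a x 0 Ix I0; rewrite addr0.
have Wsub : is_submod (fun x : M => j x \in I).
  split; first by rewrite j0.
  move=> r x y Ix Iy; rewrite jD jZ; exact: (IP (kap r)).
have [m [h [hI genI]]] := noetherian_submod noethR Wsub (fun x _ => gM x).
exists m, (fun t => j (h t)); split=> // y Iy.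
have [u [v [a [uv ya]]]] := frac_ex y.
have [|c aE] := genI a; first by rewrite -ya; exact: IZ.
exists (fun t => u * kap (c t)).
rewrite -[y]mul1r -uv -mulrA ya aE (big_morph j jD j0) mulr_sumr.
by apply: eq_bigr => t _; rewrite jZ mulrA.
Qed.

Lemma left_noetherian_surj (L1 L2 : pzRingType) (h : {rmorphism L1 -> L2}) :
  (forall y, exists x, h x = y) -> left_noetherian L1 -> left_noetherian L2.
Proof.
move=> hs noeth1 I [I0 IP].
have [|m [g [gI genI]]] := noeth1 (fun x : L1^o => h x \in I).
  split=> [|a x y Ix Iy]; first by rewrite /in_mem /= rmorph0.
  rewrite /in_mem /= rmorphD; have := IP (h a) _ _ Ix Iy.
  by rewrite -[h a *: _]/(h a * h x) -rmorphM.
exists m, (fun j => h (g j)); split=> // y Iy.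
have [x hx] := hs y; have [|c xE] := genI x; first by rewrite /in_mem /= hx.
exists (fun j => h (c j)); rewrite -hx xE raddf_sum; apply: eq_bigr => j _.
exact: rmorphM.
Qed.

Section LocalAlgebra.
Variables (R : comPzRingType) (p : prime_ideal R).

Section Map.
Variables (A B : centralAlgType R) (h : A -> B).
Hypotheses (hD : {morph h : x y / x + y}) (hZ : forall r x, h (r *: x) = r *: h x).

Definition loc_fun (x : localization p A) : localization p B :=
  frac (h (repr x).1) (repr x).2.

Lemma loc_funE a s : loc_fun (frac a s) = frac (h a) s.
Proof.
have : frac (repr (frac a s)).1 (repr (frac a s)).2 = frac a s.
  by rewrite /frac -surjective_pairing reprK.
rewrite /loc_fun; case: (repr _) => b t /= /frac_eqP[u e].
by apply/frac_eqP; exists u; rewrite -!hZ e.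
Qed.

Lemma loc_funD : {morph loc_fun : x y / x + y}.
Proof.
elim/fracW => a s; elim/fracW => b t.
by rewrite [_ + _]loc_addE !loc_funE hD !hZ [RHS]loc_addE.
Qed.
End Map.

Variable A : centralAlgType R.
Local Notation S := (local_ring p).
Local Notation L := (localization p A).

Definition loc_central_fun : S -> L :=
  loc_fun (A := regular_algebra R) (B := A) (fun r : R => r *: (1 : A)).

Lemma loc_central_funE (r : R) s :
  loc_central_fun (frac (r : regular_algebra R) s) = frac (r *: (1 : A)) s.
Proof. by rewrite /loc_central_fun loc_funE // => a b; rewrite scalerA. Qed.

Fact loc_central_funD : {morph loc_central_fun : x y / x + y}.
Proof.
by apply: loc_funD => [a b|a b]; rewrite ?scalerDl ?scalerA.
Qed.

Fact loc_central_funM : {morph loc_central_fun : x y / x * y}.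
Proof.
elim/fracW => a s; elim/fracW => b t.
rewrite [_ * _]loc_mulE !loc_central_funE [RHS]loc_mulE; congr (frac _ _).
by rewrite -centralAl mul1r scalerA.
Qed.

Fact loc_central_fun1 : loc_central_fun 1 = 1.
Proof. by rewrite [1]/(frac _ _) loc_central_funE scale1r. Qed.

Definition loc_central : {rmorphism S -> L} :=
  rmorphism_of loc_central_funD loc_central_funM loc_central_fun1.

Lemma loc_centralE (r : R) s :
  loc_central (frac (r : regular_algebra R) s) = frac (r *: (1 : A)) s.
Proof. exact: loc_central_funE. Qed.

Lemma loc_centralC s x : loc_central s * x = x * loc_central s.
Proof.
elim/fracW: s => r s; elim/fracW: x => a t.
rewrite loc_centralE [LHS]loc_mulE [RHS]loc_mulE.
rewrite -centralAl -centralAr mul1r mulr1; congr (frac _ _).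
by apply: val_inj; rewrite /= mulrC.
Qed.

Lemma loc_central_mul (r : R) s a t :
  loc_central (frac (r : regular_algebra R) s) * frac a t = frac (r *: a) (denom_mul s t).
Proof. by rewrite loc_centralE [LHS]loc_mulE -centralAl mul1r. Qed.

Definition alg_dual_basis n (e : 'I_n -> A) (f : 'I_n -> A -> R) : Prop :=
  (forall j r x y, f j (r *: x + y) = r * f j x + f j y) /\
  (forall x, x = \sum_j f j x *: e j).

Section DualBasis.
Variables (n : nat) (e : 'I_n -> A) (f : 'I_n -> A -> R).
Hypothesis ef : alg_dual_basis e f.

Lemma alg_dual_basisD j : {morph f j : x y / x + y}.
Proof. by move=> x y; have := ef.1 j 1 x y; rewrite scale1r mul1r. Qed.

Lemma alg_dual_basisZ j r x : f j (r *: x) = r * f j x.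
Proof.
have f0 : f j 0 = 0 by apply: (addrI (f j 0)); rewrite -alg_dual_basisD !addr0.
by have := ef.1 j r x 0; rewrite f0 !addr0.
Qed.

Definition loc_functional j : L -> S :=
  loc_fun (A := A) (B := regular_algebra R) (f j).

Lemma loc_functionalE j a s :
  loc_functional j (frac a s) = frac (f j a : regular_algebra R) s.
Proof. by rewrite /loc_functional loc_funE // => r x; exact: alg_dual_basisZ. Qed.

Lemma frac_sum (B : centralAlgType R) (I : finType) (F : I -> B) s :
  frac (\sum_j F j) s = \sum_j frac (F j) s :> localization p B.
Proof.
elim/big_ind2: _ => // [|x1 X1 x2 X2 <- <-].
  by apply/frac_eqP; exists (denom1 p); rewrite !scaler0.
rewrite [RHS]loc_addE; apply/frac_eqP; exists (denom1 p) => /=; congr (_ *: _).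
by rewrite -scalerDr scalerA.
Qed.

Lemma loc_dual_basis :
  dual_basis loc_central (fun j => frac (e j) (denom1 p) : L^o) loc_functional.
Proof.
have fD j : {morph loc_functional j : x y / x + y}.
  by apply: loc_funD; [exact: alg_dual_basisD | move=> r x; exact: alg_dual_basisZ].
split=> [j s x y|].
  rewrite fD; congr (_ + _); elim/fracW: s => r s; elim/fracW: x => a t.
  rewrite [_ *: _]loc_central_mul !loc_functionalE [RHS]loc_mulE.
  by rewrite alg_dual_basisZ.
elim/fracW => a s.
rewrite {1}(ef.2 a) frac_sum; apply: eq_bigr => j _.
rewrite loc_functionalE [RHS]loc_central_mul; congr (frac _ _).
by apply: val_inj; rewrite /= mulr1.
Qed.
End DualBasis.
End LocalAlgebra.

(** * The residue field and the comparison map from [A_p] to the fibre *)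

Section Residue.
Variables (R : comPzRingType) (p : prime_ideal R).
Local Notation S := (local_ring p).
Local Notation k := (residue_field p).

Definition residue_fun (x : S) : k := \pi_k x.

Fact residue_funD : {morph residue_fun : x y / x + y}.
Proof. by move=> x y; rewrite /residue_fun rmorphD. Qed.
Fact residue_funM : {morph residue_fun : x y / x * y}.
Proof. by move=> x y; rewrite /residue_fun rmorphM. Qed.
Fact residue_fun1 : residue_fun 1 = 1.
Proof. by rewrite /residue_fun rmorph1. Qed.

Definition residue : {rmorphism S -> k} :=
  rmorphism_of residue_funD residue_funM residue_fun1.

Lemma residue_surj y : exists x, residue x = y.
Proof. by exists (repr y); rewrite /= /residue_fun reprK. Qed.

Lemma local_unit x : residue x <> 0 -> exists t, t * x = 1.
Proof.
elim/fracW: x => r s nr0.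
have rp : r \notin p.
  apply/negP => pr; apply: nr0; apply/eqP.
  rewrite -(rmorph0 residue) /= /residue_fun -Quotient.idealrBE subr0.
  by apply/asboolP; exists r, s.
exists (frac (val s : regular_algebra R) (exist _ r rp)).
rewrite [LHS]loc_mulE; apply/frac_eqP; exists (denom1 p) => /=.
by rewrite !calgZE /= !mul1r mulr1 mulrC.
Qed.

Lemma residue_field_inv (y : k) : y <> 0 -> exists z, z * y = 1.
Proof.
have [x <-] := residue_surj y => /local_unit[t tx]; exists (residue t).
by rewrite -rmorphM tx rmorph1.
Qed.

Lemma to_residue_fieldE (r : R) :
  to_residue_field p r = residue (frac (r : regular_algebra R) (denom1 p)).
Proof. by []. Qed.

Variable A : centralAlgType R.
Local Notation L := (localization p A).
Local Notation F := (fibre A p).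

Definition ptens (a : A) (c : k) : F :=
  \pi_(tensor A (residue_algebra p)) [:: (a, c : residue_algebra p)].

Lemma ptensDl a b c : ptens (a + b) c = ptens a c + ptens b c.
Proof.
rewrite [RHS]tensor_addE; apply/tensor_piP; exact: tensor_eq_Dl.
Qed.

Lemma ptensDr a c d : ptens a (c + d) = ptens a c + ptens a d.
Proof.
rewrite [RHS]tensor_addE; apply/tensor_piP; exact: tensor_eq_Dr.
Qed.

Lemma ptensM a b c d : ptens a c * ptens b d = ptens (a * b) (c * d).
Proof. by rewrite [LHS]tensor_mulE. Qed.

Lemma ptensZ r a c : ptens (r *: a) c = ptens a (to_residue_field p r * c).
Proof. by apply/tensor_piP; exact: tensor_eq_Z. Qed.

Lemma ptens_ind (P : F -> Prop) :
    P 0 -> (forall a c, P (ptens a c)) -> (forall x y, P x -> P y -> P (x + y)) ->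
  forall x, P x.
Proof.
move=> P0 P1 PD; elim/quotW; elim=> [|[a c] s IHs]; first exact: P0.
rewrite -cat1s -[\pi _]tensor_addE; apply: PD => //; exact: P1.
Qed.

Definition fib_central : {rmorphism k -> F} :=
  @rmorphism_of k F (fun c => ptens 1 c) (ptensDr 1)
    (fun c d => etrans (congr1 (fun a => ptens a (c * d)) (esym (mulr1 1))) (esym (ptensM 1 1 c d)))
    erefl.

Lemma fib_centralC c x : fib_central c * x = x * fib_central c.
Proof.
elim/ptens_ind: x => [|a d|x y xC yC]; first by rewrite mulr0 mul0r.
  by rewrite !ptensM mul1r mulr1 mulrC.
by rewrite mulrDr mulrDl xC yC.
Qed.

Definition rinv (s : denominator p) : k := residue (frac (1 : regular_algebra R) s).

Lemma rinvE s : to_residue_field p (val s) * rinv s = 1.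
Proof.
rewrite to_residue_fieldE -rmorphM -[RHS](rmorph1 residue); congr (residue _).
rewrite [LHS]loc_mulE; apply/frac_eqP; exists (denom1 p).
by rewrite !calgZE /= !mul1r.
Qed.

Lemma residue_frac (r : R) s :
  residue (frac (r : regular_algebra R) s) = to_residue_field p r * rinv s.
Proof.
rewrite to_residue_fieldE -rmorphM; congr (residue _).
rewrite [RHS]loc_mulE; apply/frac_eqP; exists (denom1 p).
by rewrite !calgZE /= !mul1r mulr1.
Qed.

Lemma rinvM s t : rinv (denom_mul s t) = rinv s * rinv t.
Proof.
rewrite -rmorphM; congr (residue _).
by rewrite [RHS]loc_mulE; congr (frac _ _); rewrite [RHS]mulr1.
Qed.

Lemma rinv_cancel s c : to_residue_field p (val s) * (rinv s * c) = c.
Proof. by rewrite mulrA rinvE mul1r. Qed.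

Definition to_fibre_fun (x : L) : F := ptens (repr x).1 (rinv (repr x).2).

(** Both inverses are written over the denominator [u * s * t]; the remaining scalars cross the
    tensor sign, where the relation [e] applies. *)
Lemma to_fibre_funE a s : to_fibre_fun (frac a s) = ptens a (rinv s).
Proof.
have : frac (repr (frac a s)).1 (repr (frac a s)).2 = frac a s.
  by rewrite /frac -surjective_pairing reprK.
rewrite /to_fibre_fun; case: (repr _) => b t /= /frac_eqP[u].
rewrite !scalerA => e.
have -> : rinv t = to_residue_field p (val u * val s) * rinv (denom_mul (denom_mul u s) t).
  by rewrite rinvM mulrA (rinvE (denom_mul u s)) mul1r.
have -> : rinv s = to_residue_field p (val u * val t) * rinv (denom_mul (denom_mul u s) t).
  have -> : rinv (denom_mul (denom_mul u s) t) = rinv (denom_mul u t) * rinv s.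
    by rewrite !rinvM mulrAC.
  by rewrite mulrA (rinvE (denom_mul u t)) mul1r.
by rewrite -!ptensZ e.
Qed.

Fact to_fibre_funD : {morph to_fibre_fun : x y / x + y}.
Proof.
elim/fracW => a s; elim/fracW => b t.
rewrite [_ + _]loc_addE !to_fibre_funE ptensDl !ptensZ rinvM rinv_cancel.
by rewrite [rinv s * _]mulrC rinv_cancel.
Qed.

Fact to_fibre_funM : {morph to_fibre_fun : x y / x * y}.
Proof.
elim/fracW => a s; elim/fracW => b t.
by rewrite [_ * _]loc_mulE !to_fibre_funE ptensM rinvM.
Qed.

Fact to_fibre_fun1 : to_fibre_fun 1 = 1.
Proof.
rewrite [1]/(frac _ _) to_fibre_funE; congr ptens.
by have := rinvE (denom1 p); rewrite /= rmorph1 mul1r.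
Qed.

Definition to_fibre : {rmorphism L -> F} :=
  rmorphism_of to_fibre_funD to_fibre_funM to_fibre_fun1.

Lemma to_fibreE a s : to_fibre (frac a s) = ptens a (rinv s).
Proof. exact: to_fibre_funE. Qed.

Lemma to_fibre_central s : to_fibre (loc_central p A s) = fib_central (residue s).
Proof.
elim/fracW: s => r s; rewrite loc_centralE to_fibreE residue_frac ptensZ //.
Qed.

Lemma to_fibre_surj y : exists x, to_fibre x = y.
Proof.
elim/ptens_ind: y => [|a c|_ _ [x <-] [y <-]]; first by exists 0; rewrite rmorph0.
  have [s <-] := residue_surj c; elim/fracW: s => r s.
  exists (frac (r *: a) s); rewrite to_fibreE residue_frac.
  by rewrite ptensZ.
by exists (x + y); rewrite rmorphD.
Qed.

Section FibreFunctional.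
Variable f : A -> R.
Hypotheses (fD : {morph f : x y / x + y}) (fZ : forall r x, f (r *: x) = r * f x).

(** The functional induced by [f] on [A (x)_R k(p)], on formal sums. It detects nonzero elements of
    the fibre without an explicit description of the tensor relation. *)
Definition fib_eval (s : seq (A * residue_algebra p)) : k :=
  \sum_(t <- s) to_residue_field p (f t.1) * (t.2 : k).

Lemma fib_eval_eq s t : tensor_eq s t -> fib_eval s = fib_eval t.
Proof.
rewrite /fib_eval.
have f0 : f 0 = 0 by apply: (addrI (f 0)); rewrite -fD !addr0.
elim=> {s t} //= [s t u _ -> _ -> //|s t st|s t u _ e|b|a a' b|a b b'|r a b].
- exact: perm_big.
- by rewrite !big_cat e.
- by rewrite big_seq1 big_nil f0 rmorph0 mul0r.
- by rewrite !big_cons big_nil !addr0 fD rmorphD mulrDl.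
- by rewrite !big_cons big_nil !addr0 mulrDr.
- rewrite !big_seq1 /= fZ rmorphM -mulrA mulrCA; congr (_ * _).
Qed.

Lemma to_fibre_eq0 x : to_fibre x = 0 ->
  residue (loc_fun (B := regular_algebra R) f x) = 0.
Proof.
elim/fracW: x => a s; rewrite to_fibreE loc_funE // => /tensor_piP/fib_eval_eq.
rewrite /fib_eval big_seq1 big_nil /= => e. 
exact: etrans (residue_frac _ _) e.
Qed.
End FibreFunctional.

Lemma reduction_to_fibre n (e : 'I_n -> A) f : alg_dual_basis e f ->
  reduction (loc_central p A) residue to_fibre (to_fibre : L^o -> F^o).
Proof.
move=> ef; split.
- exact: rmorphD.
- by move=> l c; rewrite -[l *: c]/(l * c) rmorphM.
- exact: to_fibre_surj.
- exists n, (fun j => frac (e j) (denom1 p) : L^o), (loc_functional (p := p) f).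
  split; first exact: loc_dual_basis.
  move=> c c0 j; apply: to_fibre_eq0 => //; first exact: alg_dual_basisD ef j.
  exact: alg_dual_basisZ ef j.
Qed.
End Residue.

Lemma op_dual_basis (S : comPzRingType) (L : pzRingType) (i : {rmorphism S -> L})
    n (e : 'I_n -> L) f :
  (forall s a, i s * a = a * i s) ->
  dual_basis i (e : 'I_n -> L^o) f -> dual_basis (op_central i) (e : 'I_n -> (L^c)^o) f.
Proof.
move=> iC ef; split=> [j s x y|x].
  have := ef.1 j s (x : L) (y : L); rewrite -[X in f j (X + _)]/(i s * (x : L)) iC.
  by [].
rewrite {1}(ef.2 (x : L)); apply: eq_bigr => j _.
exact: iC.
Qed.

(** * Transfer between [A_p] and its fibre, for left and right modules *)

Section LocalTheorem.
Variables (R : comPzRingType) (p : prime_ideal R) (A : centralAlgType R).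
Variables (n : nat) (e : 'I_n -> A) (f : 'I_n -> A -> R).
Hypothesis ef : alg_dual_basis e f.

Local Notation S := (local_ring p).
Local Notation k := (residue_field p).
Local Notation L := (localization p A).
Local Notation F := (fibre A p).

Let sigma_unit (s : S) : residue p s = 1 -> exists t, t * s = 1.
Proof. by move=> s1; apply: local_unit; rewrite s1; exact/eqP/oner_neq0. Qed.

Let redL := reduction_to_fibre p ef.

(** Converse rings have the same underlying groups, so the same map serves; since the image of [S]
    is central, so does the same dual basis. *)
Lemma op_reduction_to_fibre :
  reduction (op_central (loc_central p A)) (residue p) (op_rmorphism (to_fibre p A))
    (to_fibre p A : (L^c)^o -> (F^c)^o).
Proof.
have [_ _ ts [m [e' [f' [ef' ker]]]]] := redL; split=> //.
- exact: (rmorphD (to_fibre p A)).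
- by move=> l c; exact: (rmorphM (to_fibre p A) c l).
- exists m, e', f'; split=> //; apply: op_dual_basis ef'.
  exact: loc_centralC.
Qed.

Let op_loc_centralC s (a : L^c) :
  op_central (loc_central p A) s * a = a * op_central (loc_central p A) s.
Proof. exact/esym/loc_centralC. Qed.

Let op_fib_centralC c (a : F^c) :
  op_central (fib_central p A) c * a = a * op_central (fib_central p A) c.
Proof. exact/esym/fib_centralC. Qed.

Let op_to_fibre_central s : op_rmorphism (to_fibre p A) (op_central (loc_central p A) s)
  = op_central (fib_central p A) (residue p s).
Proof. exact: to_fibre_central. Qed.

Let op_to_fibre_surj (y : F^c) : exists x, op_rmorphism (to_fibre p A) x = y.
Proof. exact: to_fibre_surj. Qed.

Let inj_k : injective_module (k^o : lmodType k).
Proof. by apply: field_injective; exact: residue_field_inv. Qed.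

Lemma gorenstein_local_base : supp A p -> finite_injdim L^o -> gorenstein_local S.
Proof.
move=> [x x0]; apply: (finite_injdim_base (@loc_centralC _ p A) _ (@local_unit _ p) x0).
exists n, (fun j => frac (e j) (denom1 p) : L^o), (loc_functional (p := p) f).
exact: loc_dual_basis.
Qed.

Lemma fibre_finite_injdim : finite_injdim L^o -> finite_injdim F^o.
Proof.
apply: (finite_injdim_reduction (@loc_centralC _ p A) (@fib_centralC _ p A)
  (@residue_surj _ p) (@to_fibre_surj _ p A) (@to_fibre_central _ p A) _ redL) => //.
Qed.

Lemma fibre_finite_injdim_op : finite_injdim (L^c)^o -> finite_injdim (F^c)^o.
Proof.
apply: (finite_injdim_reduction op_loc_centralC op_fib_centralC
  (@residue_surj _ p) op_to_fibre_surj op_to_fibre_central _ op_reduction_to_fibre) => //.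
Qed.

Lemma localization_finite_injdim :
  gorenstein_local S -> finite_injdim F^o -> finite_injdim L^o.
Proof.
apply: (finite_injdim_lift (@loc_centralC _ p A) (@fib_centralC _ p A)
  (@residue_surj _ p) (@to_fibre_surj _ p A) (@to_fibre_central _ p A) _ redL) => //.
Qed.

Lemma localization_finite_injdim_op :
  gorenstein_local S -> finite_injdim (F^c)^o -> finite_injdim (L^c)^o.
Proof.
apply: (finite_injdim_lift op_loc_centralC op_fib_centralC
  (@residue_surj _ p) op_to_fibre_surj op_to_fibre_central _ op_reduction_to_fibre) => //.
Qed.

Hypothesis noethR : left_noetherian R.

Let gen x : exists c : 'I_n -> R, x = \sum_j c j *: e j.
Proof. by exists (fun j => f j x); rewrite {1}(ef.2 x). Qed.

Let of_alg (a : A) : L := frac a (denom1 p).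

Let of_algD : {morph of_alg : x y / x + y}.
Proof.
move=> a b; rewrite [RHS]loc_addE; apply/frac_eqP; exists (denom1 p) => /=.
by congr (_ *: _); rewrite mulr1 !scale1r.
Qed.

Let kap (r : R) : L := frac (r *: (1 : A)) (denom1 p).

Let kap_unit s : frac (1 : A) s * kap (val s) = 1.
Proof.
rewrite [LHS]loc_mulE; apply/frac_eqP; exists (denom1 p) => /=.
by rewrite mul1r mulr1 scale1r.
Qed.

Let kapC r x : kap r * x = x * kap r.
Proof.
by have := loc_centralC (frac (r : regular_algebra R) (denom1 p)) x; rewrite loc_centralE.
Qed.

Let kap_of_alg r a : of_alg (r *: a) = kap r * of_alg a.
Proof.
rewrite [RHS]loc_mulE -centralAl mul1r; congr (frac _ _).
by apply: val_inj; rewrite /= mulr1.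
Qed.

Let kap_frac a s : kap (val s) * frac a s = of_alg a.
Proof.
rewrite [LHS]loc_mulE -centralAl mul1r; apply/frac_eqP; exists (denom1 p) => /=.
by rewrite scale1r !mul1r.
Qed.

Lemma localization_noetherian : left_noetherian L.
Proof.
apply: (left_noetherian_frac noethR gen of_algD kap_of_alg).
elim/fracW => a s; exists (frac (1 : A) s), (kap (val s)), a.
by rewrite kap_unit kap_frac.
Qed.

Lemma localization_noetherian_op : left_noetherian L^c.
Proof.
apply: (@left_noetherian_frac R A n e L^c kap of_alg noethR gen of_algD).
  by move=> r a; rewrite kap_of_alg kapC.
elim/fracW => a s; exists (frac (1 : A) s), (kap (val s)), a.
split; first exact: etrans (kapC _ _) (kap_unit s).
exact: etrans (esym (kapC _ _)) (kap_frac a s).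
Qed.

Lemma fibre_noetherian : left_noetherian F.
Proof. exact: left_noetherian_surj (@to_fibre_surj _ p A) localization_noetherian. Qed.

Lemma fibre_noetherian_op : left_noetherian F^c.
Proof.
exact: (@left_noetherian_surj L^c F^c (op_rmorphism (to_fibre p A))
  (@to_fibre_surj _ p A) localization_noetherian_op).
Qed.

Lemma gorenstein_fibre : supp A p -> iwanaga_gorenstein L ->
  gorenstein_local S /\ iwanaga_gorenstein F.
Proof.
move=> pA [_ _ idL idLc]; split; first exact: gorenstein_local_base.
split; [exact: fibre_noetherian | exact: fibre_noetherian_op | |].
- exact: fibre_finite_injdim.
- exact: fibre_finite_injdim_op.
Qed.

Lemma gorenstein_localization : gorenstein_local S -> iwanaga_gorenstein F ->
  iwanaga_gorenstein L.
Proof.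
move=> gS [_ _ idF idFc].
split; [exact: localization_noetherian | exact: localization_noetherian_op | |].
- exact: localization_finite_injdim.
- exact: localization_finite_injdim_op.
Qed.
End LocalTheorem.

(** * From [A_m] to [A_p] for a prime [p] contained in [m] *)

Section ChangePrime.
Variables (R : comPzRingType) (m p : prime_ideal R) (A : centralAlgType R).
Hypothesis pm : {subset p <= m}.

Lemma denom_sub (s : denominator m) : val s \notin p.
Proof. by apply: contra (valP s) => /pm. Qed.

Definition sub_denom (s : denominator m) : denominator p := exist _ (val s) (denom_sub s).

Definition loc_sub_fun (x : localization m A) : localization p A :=
  frac (repr x).1 (sub_denom (repr x).2).

Lemma loc_sub_funE a s : loc_sub_fun (frac a s) = frac a (sub_denom s).
Proof.
have : frac (repr (frac a s)).1 (repr (frac a s)).2 = frac a s.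
  by rewrite /frac -surjective_pairing reprK.
rewrite /loc_sub_fun; case: (repr _) => b t /= /frac_eqP[u e].
by apply/frac_eqP; exists (sub_denom u).
Qed.

Fact loc_sub_funD : {morph loc_sub_fun : x y / x + y}.
Proof.
elim/fracW => a s; elim/fracW => b t.
rewrite [_ + _]loc_addE !loc_sub_funE [RHS]loc_addE; congr (frac _ _).
exact: val_inj.
Qed.

Fact loc_sub_funM : {morph loc_sub_fun : x y / x * y}.
Proof.
elim/fracW => a s; elim/fracW => b t.
rewrite [_ * _]loc_mulE !loc_sub_funE [RHS]loc_mulE; congr (frac _ _).
exact: val_inj.
Qed.

Fact loc_sub_fun1 : loc_sub_fun 1 = 1.
Proof.
rewrite [1]/(frac _ _) loc_sub_funE; congr (frac _ _).
exact: val_inj.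
Qed.

Definition loc_sub : {rmorphism localization m A -> localization p A} :=
  rmorphism_of loc_sub_funD loc_sub_funM loc_sub_fun1.

Lemma loc_subE a s : loc_sub (frac a s) = frac a (sub_denom s).
Proof. exact: loc_sub_funE. Qed.

Definition base_fun (r : R) : localization m A := frac (r *: (1 : A)) (denom1 m).

Fact base_funD : {morph base_fun : x y / x + y}.
Proof.
move=> x y; rewrite [RHS]loc_addE; apply/frac_eqP; exists (denom1 m) => /=.
by congr (_ *: _); rewrite mulr1 !scale1r scalerDl.
Qed.

Fact base_funM : {morph base_fun : x y / x * y}.
Proof.
move=> x y; rewrite [RHS]loc_mulE -centralAl mul1r scalerA; congr (frac _ _).
by apply: val_inj; rewrite /= mulr1.
Qed.

Fact base_fun1 : base_fun 1 = 1. Proof. by rewrite /base_fun scale1r. Qed.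

Definition base_map : {rmorphism R -> localization m A} :=
  rmorphism_of base_funD base_funM base_fun1.

Lemma base_mapE r : base_map r = frac (r *: (1 : A)) (denom1 m). Proof. by []. Qed.

Lemma base_mapC r x : base_map r * x = x * base_map r.
Proof.
by have := loc_centralC (frac (r : regular_algebra R) (denom1 m)) x; rewrite loc_centralE.
Qed.

Lemma loc_sub_base (s : denominator p) : frac (1 : A) s * loc_sub (base_map (val s)) = 1.
Proof.
rewrite base_mapE loc_subE [LHS]loc_mulE; apply/frac_eqP; exists (denom1 p) => /=.
by rewrite mul1r mulr1 scale1r.
Qed.

Lemma loc_sub_baseC s x : loc_sub (base_map s) * x = x * loc_sub (base_map s).
Proof.
rewrite base_mapE loc_subE; elim/fracW: x => a t.
rewrite [LHS]loc_mulE [RHS]loc_mulE -centralAl -centralAr mul1r mulr1.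
by congr (frac _ _); apply: val_inj; rewrite /= mulrC.
Qed.

Lemma loc_sub_frac y : exists s a, s \notin p /\ loc_sub (base_map s) * y = loc_sub a.
Proof.
elim/fracW: y => a s; exists (val s), (frac a (denom1 m)); split; first exact: (valP s).
rewrite base_mapE !loc_subE [LHS]loc_mulE -centralAl mul1r.
by apply/frac_eqP; exists (denom1 p) => /=; rewrite scale1r !mul1r.
Qed.

Lemma loc_sub_eq0 x : loc_sub x = 0 -> exists s, s \notin p /\ base_map s * x = 0.
Proof.
elim/fracW: x => a s; rewrite loc_subE => /frac_eqP[u e]; exists (val u).
split; first exact: (valP u).
rewrite base_mapE [LHS]loc_mulE -centralAl mul1r; apply/frac_eqP; exists (denom1 m) => /=.
by move: e; rewrite /= !scale1r !scaler0.
Qed.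

Let notp1 : 1 \notin p. Proof. exact: prime_pred1. Qed.
Let notpM s t : s \notin p -> t \notin p -> s * t \notin p.
Proof.
by move=> sp tp; apply/negP => /prime_predP/orP[]; apply/negP.
Qed.

(** [A_p] is the localization of [A_m] at the complement of [p] in [R]. Denominators are taken in
    [R] and not in [R_m], so [base_map] plays the part of the central map. *)
Lemma localization_le : left_noetherian (localization m A) ->
  finite_injdim (localization m A)^o -> finite_injdim (localization p A)^o.
Proof.
apply: (@finite_injdim_localization R _ _ base_map loc_sub (fun s => s \notin p)) => //.
- exact: base_mapC.
- by move=> t tp; exists (frac (1 : A) (exist _ t tp : denominator p)); exact: loc_sub_base.
- exact: loc_sub_frac.
- exact: loc_sub_eq0.
Qed.

Lemma localization_le_op : left_noetherian (localization m A)^c ->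
  finite_injdim ((localization m A)^c)^o -> finite_injdim ((localization p A)^c)^o.
Proof.
apply: (@finite_injdim_localization R _ _ (op_central base_map) (op_rmorphism loc_sub)
  (fun s => s \notin p)) => //.
- by move=> s a; exact/esym/base_mapC.
- move=> t tp; pose s : denominator p := exist _ t tp; exists (frac (1 : A) s).
  exact: (etrans (loc_sub_baseC t (frac (1 : A) s)) (loc_sub_base s)).
- move=> y; have [s [a [sp e]]] := loc_sub_frac y; exists s, a; split=> //.
  exact: etrans (esym (loc_sub_baseC _ _)) e.
- move=> x /loc_sub_eq0[s [sp e]]; exists s; split=> //.
  exact: etrans (esym (base_mapC _ _)) e.
Qed.

Lemma supp_sub : supp A p -> supp A m.
Proof.
move=> [x x0]; elim/fracW: x x0 => a s a0; exists (frac a (denom1 m)) => e.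
apply: a0; have := congr1 loc_sub e; rewrite loc_subE rmorph0 => /frac_eqP[u e'].
by apply/frac_eqP; exists u; move: e'; rewrite /= !scale1r !scaler0.
Qed.
End ChangePrime.

(** Zorn's lemma is applied to all primes containing [p], where the union of a nonempty chain is
    again prime. Membership in the support comes for free, because [supp_sub] makes the support
    closed upwards. *)
Lemma maximal_in_supp_ex (R : comPzRingType) (A : centralAlgType R) (p : prime_ideal R) :
  supp A p -> exists m : prime_ideal R, maximal_in_supp A m /\ {subset p <= m}.
Proof.
move=> pA.
pose good (G : set R) := exists q : prime_ideal R, {subset p <= q} /\ forall x, G x <-> x \in q.
have [G [PG maxG]] : exists G, (G = set0 \/ good G) /\
    forall B, (G `<` B)%classic -> ~ (B = set0 \/ good B).
  apply: (@Zorn_bigcup _ (fun G => G = set0 \/ good G)) => F FP Ftot.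
  have [allF|/existsNP[X0 /not_implyP[FX0 X0n]]] := pselect (forall X, F X -> X = set0).
    by left; apply/seteqP; split=> // x [X /allF ->].
  right; have gX X x : F X -> X x -> good X by move=> /FP[->|].
  have [//|[q0 [pq0 q0E]]] : X0 = set0 \/ good X0 by exact: FP.
  pose U := (\bigcup_(X in F) X)%classic.
  have UM a x : U x -> U (a * x).
    move=> [X FX Xx]; exists X => //; have [q [_ qE]] := gX _ _ FX Xx.
    by apply/qE/prime_predM/qE.
  have UD x y : U x -> U y -> U (x + y).
    move=> [X FX Xx] [Y FY Yy]; have [XY|YX] := Ftot _ _ FX FY.
      exists Y => //; have [q [_ qE]] := gX _ _ FY Yy.
      by apply/qE/prime_predD; apply/qE => //; exact: XY.
    exists X => //; have [q [_ qE]] := gX _ _ FX Xx.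
    by apply/qE/prime_predD; apply/qE => //; exact: YX.
  pose Q : {pred R} := fun x => `[< U x >].
  have QE x : U x <-> x \in Q by split=> [Ux|/asboolP //]; exact/asboolP.
  have Q0 : 0 \in Q by apply/QE; exists X0 => //; apply/q0E; exact: prime_pred0.
  have QD : {in Q &, forall x y, x + y \in Q}.
    by move=> x y /QE Ux /QE Uy; exact/QE/UD.
  have QM a : {in Q, forall x, a * x \in Q} by move=> x /QE Ux; exact/QE/UM.
  have Q1 : 1 \notin Q.
    apply/negP => /QE[X FX X1]; have [q [_ qE]] := gX _ _ FX X1.
    by have /qE := X1; apply/negP; exact: prime_pred1.
  have QP x y : x * y \in Q -> (x \in Q) || (y \in Q).
    move=> /QE[X FX Xxy]; have [q [_ qE]] := gX _ _ FX Xxy.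
    have /qE/prime_predP/orP[] := Xxy => /qE Xx; apply/orP; [left|right];
      by apply/QE; exists X.
  exists (PrimeIdeal Q0 QD QM Q1 QP); split=> [x px|x]; last exact: QE.
  by apply/QE; exists X0 => //; apply/q0E/pq0.
have [m [pm mE]] : good G.
  case: PG => // G0; exfalso; apply: (maxG (fun x => x \in p)).
    rewrite G0; split=> // /(_ 0); apply; exact: prime_pred0.
  by right; exists p; split.
exists m; split=> //; split=> [|q qA mq]; first exact: supp_sub pm pA.
apply: contrapT => nqm; apply: (maxG (fun x => x \in q)); last first.
  by right; exists q; split=> // x /pm/mq.
by split=> [x /mE/mq //|qG]; apply: nqm => x xq; exact/mE/qG.
Qed.

Theorem theorem6p8 (R : comPzRingType) (A : centralAlgType R)
    (hR : left_noetherian R) (hA : finite_projective A) :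
  [<-> gorenstein_algebra A;
       (forall p : prime_ideal R, supp A p ->
          gorenstein_local (local_ring p) /\ iwanaga_gorenstein (fibre A p));
       (forall m : prime_ideal R, maximal_in_supp A m ->
          gorenstein_local (local_ring m) /\ iwanaga_gorenstein (fibre A m))].
Proof.
have [n [e [f ef]]] : exists n (e : 'I_n -> A) f, alg_dual_basis e f.
  have [[n [g [_ gen]]] projA] := hA.
  have gL a (x y : 'rV[R]_n) : \sum_j (a *: x + y) 0 j *: g j
      = a *: (\sum_j x 0 j *: g j) + \sum_j y 0 j *: g j.
    rewrite scaler_sumr -big_split; apply: eq_bigr => j _ /=.
    by rewrite !mxE scalerDl scalerA.
  (* Splitting the surjection from [R^n] given by the generators yields a dual basis, the form of
     finite projectivity that localizes. *)
  have [|h hE] := projA _ _ (lin_of gL) (idfun : {linear A -> A}).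
    move=> y; have [c ->] := gen y isT; exists (\row_j c j).
    by apply: eq_bigr => j _; rewrite mxE.
  exists n, g, (fun j x => h x 0 j); split=> [j r x y|x].
    by rewrite linearP !mxE.
  by rewrite -[LHS]hE.
tfae.
- by move=> [_ gA] p pA; exact: gorenstein_fibre ef hR pA (gA p pA).
- by move=> gA m [mA _]; exact: gA.
(* Nothing is assumed at [p] itself: the property is lifted from the fibre at a maximal [m] above
   [p] to [A_m], and then descends to [A_p]. *)
- move=> gA; split=> // p pA.
  have [m [mmax pm]] := maximal_in_supp_ex pA.
  have [gS gF] := gA m mmax.
  have [nL nLc idL idLc] := gorenstein_localization ef hR gS gF.
  split.
  + exact: localization_noetherian ef hR.
  + exact: localization_noetherian_op ef hR.
  + exact: localization_le pm nL idL.
  + exact: localization_le_op pm nLc idLc.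
Qed.
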